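(* Let $n\ge2$. (a) Let $K\in\mathcal{K}^n$ be a non-symmetric convex body. Then for every neighbourhood $U$ of the identity in $GL(n)$ there exists a linear transformation $A\in U$ such that $AK$ is universal. (b) Let $K\in\mathcal{K}^n$ be a non-trivial convex body. Then for every neighbourhood $U$ of the identity in $GL(n)$ there exists a linear transformation $A\in U$ such that $AK$ is centrally universal.
   Context: $\mathcal{K}^n$ is the set of convex bodies (non-empty, compact, convex sets) in Euclidean space $\mathbb{R}^n$. A convex body is non-symmetric if it has no centre of symmetry (there is no point $c$ with $K-c=-(K-c)$), and non-trivial if it has more than one point. For $m\in\mathbb{N}_0=\{0,1,2,\dots\}$, $\mathcal{H}^n_m$ is the finite-dimensional real vector space of spherical harmonics of dimension $n$ and order $m$, i.e. restrictions to the unit sphere $S^{n-1}$ of harmonic homogeneous polynomials of degree $m$ on $\mathbb{R}^n$ (including zero). $\pi_m:C(S^{n-1})\to\mathcal{H}^n_m$ is the orthogonal projection with respect to the scalar product $(f,g)=\int_{S^{n-1}}fg\,d\sigma$, where $\sigma$ is spherical Lebesgue measure. $h_K$ denotes the restriction to $S^{n-1}$ of the support function $h(K,x)=\max\{\langle x,y\rangle:y\in K\}$. A convex body $K\in\mathcal{K}^n$ is universal if $\pi_mh_K\ne0$ for all $m\in\mathbb{N}_0$, and centrally universal if $\pi_mh_K\neq0$ for all even $m\in\mathbb{N}_0$. *)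

(* Defs.v *)
From HB Require Import structures.
From mathcomp Require Import all_boot all_order all_algebra.
From mathcomp Require Import interval_inference.
From mathcomp Require Import all_classical all_reals all_analysis.
From mathcomp Require Import measurable_realfun.
From mathcomp Require mpoly.

Set Implicit Arguments.
Unset Strict Implicit.
Unset Printing Implicit Defensive.

Import Order.TTheory GRing.Theory Num.Theory.
Import numFieldNormedType.Exports.

Local Open Scope classical_set_scope.
Local Open Scope ring_scope.

Section euclidean.
Context {R : realType} {n : nat}.
Implicit Types x y : 'rV[R]_n.

Definition dot x y : R := \sum_i x 0 i * y 0 i.

(* The library norm of ['rV[R]_n] is the sup norm. *)
Definition enorm x : R := Num.sqrt (dot x x).

Definition unit_sphere : set 'rV[R]_n := [set x | enorm x = 1].

End euclidean.
Arguments unit_sphere : clear implicits.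

Definition measure_row_display : measure_display -> measure_display.
Proof. exact. Qed.

Section measurable_row.
Context {d} {T : measurableType d}.
Variable n : nat.

Let coors : 'I_n -> 'rV[T]_n -> T := fun i x => x 0 i.

Let row_set0 : g_sigma_preimage coors set0.
Proof. exact: sigma_algebra0. Qed.

Let row_setC A : g_sigma_preimage coors A -> g_sigma_preimage coors (~` A).
Proof. exact: sigma_algebraC. Qed.

Let row_bigcup (F : _^nat) : (forall i, g_sigma_preimage coors (F i)) ->
  g_sigma_preimage coors (\bigcup_i (F i)).
Proof. exact: sigma_algebra_bigcup. Qed.

HB.instance Definition _ := @isMeasurable.Build (measure_row_display d)
  'rV[T]_n (g_sigma_preimage coors) row_set0 row_setC row_bigcup.

End measurable_row.

Section measurable_row_lemmas.

Lemma measurable_coord d (T : measurableType d) n (i : 'I_n) :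
  measurable_fun [set: 'rV[T]_n] (fun x => x 0 i).
Proof.
move=> _ Y mY; rewrite setTI; apply: sub_sigma_algebra => /=.
rewrite -bigcup_seq/=; exists i => /=; first by rewrite mem_index_enum.
by exists Y => //; rewrite setTI.
Qed.

Lemma measurable_fun_rowP d1 d2 (T1 : measurableType d1)
    (T2 : measurableType d2) n (f : T1 -> 'rV[T2]_n) :
  (forall i, measurable_fun [set: T1] (fun x => f x 0 i)) ->
  measurable_fun [set: T1] f.
Proof.
move=> mf; have prefS : g_sigma_preimage (fun i => (fun x : 'rV[T2]_n => x 0 i) \o f)
    `<=` measurable.
  apply: smallest_sub; first exact: sigma_algebra_measurable.
  case: n f mf => [|n] f mf; first by rewrite big_ord0.
  rewrite -bigcup_mkord_ord; apply: bigcup_sub => i Ii.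
  by move=> A [B mB <-]; exact: mf.
rewrite g_sigma_preimage_comp in prefS.
by move=> _ A mA; apply: prefS; exists A.
Qed.

End measurable_row_lemmas.

Section lebesgue_row.
Context {R : realType}.

Definition row_cons n (z : R * 'rV[R]_n) : 'rV[R]_n.+1 :=
  \row_i oapp (z.2 0) z.1 (unlift ord0 i).

Lemma measurable_row_cons n :
  measurable_fun [set: measurableTypeR R * 'rV[R]_n] (@row_cons n).
Proof.
apply: measurable_fun_rowP => i; under eq_fun do rewrite mxE.
case: unliftP => [j _|_] /=; last exact: measurable_fst.
by apply: (measurableT_comp (@measurable_coord _ R n j)).
Qed.

Definition row_uncons n (x : 'rV[R]_n.+1) : R * 'rV[R]_n :=
  (x 0 ord0, \row_i x 0 (lift ord0 i)).

Lemma row_consK n : cancel (@row_cons n) (@row_uncons n).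
Proof.
case=> a y; rewrite /row_uncons mxE unlift_none/=; congr pair.
by apply/rowP => i; rewrite !mxE liftK.
Qed.

Lemma measurable_row_uncons n :
  measurable_fun [set: 'rV[R]_n.+1]
    (@row_uncons n : _ -> measurableTypeR R * 'rV[R]_n).
Proof.
apply/measurable_fun_pairP; split; first exact: measurable_coord.
apply: measurable_fun_rowP => i /=; under eq_fun do rewrite mxE.
exact: measurable_coord.
Qed.

Section lebesgue_succ.
Context {n : nat}.
Variable mu : {sigma_finite_measure set 'rV[R]_n -> \bar R}.

Definition lebesgue_succ : set 'rV[R]_n.+1 -> \bar R :=
  pushforward (@lebesgue_measure R \x mu)%E (@row_cons n).

Let lebesgue_succ0 : lebesgue_succ set0 = 0%E.
Proof. by apply: measure0; exact: measurable_row_cons. Qed.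

Let lebesgue_succ_ge0 A : (0 <= lebesgue_succ A)%E.
Proof. by apply: measure_ge0; exact: measurable_row_cons. Qed.

Let lebesgue_succ_sigma_additive : semi_sigma_additive lebesgue_succ.
Proof.
by apply: measure_semi_sigma_additive; exact: measurable_row_cons.
Qed.

HB.instance Definition _ := isMeasure.Build _ _ _ lebesgue_succ
  lebesgue_succ0 lebesgue_succ_ge0 lebesgue_succ_sigma_additive.

Let lebesgue_succ_sigma_finite : sigma_finite setT lebesgue_succ.
Proof.
have /sigma_finiteP[F [TF ndF Foo]] := sigma_finiteT (@lebesgue_measure R).
have /sigma_finiteP[G [TG ndG Goo]] := sigma_finiteT mu.
exists (fun k => @row_uncons n @^-1` (F k `*` G k)).
  rewrite -preimage_bigcup (_ : \bigcup_k _ = setT) ?preimage_setT//.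
  rewrite -setXTT TF TG predeqE => -[x y]; split.
    by move=> [k _ []/= ? ?]; split; exists k.
  move=> [/= [k _ Fkx] [l _ Gly]]; exists (maxn k l) => //; split.
  - by move: x Fkx; exact/subsetPset/ndF/leq_maxl.
  - by move: y Gly; exact/subsetPset/ndG/leq_maxr.
move=> k; have [mF F_oo] := Foo k; have [mG G_oo] := Goo k; split.
  rewrite -[X in measurable X]setTI.
  by apply: (measurable_row_uncons measurableT); exact: measurableX.
rewrite /lebesgue_succ /pushforward -comp_preimage.
rewrite (_ : _ \o _ = id); last by apply/funext => z; exact: row_consK.
by rewrite preimage_id product_measure1E// lte_mul_pinfty// ge0_fin_numE.
Qed.

HB.instance Definition _ := Measure_isSigmaFinite.Build _ _ _
  lebesgue_succ lebesgue_succ_sigma_finite.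

End lebesgue_succ.

Fixpoint lebesgue_row n : {sigma_finite_measure set 'rV[R]_n -> \bar R} :=
  match n with
  | 0 => \d_(0 : 'rV[R]_0)
  | n'.+1 => lebesgue_succ (lebesgue_row n')
  end.

End lebesgue_row.

Section spherical_measure.
Context {R : realType} {n : nat}.

Lemma measurable_enorm : measurable_fun [set: 'rV[R]_n] (@enorm R n).
Proof.
have mdot : measurable_fun [set: 'rV[R]_n] (fun x => dot x x).
  by apply: measurable_sum => i; apply: measurable_funM; exact: measurable_coord.
rewrite (_ : @enorm R n = fun x => dot x x `^ (2^-1)).
  exact: (measurableT_comp (measurable_powR (2^-1)) mdot).
apply/funext => x; rewrite powR12_sqrt//.
by apply: sumr_ge0 => i _; rewrite -expr2 sqr_ge0.
Qed.

Definition unit_ball : set 'rV[R]_n := [set x | enorm x <= 1].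

Lemma measurable_unit_ball : measurable unit_ball.
Proof.
rewrite -[unit_ball]setTI (_ : unit_ball = @enorm R n @^-1` `]-oo, 1]).
  by apply: measurable_enorm => //; exact: measurable_itv.
by apply/seteqP; split => x /=; rewrite in_itv.
Qed.

Definition direction (x : 'rV[R]_n) : 'rV[R]_n := (enorm x)^-1 *: x.

Lemma measurable_direction : measurable_fun [set: 'rV[R]_n] direction.
Proof.
apply: measurable_fun_rowP => i.
under eq_fun do rewrite mxE -powR_inv1 ?sqrtr_ge0//.
apply: measurable_funM; last exact: measurable_coord.
exact: (measurableT_comp (measurable_powR (-1)) measurable_enorm).
Qed.

(* The spherical Lebesgue measure, by integration in polar coordinates: for [A]
   included in the unit sphere, [direction @^-1` A `&` unit_ball] is the cone of
   the points [t *: u], with [u] in [A] and [0 < t <= 1], whose Lebesgue measure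
   is the [n]-th part of the surface area of [A]. *)
Definition sphere_measure (A : set 'rV[R]_n) : \bar R :=
  (n%:R%:E * lebesgue_row n (direction @^-1` A `&` unit_ball))%E.

Let sphere_measure0 : sphere_measure set0 = 0%E.
Proof. by rewrite /sphere_measure preimage_set0 set0I measure0 mule0. Qed.

Let sphere_measure_ge0 A : (0 <= sphere_measure A)%E.
Proof. by rewrite /sphere_measure mule_ge0// lee_fin. Qed.

Let sphere_measure_sigma_additive : semi_sigma_additive sphere_measure.
Proof.
have := @measure_semi_sigma_additive _ _ _ (mscale n%:R%:nng
  (pushforward (mrestr (lebesgue_row n) measurable_unit_ball) direction)).
by apply; exact: measurable_direction.
Qed.

HB.instance Definition _ := isMeasure.Build _ _ _ sphere_measure
  sphere_measure0 sphere_measure_ge0 sphere_measure_sigma_additive.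

End spherical_measure.

Section spherical_harmonics.
(* The notations of [mpoly] clash with those of the analysis library. *)
Import -(notations) mpoly.
Context {R : realType} {n : nat}.
Local Notation S := (unit_sphere R n).

Definition laplacian (p : mpoly n R) : mpoly n R :=
  \sum_(i < n) mderiv i (mderiv i p).

(* A function on the sphere is encoded by its extension by 0 to the whole
   space: [f \_ S] is the restriction of [f] to the sphere. *)
Definition spherical_harmonic (m : nat) : set ('rV[R]_n -> R) :=
  [set (fun x => meval (x 0) p) \_ S | p in
    [set p : mpoly n R |
      p \is ishomog1 m (@mdeg n) /\ laplacian p = 0]].

Definition sphere_dot (f g : 'rV[R]_n -> R) : R :=
  \int[sphere_measure]_(x in S) (f x * g x).

(* The default value 0 is irrelevant for continuous [f]. *)
Definition harmonic_proj (m : nat) (f : 'rV[R]_n -> R) : 'rV[R]_n -> R :=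
  xget 0 [set g | spherical_harmonic m g /\
    forall q, spherical_harmonic m q -> sphere_dot (f - g) q = 0].

End spherical_harmonics.

Section convex_bodies.
Context {R : realType} {n : nat}.
Implicit Types (K : set 'rV[R]_n) (A : 'M[R]_n).

Definition convex_body K := [/\ K !=set0, compact K & convex_set K].

Definition symmetric_body K :=
  exists c, [set x - c | x in K] = [set - (x - c) | x in K].

Definition nontrivial_body K := exists x y, [/\ K x, K y & x <> y].

Definition support_function K (x : 'rV[R]_n) : R := sup [set dot x y | y in K].

Definition universal K := forall m : nat,
  harmonic_proj m (support_function K \_ (unit_sphere R n)) <> 0.

Definition centrally_universal K := forall m : nat, ~~ odd m ->
  harmonic_proj m (support_function K \_ (unit_sphere R n)) <> 0.

(* Points are row vectors: [x *m A^T] is the transpose of the column [A x]. *)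
Definition linear_image A K : set 'rV[R]_n := [set x *m A^T | x in K].

Definition GL : set 'M[R]_n := [set A | A \in unitmx].

End convex_bodies.
Arguments GL : clear implicits.

(* Main.v *)
(* By Baire's theorem it suffices that, for each degree [m] concerned, the linear
   maps [A] for which [h_{AK}] is not orthogonal to the harmonics of degree [m]
   are dense near the identity. Suppose that [h_{AK}] is orthogonal to them for
   all [A] in a nonempty open set of invertible maps. Differentiating along the
   elementary matrices [1 + s E_ij] gives, as [h] is homogeneous of degree 1,
     \int_S h (u_i d_j P - (n + m + 1) u_i u_j P) = 0
   for all harmonic [P] of degree [m]. For [P = d_i d_j Q], summing over [i] and
   [j] gives orthogonality to the harmonics [Q] of degree [m + 2]; taking for [P]
   the harmonic component of [u_i u_j Q] gives it for [Q] of degree [k = m - 2],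
   except for [k = 1]. For even [m], going down to degree 0, [\int_S h = 0], which
   is absurd since the width of a nontrivial body is positive somewhere. For odd
   [m], [h] is orthogonal to all harmonics of odd degree at least 3, hence its odd
   part is linear and [K] is symmetric. *)
From HB Require Import structures.
Require Import Defs.
From mathcomp Require Import all_boot all_order all_algebra.
From mathcomp Require Import interval_inference ring lra.
From mathcomp Require Import all_classical all_reals all_analysis.
From mathcomp Require Import measurable_realfun.
From mathcomp Require mpoly.

Set Implicit Arguments.
Unset Strict Implicit.
Unset Printing Implicit Defensive.

Import Order.TTheory GRing.Theory Num.Theory.
Import numFieldNormedType.Exports.

Local Open Scope classical_set_scope.
Local Open Scope ring_scope.

(** * Lebesgue measure on row vectors *)

(** A support function is Lipschitz but in general not differentiable, so the derivative along
    [1 + s E_ij] is never taken of [h]. Homogeneity turns integrals over the sphere into integrals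
    over the solid ball, where a linear change of variables carries the shear over to the polynomial
    and to a radial weight of class C^1; only these are expanded in [s]. The constant [n + m + 1] is
    the dimension plus the degree of homogeneity of [h P]. Elementary matrices change one coordinate
    at a time, so their Jacobian follows from Fubini's theorem and the affine formula on the line.
    The exception of degree 1 is inherent: translating [K] adds a linear function to [h], which
    alters its component of degree 1 only, so no other degree can control that one. It is harmless,
    since a linear odd part of [h] is exactly what a centre of symmetry produces. The passage from
    harmonics to all continuous functions avoids decomposing polynomials into harmonics:
    orthogonality of a function to all harmonics survives multiplication of the function by a
    coordinate. *)

Section pushforward_scaled.
Context {d1 d2} {T1 : measurableType d1} {T2 : measurableType d2} {R : realType}.
Variables (k : {nonneg R}) (m : {measure set T1 -> \bar R}) (f : T1 -> T2).

(** The measurability proof is an argument so that the measure structure can be inferred from the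
    term itself. *)
Definition pushforward_scaled of measurable_fun [set: T1] f : set T2 -> \bar R :=
  fun A => (k%:num%:E * m (f @^-1` A))%E.

Variable mf : measurable_fun [set: T1] f.

Let pushforward_scaled0 : pushforward_scaled mf set0 = 0%E.
Proof. by rewrite /pushforward_scaled preimage_set0 measure0 mule0. Qed.

Let pushforward_scaled_ge0 A : (0 <= pushforward_scaled mf A)%E.
Proof. by rewrite mule_ge0// lee_fin. Qed.

Let pushforward_scaled_sigma_additive : semi_sigma_additive (pushforward_scaled mf).
Proof.
have := @measure_semi_sigma_additive _ _ _ (mscale k (pushforward m f)).
by apply; exact: mf.
Qed.

HB.instance Definition _ := isMeasure.Build _ _ _ (pushforward_scaled mf)
  pushforward_scaled0 pushforward_scaled_ge0 pushforward_scaled_sigma_additive.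

End pushforward_scaled.

Section affine_change.
Context {R : realType}.
Local Notation mu := (@lebesgue_measure R).

Lemma measurable_affine (a c : R) :
  measurable_fun setT ((fun x => a * x + c) : measurableTypeR R -> measurableTypeR R).
Proof. by apply: measurable_funD => //; exact: measurable_funM. Qed.

(** The pushforward scaled by [|a|] agrees with Lebesgue measure on the half-open intervals, hence
    everywhere by uniqueness. For [a < 0] the preimage is open at the other end, which does not
    change its length. *)
Lemma lebesgue_measure_affine (a c : R) (A : set (measurableTypeR R)) :
  a != 0 -> measurable A ->
  mu ((fun x => a * x + c) @^-1` A) = (`|a|^-1%:E * mu A)%E.
Proof.
move=> a0 mA.
have na0 : 0 < `|a| by rewrite normr_gt0.
pose f := fun x : measurableTypeR R => (a * x + c : measurableTypeR R).
have mf : measurable_fun setT f by exact: measurable_affine.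
have : mu A = pushforward_scaled `|a|%:nng mu mf A.
  apply: lebesgue_measure_unique => // X [[x y] _ <-] /=.
  rewrite /pushforward_scaled /= /f.
  have -> : (fun x : R => a * x + c) @^-1` `]x, y]%classic =
     if 0 < a then `](x - c) / a, (y - c) / a]%classic
     else `[(y - c) / a, (x - c) / a[%classic.
    case: ifPn => ha; apply/seteqP; split => z /=; rewrite !in_itv /=.
    - by rewrite ltr_pdivrMr// ler_pdivlMr// ltrBlDr lerBrDr mulrC.
    - by rewrite ltr_pdivrMr// ler_pdivlMr// ltrBlDr lerBrDr mulrC.
    - have {}ha : a < 0 by rewrite lt_neqAle a0 leNgt.
      by rewrite ler_ndivrMr// ltr_ndivlMr// ltrBlDr lerBrDr mulrC andbC.
    - have {}ha : a < 0 by rewrite lt_neqAle a0 leNgt.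
      by rewrite ler_ndivrMr// ltr_ndivlMr// ltrBlDr lerBrDr mulrC andbC.
  case: ifPn => ha; rewrite !lebesgue_measure_itv /= !lte_fin.
  - rewrite ltr_pM2r ?invr_gt0// ltrD2r; case: ifP => _; last by rewrite mule0.
    rewrite -!EFinD -EFinM (ger0_norm (ltW ha)); congr EFin; field; exact: lt0r_neq0.
  - have {}ha : a < 0 by rewrite lt_neqAle a0 leNgt.
    rewrite ltr_nM2r ?invr_lt0// ltrD2r; case: ifP => _; last by rewrite mule0.
    rewrite -!EFinD -EFinM (ltr0_norm ha); congr EFin; field; exact: ltr0_neq0.
rewrite /pushforward_scaled /= => ->.
by rewrite muleA -EFinM mulVf ?gt_eqF// mul1e.
Qed.

End affine_change.

Section coordinate_change.
Context {R : realType}.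

Definition set_coord n (i : 'I_n) (v : R) (x : 'rV[R]_n) : 'rV[R]_n :=
  \row_j if j == i then v else x 0 j.

(** When [c] does not depend on the coordinate [i], this is an affine map on each line parallel to
    that axis. Elementary matrices and dilations are composed of such maps. *)
Definition coord_affine n (i : 'I_n) (a : R) (c : 'rV[R]_n -> R) (x : 'rV[R]_n) :=
  set_coord i (a * x 0 i + c x) x.

Lemma measurable_coord_affine n (i : 'I_n) a c : measurable_fun setT c ->
  measurable_fun [set: 'rV[R]_n] (coord_affine i a c).
Proof.
move=> mc; apply: measurable_fun_rowP => j; under eq_fun do rewrite mxE.
case: (j == i); last exact: measurable_coord.
by apply: measurable_funD => //; apply: measurable_funM => //; exact: measurable_coord.
Qed.

Lemma row_cons0 n (z : R) (y : 'rV[R]_n) : row_cons (z, y) 0 ord0 = z.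
Proof. by rewrite mxE unlift_none. Qed.

Lemma row_consS n (z : R) (y : 'rV[R]_n) j : row_cons (z, y) 0 (lift ord0 j) = y 0 j.
Proof. by rewrite mxE liftK. Qed.

Lemma set_coord_row_cons0 n v z (y : 'rV[R]_n) :
  set_coord ord0 v (row_cons (z, y)) = row_cons (v, y).
Proof. by apply/rowP => k; rewrite !mxE /=; case: unliftP => [l ->|->]. Qed.

Lemma set_coord_row_consS n (j : 'I_n) v z y :
  set_coord (lift ord0 j) v (row_cons (z, y)) = row_cons (z, set_coord j v y).
Proof.
apply/rowP => k; rewrite mxE; case: (unliftP ord0 k) => [l ->|->].
  by rewrite !row_consS mxE (inj_eq lift_inj).
by rewrite !row_cons0.
Qed.

Lemma lebesgue_row_xsection n (A : set 'rV[R]_n.+1) :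
  lebesgue_row n.+1 A = (\int[@lebesgue_measure R]_z
    lebesgue_row n ((fun y => row_cons (z, y)) @^-1` A))%E.
Proof.
rewrite /= /lebesgue_succ /pushforward /product_measure1.
apply: eq_integral => z _ /=.
by rewrite xsectionE.
Qed.

(** Tonelli's theorem: the construction integrates over the first coordinate last, and uniqueness of
    the product measure allows the other order. *)
Lemma lebesgue_row_ysection n (A : set 'rV[R]_n.+1) : measurable A ->
  lebesgue_row n.+1 A = (\int[lebesgue_row n]_y
    @lebesgue_measure R ((fun z => row_cons (z, y)) @^-1` A))%E.
Proof.
move=> mA.
have mB : measurable (@row_cons R n @^-1` A).
  by rewrite -[X in measurable X]setTI; exact: measurable_row_cons.
transitivity ((@lebesgue_measure R \x^ lebesgue_row n)%E (@row_cons R n @^-1` A)).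
  rewrite /= /lebesgue_succ /pushforward.
  apply: (@product_measure_unique _ _ _ _ _ _ _ (product_measure2 _ _)) => //.
  by move=> X Y mX mY; exact: product_measure2E.
rewrite /product_measure2; apply: eq_integral => z _ /=.
by rewrite ysectionE.
Qed.

(** The set is cut into slices that the map preserves: slices with fixed first coordinate if [i] is
    another one, which is the induction step, and lines along the first axis otherwise, where the
    one-dimensional formula applies. *)
Lemma lebesgue_row_coord_affine n (i : 'I_n) a c (A : set 'rV[R]_n) : a != 0 ->
  measurable_fun setT c -> (forall v x, c (set_coord i v x) = c x) ->
  measurable A ->
  lebesgue_row n (coord_affine i a c @^-1` A) = (`|a|^-1%:E * lebesgue_row n A)%E.
Proof.
move=> a0; elim: n i c A => [|n IHn] i c A; first by case: i.
move=> mc cE mA.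
have mT : measurable (coord_affine i a c @^-1` A).
  by rewrite -[X in measurable X]setTI; exact: measurable_coord_affine.
have ia0 : 0 <= `|a|^-1 by rewrite invr_ge0.
case: (unliftP ord0 i) => [j|] ei.
- rewrite !lebesgue_row_xsection -ge0_integralZl//; last first.
  - rewrite [X in measurable_fun _ X](_ : _ =
        lebesgue_row n \o xsection (@row_cons R n @^-1` A)).
      apply: (@measurable_fun_xsection _ _ (measurableTypeR R) _ _ (lebesgue_row n)).
      rewrite -[X in measurable X]setTI; exact: measurable_row_cons.
    by apply/funext => z /=; rewrite xsectionE.
  apply: eq_integral => z _.
  have mz : measurable_fun setT (fun y : 'rV[R]_n => row_cons (z, y)).
    by apply: measurableT_comp; [exact: measurable_row_cons|exact: measurable_pair1].
  rewrite -(IHn j (fun y => c (row_cons (z, y)))).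
  + congr (lebesgue_row _ _); apply/funext => y /=; congr A.
    by rewrite /coord_affine ei set_coord_row_consS row_consS.
  + exact: measurableT_comp.
  + by move=> v x; rewrite -set_coord_row_consS -ei cE.
  + by rewrite -[X in measurable X]setTI; exact: mz.
- rewrite !lebesgue_row_ysection// -ge0_integralZl//; last first.
  - rewrite [X in measurable_fun _ X](_ : _ =
        @lebesgue_measure R \o ysection (@row_cons R n @^-1` A)).
      apply: (@measurable_fun_ysection _ _ (measurableTypeR R) _ _ (@lebesgue_measure R)).
      rewrite -[X in measurable X]setTI; exact: measurable_row_cons.
    by apply/funext => z /=; rewrite ysectionE.
  apply: eq_integral => y _.
  have my : measurable_fun setT (fun z : measurableTypeR R => row_cons (z, y)).
    by apply: measurableT_comp; [exact: measurable_row_cons|exact: measurable_pair2].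
  (* Here [c] is independent of the first coordinate, so it may be evaluated with 0 in that
     place. *)
  rewrite -(@lebesgue_measure_affine R a (c (row_cons (0, y))))//; last first.
    by rewrite -[X in measurable X]setTI; exact: my.
  congr lebesgue_measure; apply/funext => z /=; congr A.
  by rewrite -(cE z (row_cons (0, y))) /coord_affine ei !set_coord_row_cons0 row_cons0.
Qed.

End coordinate_change.

Section measurable_continuous.
Context {R : realType} {n : nat}.
Local Notation V := 'rV[R]_n.

Lemma mx_norm_row_le (x : V) (r : R) :
  0 <= r -> (forall i, `|x 0 i| <= r) -> `|x| <= r.
Proof.
move=> r0 xr; rewrite /Num.norm /= mx_normrE; apply/bigmax_leP; split => //.
by case=> i j _ /=; rewrite ord1.
Qed.

Lemma measurable_setI_ord m (F : 'I_m -> set V) :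
  (forall i, measurable (F i)) -> measurable [set x | forall i, F i x].
Proof.
move=> mF; rewrite -[X in measurable X]setCK; apply: measurableC.
rewrite (_ : ~` _ = \bigcup_i ~` F i).
  apply: countable_bigcupT_measurable; first exact: countableP.
  by move=> i; exact: measurableC.
apply/seteqP; split => x /=; last by move=> [i _ /= nFi] xF; exact: nFi.
by move=> /existsNP[i nFi]; exists i.
Qed.

(* A continuous function is the pointwise limit of the maps
   [f (grid k (cell k x))], which are constant on each of countably many cells. *)
Let grid (k : nat) (z : 'rV[int]_n) : V := \row_i ((z 0 i)%:~R / k.+1%:R).
Let cell (k : nat) (x : V) : 'rV[int]_n := \row_i Num.floor (k.+1%:R * x 0 i).

Lemma measurable_continuous (f : V -> R) :
  continuous f -> measurable_fun setT f.
Proof.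
move=> cf.
apply: (@measurable_fun_cvg _ V _ _ (fun k x => f (grid k (cell k x)))) => [k|x _].
- move=> _ Y mY; rewrite setTI.
  pose S : set V := \bigcup_(z in [set z | Y (f (grid k z))])
    [set x | forall i, Num.floor (k.+1%:R * x 0 i) = z 0 i].
  suff -> : (fun x : V => f (grid k (cell k x))) @^-1` Y = S.
    rewrite /S bigcup_mkcond; apply: countable_bigcupT_measurable.
      exact: countableP.
    move=> z; case: ifPn => _; last exact: measurable0.
    apply: (@measurable_setI_ord n
      (fun i => [set x | Num.floor (k.+1%:R * x 0 i) = z 0 i])) => i.
    rewrite [X in measurable X](_ : _ = (fun x : V => k.+1%:R * x 0 i) @^-1`
        `[(z 0 i)%:~R, (z 0 i + 1)%:~R[).
      rewrite -[X in measurable X]setTI.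
      have : measurable_fun setT (fun x : V => k.+1%:R * x 0 i).
        by apply: measurable_funM => //; exact: measurable_coord.
      by apply => //; exact: measurable_itv.
    apply/seteqP; split => x /=; rewrite in_itv /=.
      by move=> <-; rewrite floor_le floorD1_gt.
    by move=> zx; apply/floor_def.
  apply/seteqP; split => x /=.
    by move=> Yx; exists (cell k x) => // i; rewrite mxE.
  move=> [z /= Yz xz]; suff -> : cell k x = z by [].
  by apply/rowP => i; rewrite mxE xz.
- apply: continuous_cvg; first exact: cf.
  apply/cvgrPdist_le => e e0; near=> k.
  apply: mx_norm_row_le (ltW e0) _ => i; rewrite !mxE.
  have k0 : (0 : R) < k.+1%:R by [].
  set F := (Num.floor _)%:~R.
  have -> : x 0 i - F / k.+1%:R = (k.+1%:R * x 0 i - F) / k.+1%:R.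
    by field; rewrite gt_eqF.
  rewrite normrM normfV (gtr0_norm k0) ler_pdivrMr// ger0_norm ?subr_ge0 ?floor_le//.
  apply: (@le_trans _ _ 1).
    by rewrite lerBlDr addrC -[1]/(1%:~R) -intrD ltW// floorD1_gt.
  rewrite -ler_pdivrMl// mulr1 ltW//.
  rewrite -ltf_pV2 ?posrE ?invr_gt0// invrK.
  near: k; exact: (near_infty_natSinv_lt (PosNum e0)).
Unshelve. all: by end_near. Qed.

End measurable_continuous.

Section continuous_functions.
Context {R : realType} {T : topologicalType}.
Implicit Types f g : T -> R.

Lemma fun_continuousD f g : continuous f -> continuous g ->
  continuous (fun x => f x + g x).
Proof. by move=> cf cg x; apply: continuousD; [exact: cf|exact: cg]. Qed.

Lemma fun_continuousB f g : continuous f -> continuous g ->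
  continuous (fun x => f x - g x).
Proof. by move=> cf cg x; apply: continuousB; [exact: cf|exact: cg]. Qed.

Lemma fun_continuousM f g : continuous f -> continuous g ->
  continuous (fun x => f x * g x).
Proof. by move=> cf cg x; apply: continuousM; [exact: cf|exact: cg]. Qed.

Lemma continuous_sum (I : Type) (s : seq I) (F : I -> T -> R) :
  (forall i, continuous (F i)) -> continuous (fun x => \sum_(i <- s) F i x).
Proof.
move=> cF; elim: s => [|i s IHs].
  by under eq_fun do rewrite big_nil; exact: cst_continuous.
by under eq_fun do rewrite big_cons; exact: fun_continuousD.
Qed.

Lemma continuous_prod (I : Type) (s : seq I) (F : I -> T -> R) :
  (forall i, continuous (F i)) -> continuous (fun x => \prod_(i <- s) F i x).
Proof.
move=> cF; elim: s => [|i s IHs].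
  by under eq_fun do rewrite big_nil; exact: cst_continuous.
by under eq_fun do rewrite big_cons; exact: fun_continuousM.
Qed.

Lemma fun_continuousX f k : continuous f -> continuous (fun x => f x ^+ k).
Proof.
move=> cf; elim: k => [|k IHk]; first exact: cst_continuous.
by under eq_fun do rewrite exprS; exact: fun_continuousM.
Qed.

Lemma fun_continuous_norm f : continuous f -> continuous (fun x => `|f x|).
Proof. by move=> cf x; apply: continuous_comp; [exact: cf|exact: norm_continuous]. Qed.

Lemma fun_continuous_max0 f : continuous f -> continuous (fun x => Num.max 0 (f x)).
Proof.
move=> cf; rewrite (_ : (fun x => _) = (fun x => 2^-1 * (f x + `|f x|))).
  apply: fun_continuousM; first exact: cst_continuous.
  by apply: fun_continuousD => //; exact: fun_continuous_norm.
apply/funext => x; case: (leP 0 (f x)) => h.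
  by rewrite ger0_norm//; field.
by rewrite ltr0_norm// subrr mulr0.
Qed.

End continuous_functions.

Section euclidean_norm.
Context {R : realType} {n : nat}.
Local Notation V := 'rV[R]_n.
Implicit Types x y z : V.

Lemma dotC x y : dot x y = dot y x.
Proof. by apply: eq_bigr => i _; rewrite mulrC. Qed.

Lemma dotDl x y z : dot (x + y) z = dot x z + dot y z.
Proof. by rewrite -big_split; apply: eq_bigr => i _; rewrite mxE mulrDl. Qed.

Lemma dotZl a x y : dot (a *: x) y = a * dot x y.
Proof. by rewrite big_distrr; apply: eq_bigr => i _; rewrite mxE /= mulrA. Qed.

Lemma dotDr x y z : dot x (y + z) = dot x y + dot x z.
Proof. by rewrite !(dotC x) dotDl. Qed.

Lemma dotZr a x y : dot x (a *: y) = a * dot x y.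
Proof. by rewrite !(dotC x) dotZl. Qed.

Lemma dotNl x y : dot (- x) y = - dot x y.
Proof. by rewrite -scaleN1r dotZl mulN1r. Qed.

Lemma dotNr x y : dot x (- y) = - dot x y.
Proof. by rewrite -scaleN1r dotZr mulN1r. Qed.

Lemma dot0l x : dot 0 x = 0.
Proof. by rewrite -[0](scale0r x) dotZl mul0r. Qed.

Lemma dot0r x : dot x 0 = 0.
Proof. by rewrite dotC dot0l. Qed.

Lemma dotxx_ge0 x : 0 <= dot x x.
Proof. by apply: sumr_ge0 => i _; rewrite -expr2 sqr_ge0. Qed.

Lemma sqr_coord_le x i : (x 0 i) ^+ 2 <= dot x x.
Proof.
rewrite expr2 /dot (bigD1 i)//= lerDl; apply: sumr_ge0 => j _.
by rewrite -expr2 sqr_ge0.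
Qed.

Lemma dotxx_eq0 x : (dot x x == 0) = (x == 0).
Proof.
apply/eqP/eqP => [h|->]; last exact: dot0l.
apply/rowP => i; rewrite mxE; apply/eqP; rewrite -sqrf_eq0.
by apply/eqP/le_anti; rewrite sqr_ge0 -h sqr_coord_le.
Qed.

Lemma sqr_enorm x : enorm x ^+ 2 = dot x x.
Proof. by rewrite sqr_sqrtr// dotxx_ge0. Qed.

Lemma enorm_ge0 x : 0 <= enorm x.
Proof. exact: sqrtr_ge0. Qed.

Lemma enorm_eq0 x : (enorm x == 0) = (x == 0).
Proof. by rewrite -sqrf_eq0 sqr_enorm dotxx_eq0. Qed.

Lemma enorm_gt0 x : (0 < enorm x) = (x != 0).
Proof. by rewrite lt_neqAle eq_sym enorm_eq0 enorm_ge0 andbT. Qed.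

Lemma enorm0 : enorm (0 : V) = 0.
Proof. by apply/eqP; rewrite enorm_eq0. Qed.

Lemma enormZ a x : enorm (a *: x) = `|a| * enorm x.
Proof. by rewrite /enorm dotZl dotZr mulrA -expr2 sqrtrM ?sqr_ge0// sqrtr_sqr. Qed.

Lemma enormN x : enorm (- x) = enorm x.
Proof. by rewrite -scaleN1r enormZ normrN1 mul1r. Qed.

Lemma coord_le_enorm x i : `|x 0 i| <= enorm x.
Proof. by rewrite -sqrtr_sqr ler_sqrt ?dotxx_ge0 ?sqr_coord_le. Qed.

Lemma norm_le_enorm x : `|x| <= enorm x.
Proof.
by apply: mx_norm_row_le (enorm_ge0 x) _ => i; exact: coord_le_enorm.
Qed.

Lemma dot_le_enorm x y : `|dot x y| <= enorm x * enorm y.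
Proof.
rewrite -(@ler_pXn2r _ 2)// ?nnegrE ?mulr_ge0 ?enorm_ge0// real_normK ?num_real//.
rewrite exprMn !sqr_enorm.
have [->|y0] := eqVneq y 0; first by rewrite !dot0r expr2 !mulr0.
have py : 0 < dot y y by rewrite lt_neqAle eq_sym dotxx_eq0 y0 dotxx_ge0.
(* The squared norm of this vector is [dot y y] times the difference of the two sides of the
   Cauchy-Schwarz inequality. *)
have := dotxx_ge0 (dot y y *: x - dot x y *: y).
rewrite !(dotDl, dotDr, dotNl, dotNr, dotZl, dotZr) (dotC y x) => h.
rewrite -subr_ge0 -(pmulr_rge0 _ py); apply: le_trans h _.
by rewrite le_eqVlt; apply/orP; left; apply/eqP; ring.
Qed.

Lemma dot_le x y : dot x y <= enorm x * enorm y.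
Proof. by apply: le_trans (dot_le_enorm x y); exact: ler_norm. Qed.

Lemma enormD x y : enorm (x + y) <= enorm x + enorm y.
Proof.
rewrite -(@ler_pXn2r _ 2)// ?nnegrE ?addr_ge0 ?enorm_ge0// sqrrD !sqr_enorm.
rewrite dotDl !dotDr (dotC y x); have := dot_le x y; lra.
Qed.

Lemma enorm_le_sum x : enorm x <= \sum_i `|x 0 i|.
Proof.
rewrite -(@ler_pXn2r _ 2)// ?nnegrE ?enorm_ge0 ?sumr_ge0// sqr_enorm expr2 /dot.
rewrite mulr_suml; apply: ler_sum => i _; rewrite -expr2 -real_normK ?num_real// expr2.
by rewrite ler_wpM2l// (bigD1 i)//= lerDl sumr_ge0.
Qed.

Lemma continuous_coord i : continuous (fun x : V => x 0 i).
Proof. exact: coord_continuous. Qed.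

Lemma continuous_dotxx : continuous (fun x : V => dot x x).
Proof.
by apply: continuous_sum => i x; apply: continuousM; exact: continuous_coord.
Qed.

Lemma continuous_enorm : continuous (@enorm R n).
Proof.
move=> x; apply: continuous_comp; first exact: continuous_dotxx.
exact: sqrt_continuous.
Qed.

End euclidean_norm.

Section lebesgue_row_bounded.
Context {R : realType}.

Definition cube n (c : 'rV[R]_n) (r : R) : set 'rV[R]_n :=
  [set x | forall i, `|x 0 i - c 0 i| <= r].

Lemma measurable_cube n (c : 'rV[R]_n) r : measurable (cube c r).
Proof.
apply: (@measurable_setI_ord R n n (fun i => [set x | `|x 0 i - c 0 i| <= r])) => i.
have : measurable_fun setT (fun x : 'rV[R]_n => `|x 0 i - c 0 i|).
  apply: measurableT_comp => //; apply: measurable_funB => //.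
  exact: measurable_coord.
move=> /(_ measurableT _ (measurable_itv `]-oo, r])); rewrite setTI.
by congr measurable; apply/seteqP; split => x /=; rewrite in_itv.
Qed.

Lemma lebesgue_row_cube n (c : 'rV[R]_n) r : 0 <= r ->
  lebesgue_row n (cube c r) = ((r *+ 2) ^+ n)%:E.
Proof.
move=> r0; elim: n c => [|n IHn] c.
  by rewrite /= diracE mem_set//= => -[].
pose c' : 'rV[R]_n := \row_i c 0 (lift ord0 i).
rewrite /= /lebesgue_succ /pushforward.
rewrite (_ : _ @^-1` _ = `[c 0 ord0 - r, c 0 ord0 + r] `*` cube c' r).
  rewrite product_measure1E ?IHn//=; last exact: measurable_cube.
  rewrite lebesgue_measure_itv /= lte_fin.
  case: ifPn => [_|]; first by rewrite -EFinD -EFinM exprS; congr (_ * _)%:E; ring.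
  rewrite ltrBlDr -addrA ltrDl -leNgt => h; have -> : r = 0 by apply/le_anti; lra.
  by rewrite mul0rn exprS mul0r mul0e.
apply/seteqP; split => -[z y] /=; rewrite in_itv /=.
  move=> h; split; first by have := h ord0; rewrite row_cons0 ler_distl.
  by move=> i; have := h (lift ord0 i); rewrite row_consS mxE.
move=> [h1 h2] i; case: (unliftP ord0 i) => [j ->|->].
  by rewrite row_consS; have := h2 j; rewrite mxE.
by rewrite row_cons0 ler_distl.
Qed.

Lemma measurable_enorm_le n (r : R) : measurable [set x : 'rV[R]_n | enorm x <= r].
Proof.
have := @measurable_enorm R n measurableT _ (measurable_itv `]-oo, r]).
by rewrite setTI; congr measurable; apply/seteqP; split => x /=; rewrite in_itv.
Qed.

Lemma lebesgue_row_enorm_le_fin n (r : R) :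
  (lebesgue_row n [set x : 'rV[R]_n | enorm x <= r]%R < +oo)%E.
Proof.
apply: (@le_lt_trans _ _ (lebesgue_row n (cube 0 `|r|))); last first.
  by rewrite lebesgue_row_cube// ltry.
apply: le_measure; rewrite ?inE.
- exact: measurable_enorm_le.
- exact: measurable_cube.
- move=> x /= xr i; rewrite mxE subr0; apply: le_trans (coord_le_enorm _ _) _.
  by apply: le_trans xr _; exact: ler_norm.
Qed.

End lebesgue_row_bounded.

(** * Integrals of bounded functions vanishing outside a ball *)

Section bounded_support.
Context {R : realType} {n : nat}.
Local Notation V := 'rV[R]_n.
Local Notation lam := (lebesgue_row n).
Implicit Types f g : V -> R.

(** A class of integrable functions that is stable under sums, absolute values and products with
    continuous functions, so that integrability need not be checked case by case. *)
Definition bounded_support f := measurable_fun setT f /\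
  exists r C, forall x, `|f x| <= C /\ (r < enorm x -> f x = 0).

Lemma bounded_support_integrable f : bounded_support f ->
  lam.-integrable setT (EFin \o f).
Proof.
move=> [mf [r [C fC]]]; pose D := [set x : V | enorm x <= r].
have mD : measurable D by exact: measurable_enorm_le.
have : lam.-integrable D (EFin \o f).
  apply: measurable_bounded_integrable => //.
  - exact: lebesgue_row_enorm_le_fin.
  - exact: measurable_funTS.
  - exists C; split; first exact: num_real.
    by move=> x /ltW Cx y _ /=; apply: le_trans Cx; case: (fC y).
move/(integrable_mkcond _ mD); congr (integrable _ _ _).
apply/funext => x; rewrite patchE; case: ifPn => //.
rewrite notin_setE /D /= => /negP; rewrite -ltNge => rx.
by case: (fC x) => _ /(_ rx) /= ->.
Qed.

Lemma bounded_supportD f g : bounded_support f -> bounded_support g ->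
  bounded_support (fun x => f x + g x).
Proof.
move=> [mf [r [C fC]]] [mg [s [D gD]]]; split; first exact: measurable_funD.
exists (Num.max r s), (C + D) => x; have [f1 f2] := fC x; have [g1 g2] := gD x.
split; first by apply: le_trans (ler_normD _ _) _; exact: lerD.
by rewrite gt_max => /andP[/f2 -> /g2 ->]; rewrite addr0.
Qed.

Lemma bounded_supportMl f g : bounded_support f -> continuous g ->
  bounded_support (fun x => g x * f x).
Proof.
move=> [mf [r [C fC]]] cg; split.
  by apply: measurable_funM => //; exact: measurable_continuous.
have [M Mg] : exists M, forall x : V, enorm x <= r -> `|g x| <= M.
  pose K := [set x : V | enorm x <= r].
  have cK : compact K.
    apply: bounded_closed_compact.
      exists r; split; first exact: num_real.
      by move=> y ry x xr /=; apply: le_trans (norm_le_enorm x) (le_trans xr (ltW ry)).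
    rewrite (_ : K = (@enorm R n) @^-1` [set y | y <= r])//.
    apply: closed_comp; last exact: closed_le.
    by move=> x _; exact: continuous_enorm.
  have /compact_bounded[M [_ hM]] := @continuous_compact _ _ g K
    (continuous_subspaceT cg) cK.
  exists (M + 1) => x xr; apply: (hM (M + 1)); first by rewrite ltrDl.
  by exists x.
have C0 : 0 <= C by have [h _] := fC 0; exact: le_trans h.
exists r, (`|M| * C) => x; have [f1 f2] := fC x; split.
  rewrite normrM; have [xr|xr] := leP (enorm x) r.
    by apply: ler_pM => //; apply: le_trans (Mg _ xr) _; exact: ler_norm.
  by rewrite f2// normr0 mulr0 mulr_ge0.
by move=> /f2 ->; rewrite mulr0.
Qed.

Lemma bounded_supportZ a f : bounded_support f -> bounded_support (fun x => a * f x).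
Proof. by move=> h; apply: (@bounded_supportMl f (cst a)) => //; exact: cst_continuous. Qed.

Lemma bounded_supportB f g : bounded_support f -> bounded_support g ->
  bounded_support (fun x => f x - g x).
Proof.
move=> hf hg; under [X in bounded_support X]eq_fun do rewrite -mulN1r.
by apply: bounded_supportD => //; exact: bounded_supportZ.
Qed.

Lemma bounded_support_norm f : bounded_support f -> bounded_support (fun x => `|f x|).
Proof.
move=> [mf [r [C fC]]]; split; first exact: measurableT_comp.
exists r, C => x; have [f1 f2] := fC x; rewrite normr_id; split => // /f2 ->.
by rewrite normr0.
Qed.

Lemma bounded_support_indic (D : set V) r : measurable D ->
  (forall x, D x -> enorm x <= r) -> bounded_support (\1_D : V -> R).
Proof.
move=> mD Dr; split; first exact: measurable_indic.
exists r, 1 => x; rewrite indicE; case: (boolP (x \in D)) => [xD|xD].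
  by rewrite normr1; split => // /lt_geF; rewrite Dr//; exact: set_mem.
by rewrite normr0.
Qed.

Definition lint f : R := \int[lam]_x f x.

Lemma lintD f g : bounded_support f -> bounded_support g ->
  lint (fun x => f x + g x) = lint f + lint g.
Proof. by move=> hf hg; apply: RintegralD => //; exact: bounded_support_integrable. Qed.

Lemma lintB f g : bounded_support f -> bounded_support g ->
  lint (fun x => f x - g x) = lint f - lint g.
Proof. by move=> hf hg; apply: RintegralB => //; exact: bounded_support_integrable. Qed.

Lemma lintZ a f : bounded_support f -> lint (fun x => a * f x) = a * lint f.
Proof. by move=> hf; apply: RintegralZl => //; exact: bounded_support_integrable. Qed.

Lemma le_lint f g : bounded_support f -> bounded_support g ->
  (forall x, f x <= g x) -> lint f <= lint g.
Proof.
by move=> hf hg fg; apply: le_Rintegral => //; exact: bounded_support_integrable.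
Qed.

Lemma ler_norm_lint f g : bounded_support f -> bounded_support g ->
  (forall x, `|f x| <= g x) -> `|lint f| <= lint g.
Proof.
move=> hf hg fg; apply: (le_trans (le_normr_Rintegral _ _)) => //.
  exact: bounded_support_integrable.
by apply: le_lint => //; exact: bounded_support_norm.
Qed.

(** The function dominates [e] times the indicator of a cube, and the measure [(2 r) ^ n] of the
    cube is positive. *)
Lemma lint_gt0 f c (r e : R) : bounded_support f -> (forall x, 0 <= f x) ->
  0 < r -> 0 < e -> (forall x, cube c r x -> e <= f x) -> 0 < lint f.
Proof.
move=> hf f0 r0 e0 fe.
have hb : bounded_support (fun x => e * \1_(cube c r) x).
  apply/bounded_supportZ/(@bounded_support_indic _ (enorm c + \sum_(i < n) r)).
    exact: measurable_cube.
  move=> x cx; rewrite -[x](subrK c) addrC; apply: le_trans (enormD _ _) _.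
  rewrite lerD2l; apply: le_trans (enorm_le_sum _) _; apply: ler_sum => i _.
  by have := cx i; rewrite !mxE.
apply: lt_le_trans (le_lint hb hf _); last first.
  move=> x; rewrite indicE; case: (boolP (x \in _)) => [/set_mem/fe|_].
    by rewrite mulr1.
  by rewrite mulr0.
rewrite lintZ; last first.
  have := bounded_supportZ e^-1 hb.
  by congr bounded_support; apply/funext => x; rewrite mulrA mulVf ?mul1r// gt_eqF.
rewrite mulr_gt0// /lint /Rintegral integral_indic//; last exact: measurable_cube.
rewrite setIT; suff : 0 < fine (lebesgue_row n (cube c r)) by [].
by rewrite lebesgue_row_cube ?ltW//= exprn_gt0// pmulrn_lgt0.
Qed.

End bounded_support.

Section image_measure.
Context {d1 d2} {T1 : measurableType d1} {T2 : measurableType d2} {R : realType}.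
Variables (m1 : {measure set T1 -> \bar R}) (m2 : {measure set T2 -> \bar R}).
Variables (phi : T1 -> T2) (k : R) (D : set T2).
Hypotheses (mphi : measurable_fun setT phi) (k0 : 0 <= k) (mD : measurable D).
Hypothesis m12 : forall A, measurable A -> A `<=` D ->
  m2 A = (k%:E * m1 (phi @^-1` A))%E.

Let measurable_preimD : measurable (phi @^-1` D).
Proof. by rewrite -[X in measurable X]setTI; exact: mphi. Qed.

(** The relation [m12] is asked only of subsets of [D] because the sphere measure, defined through
    cones, is an image measure of this kind only on subsets of the sphere. *)
Lemma ge0_integral_image (h : T2 -> \bar R) : measurable_fun setT h ->
  (forall x, 0 <= h x)%E ->
  (\int[m2]_(x in D) h x = k%:E * \int[m1]_(x in phi @^-1` D) h (phi x))%E.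
Proof.
move=> mh h0; pose k' : {nonneg R} := NngNum k0.
rewrite (@eq_measure_integral _ _ _ D (mscale k' (pushforward_scaled 1%:nng m1 mphi))).
  rewrite ge0_integral_mscale//; last exact: measurable_funTS.
  congr (_ * _)%E; rewrite -(ge0_integral_pushforward mphi) //; last first.
    exact: measurable_funTS.
  apply: eq_measure_integral => A mA _.
  by transitivity (1%:E * m1 (phi @^-1` A))%E => //; rewrite mul1e.
move=> A mA AD; rewrite m12//=.
transitivity (k%:E * (1%:E * m1 (phi @^-1` A)))%E; last by [].
by rewrite mul1e.
Qed.

Lemma Rintegral_image (f : T2 -> R) : measurable_fun setT f ->
  m1.-integrable (phi @^-1` D) (EFin \o (f \o phi)) ->
  \int[m2]_(x in D) f x = k * \int[m1]_(x in phi @^-1` D) f (phi x).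
Proof.
move=> mf fi; have mEf : measurable_fun setT (EFin \o f) by exact/measurable_EFinP.
rewrite /Rintegral integralE [in RHS]integralE.
rewrite !ge0_integral_image//;
  do ?[exact: measurable_funepos | exact: measurable_funeneg].
have H (a b : \bar R) : a \is a fin_num -> b \is a fin_num ->
    fine (k%:E * a - k%:E * b)%E = k * fine (a - b)%E.
  by case: a => [a||]// ; case: b => [b||]//= _ _; rewrite mulrBr.
rewrite -H; first by congr (fine (_ * _ - _ * _)); apply: eq_integral => x _; rewrite !unlock.
- exact: integrable_fin_num (integrable_funepos _ fi).
- exact: integrable_fin_num (integrable_funeneg _ fi).
Qed.

End image_measure.

(** * Linear changes of variables *)

Section dilation.
Context {R : realType} {n : nat}.
Local Notation V := 'rV[R]_n.
Local Notation lam := (lebesgue_row n).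
Implicit Types (f : V -> R) (T : V -> V).

(** The factor concerns preimages: for an invertible linear map it is the inverse of the absolute
    value of the determinant. *)
Definition dilates T (k : R) := [/\ measurable_fun setT T, 0 <= k &
  forall A, measurable A -> lam (T @^-1` A) = (k%:E * lam A)%E].

Lemma dilates_comp S T k l : dilates S k -> dilates T l -> dilates (S \o T) (k * l).
Proof.
move=> [mS k0 kS] [mT l0 lT]; split.
- exact: measurableT_comp.
- exact: mulr_ge0.
- move=> A mA; rewrite comp_preimage lT ?kS//; last first.
    by rewrite -[X in measurable X]setTI; exact: mS.
  by rewrite muleA -EFinM mulrC.
Qed.

Lemma lint_dilates T k f : dilates T k -> k != 0 -> bounded_support f ->
  bounded_support (f \o T) -> lint (f \o T) = k * lint f.
Proof.
move=> [mT k0 kT] kn0 [mf _] /bounded_support_integrable fT.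
have -> : lint f = k^-1 * \int[lam]_(x in T @^-1` setT) f (T x).
  apply: Rintegral_image => //; first by rewrite invr_ge0.
  move=> A mA _; suff : lam A = (k^-1%:E * lam (T @^-1` A))%E by [].
  by rewrite kT// muleA -EFinM mulVf// mul1e.
by rewrite mulrA divff// mul1r.
Qed.

Lemma dilates_coord_affine i a (c : V -> R) : a != 0 ->
  measurable_fun setT c -> (forall v x, c (set_coord i v x) = c x) ->
  dilates (coord_affine i a c) `|a|^-1.
Proof.
move=> a0 mc cE; split; first exact: measurable_coord_affine.
  by rewrite invr_ge0.
by move=> A mA; exact: lebesgue_row_coord_affine.
Qed.

(** Acting on row vectors from the right, it adds [s * x 0 i] to the coordinate [j]: a shear for
    [i != j], a stretching for [i = j]. *)
Definition elem_mx (i j : 'I_n) (s : R) : 'M[R]_n := 1%:M + s *: delta_mx i j.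

Lemma mul_elem_mx (x : V) i j s k :
  (x *m elem_mx i j s) 0 k = x 0 k + s * x 0 i * (k == j)%:R.
Proof.
rewrite mulmxDr mulmx1 -scalemxAr !mxE (bigD1 i)//= big1 ?addr0; last first.
  by move=> l li; rewrite !mxE (negbTE li) mulr0.
by rewrite !mxE eqxx /= mulrA.
Qed.

Lemma dilates_elem_mx i j s : 1 + s * (i == j)%:R != 0 ->
  dilates (fun x : V => x *m elem_mx i j s) `|1 + s * (i == j)%:R|^-1.
Proof.
move=> s0; pose c (x : V) := s * x 0 i * (i != j)%:R.
rewrite [X in dilates X _](_ : _ = coord_affine j (1 + s * (i == j)%:R) c).
  apply: dilates_coord_affine => //.
    apply: measurable_funM => //; apply: measurable_funM => //.
    exact: measurable_coord.
  by move=> v x; rewrite /c mxE; case: eqVneq => //= _; rewrite !mulr0.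
apply/funext => x; apply/rowP => k; rewrite mul_elem_mx mxE /c.
case: eqVneq => [->|]; last by rewrite mulr0 addr0.
by case: eqVneq => [->|_] /=; ring.
Qed.

Lemma dilates_scale (a : R) : a != 0 -> dilates (fun x : V => a *: x) (`|a| ^- n).
Proof.
move=> a0; pose T k (x : V) : V := \row_i ((if (i < k)%N then a else 1) * x 0 i).
have H k : (k <= n)%N -> dilates (T k) (`|a| ^- k).
  elim: k => [_|k IHk kn].
    rewrite expr0 invr1 (_ : T 0%N = id).
      by split => // A mA; rewrite mul1e.
    by apply/funext => x; apply/rowP => i; rewrite mxE mul1r.
  have -> : T k.+1 = coord_affine (Ordinal kn) a (cst 0) \o T k.
    apply/funext => x; apply/rowP => i; rewrite !mxE /= ltnn mul1r addr0.
    rewrite ltnS leq_eqVlt; case: (eqVneq i (Ordinal kn)) => [->|] /=.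
      by rewrite eqxx.
    by rewrite -val_eqE /= => /negbTE ->.
  rewrite exprS invfM; apply: dilates_comp; last exact/IHk/ltnW.
  exact: dilates_coord_affine.
suff <- : T n = (fun x : V => a *: x) by exact: H.
by apply/funext => x; apply/rowP => i; rewrite !mxE ltn_ord.
Qed.

End dilation.

(** * Polar coordinates *)

Section polar.
Context {R : realType} {n : nat}.
Local Notation V := 'rV[R]_n.
Local Notation lam := (lebesgue_row n).
Local Notation S := (unit_sphere R n).
Local Notation B := (@unit_ball R n).
Implicit Types f g : V -> R.

Definition sint f : R := \int[@sphere_measure R n]_(x in S) f x.

(** The extension from the sphere that is constant on rays. It is 0 at the origin, whose [direction]
    is 0 and thus off the sphere. *)
Definition radial_ext f (x : V) : R := (f \_ S) (direction x).

Lemma radial_extE f x :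
  radial_ext f x = if direction x \in S then f (direction x) else 0.
Proof. by rewrite /radial_ext patchE. Qed.

Lemma direction_sphere (x : V) : x != 0 -> S (direction x).
Proof.
move=> x0; rewrite /unit_sphere /= enormZ normfV ger0_norm ?enorm_ge0//.
by rewrite mulVf// enorm_eq0.
Qed.

Lemma notin_sphere0 : ~ S (0 : V).
Proof. by rewrite /unit_sphere /= enorm0 => /eqP; rewrite eq_sym oner_eq0. Qed.

Lemma measurable_sphere : measurable S.
Proof.
have := @measurable_enorm R n measurableT _ (measurable_set1 1).
by rewrite setTI.
Qed.

Lemma bounded_support_ball f : continuous f ->
  bounded_support (fun x => f x * \1_B x).
Proof.
move=> cf; apply: bounded_supportMl => //.
by apply: (@bounded_support_indic _ _ _ 1) => //; exact: measurable_unit_ball.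
Qed.

Lemma continuous_sphere_bounded f : continuous f ->
  exists C, forall x, S x -> `|f x| <= C.
Proof.
move=> /bounded_support_ball[_ [r [C fC]]]; exists C => x Sx.
have [+ _] := fC x; rewrite indicE mem_set ?mulr1//.
by rewrite /unit_ball /= Sx.
Qed.

Lemma bounded_support_radial_ext f : continuous f ->
  bounded_support (fun x => radial_ext f x * \1_B x).
Proof.
move=> cf; have [C fC] := continuous_sphere_bounded cf.
split.
  apply: measurable_funM; last by apply: measurable_indic; exact: measurable_unit_ball.
  apply: (measurableT_comp (f := f \_ S)); last exact: (@measurable_direction R n).
  apply: (measurable_restrictT f measurable_sphere).1.
  by apply: measurable_funTS; exact: measurable_continuous.
exists 1, `|C| => x; rewrite /radial_ext patchE indicE; split.
  case: ifPn => [/set_mem/fC h|_]; last by rewrite mul0r normr0.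
  case: (x \in B); last by rewrite mulr0 normr0.
  by rewrite mulr1; apply: le_trans h _; exact: ler_norm.
by move=> x1; rewrite [x \in B]memNset ?mulr0//; apply/negP; rewrite -ltNge.
Qed.

Lemma sint_lint f : continuous f ->
  sint f = n%:R * lint (fun x => radial_ext f x * \1_B x).
Proof.
(* Points outside the ball are sent to 0, off the sphere, so that the preimage of a subset of the
   sphere is exactly the cone that defines its measure. *)
move=> cf; pose phi (x : V) : V := \1_B x *: direction x.
have phiB x : B x -> phi x = direction x.
  by move=> Bx; rewrite /phi indicE mem_set// scale1r.
have phiNB x : ~ B x -> phi x = 0.
  by move=> Bx; rewrite /phi indicE memNset// scale0r.
have mphi : measurable_fun setT phi.
  apply: measurable_fun_rowP => i; under eq_fun do rewrite mxE.
  apply: measurable_funM; first by apply: measurable_indic; exact: measurable_unit_ball.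
  apply: (measurableT_comp (@measurable_coord _ R n i)).
  exact: (@measurable_direction R n).
have E : (f \o phi) \_ (phi @^-1` S) = (fun x => radial_ext f x * \1_B x).
  apply/funext => x; rewrite /radial_ext !patchE indicE.
  have [Bx|Bx] := pselect (B x).
    rewrite [x \in B]mem_set// mulr1 -(phiB _ Bx).
    by congr (if _ then _ else _).
  by rewrite [x \in B]memNset// mulr0 memNset//= phiNB//; exact: notin_sphere0.
rewrite /sint (@Rintegral_image _ _ _ _ _ lam _ phi n%:R).
- by rewrite /lint -E -Rintegral_mkcond.
- exact: mphi.
- by [].
- exact: measurable_sphere.
- move=> A mA AS; suff : sphere_measure A = (n%:R%:E * lam (phi @^-1` A))%E by [].
  rewrite /sphere_measure; congr (_ * lam _)%E; apply/seteqP; split => x /=.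
    by move=> [Ax Bx]; rewrite phiB.
  have [Bx|Bx] := pselect (B x); first by rewrite phiB.
  by rewrite phiNB// => /AS/notin_sphere0.
- exact: measurable_continuous.
- apply/(integrable_mkcond _ _).2.
    by rewrite -[X in measurable X]setTI; apply: mphi => //; exact: measurable_sphere.
  rewrite (_ : _ \_ _ = EFin \o (fun x => radial_ext f x * \1_B x)).
    exact/bounded_support_integrable/bounded_support_radial_ext.
  by rewrite -E; apply/funext => x; rewrite /= !patchE; case: ifP.
Qed.

(** The witness is the geometric sum [1 + t + ... + t^(k-1)], compared with its value [k] at
    [t = 1]. *)
Lemma onem_exprn (t : R) k : 0 <= t <= 1 -> exists s, [/\ 1 - t ^+ k = (1 - t) * s,
  0 <= s <= k%:R & `|k%:R - s| <= (k ^ 2)%:R * (1 - t)].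
Proof.
move=> /andP[t0 t1]; elim: k => [|k [s [es /andP[s0 sk] hs]]].
  by exists 0; rewrite expr0 subrr mulr0 subr0 normr0 mul0r lexx.
have tk1 : t ^+ k <= 1 by exact: exprn_ile1.
have tk0 : 0 <= t ^+ k by exact: exprn_ge0.
exists (s + t ^+ k); rewrite exprS -(natr1 k); split; first by lra.
- by apply/andP; split; lra.
- rewrite ger0_norm in hs; last by lra.
  rewrite ger0_norm; last by lra.
  have h : (1 - t) * s <= (1 - t) * k%:R by rewrite ler_wpM2l//; lra.
  rewrite natrX -(natr1 k) sqrrD1 mulrDl mulrDl; rewrite natrX in hs.
  have h2 : 0 <= k%:R * (1 - t) by rewrite mulr_ge0//; lra.
  by rewrite mulr2n mulrDl; lra.
Qed.

Lemma eq0_small (x C : R) : (forall e, 0 < e < 1 -> `|x| <= e * C) -> x = 0.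
Proof.
move=> h; apply/eqP; rewrite -normr_le0 leNgt; apply/negP => x0.
have C0 : 0 < C.
  have := h 2^-1; rewrite invr_gt0 ltr0n invf_lt1// ltr1n => /(_ isT) h1.
  by rewrite -(pmulr_rgt0 C (_ : 0 < 2^-1))//; apply: lt_le_trans h1.
pose e := Num.min 2^-1 (`|x| / (2 * C)).
have e0 : 0 < e by rewrite lt_min invr_gt0 ltr0n divr_gt0// mulr_gt0.
have e1 : e < 1 by rewrite gt_min invf_lt1// ltr1n.
have := h e; rewrite e0 e1 => /(_ isT); rewrite leNgt => /negP; apply.
apply: (@le_lt_trans _ _ (`|x| / (2 * C) * C)).
  by rewrite ler_pM2r// ge_min lexx orbT.
rewrite invfM mulrA divfK ?gt_eqF//; lra.
Qed.

(* Comparing [f] with [x |-> f (direction x)] on the shells [t < |x| <= 1], whose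
   integrals are known by homogeneity, and letting [t] tend to 1. *)
Lemma sint_homogeneous f d : (0 < d)%N -> continuous f ->
  (forall t x, 0 <= t -> f (t *: x) = t ^+ d * f x) ->
  sint f = (n + d)%:R * lint (fun x => f x * \1_B x).
Proof.
move=> d0 cf fd; rewrite sint_lint//.
set F := radial_ext f.
have fF x : f x = enorm x ^+ d * F x.
  have [->|x0] := eqVneq x 0.
    by rewrite -[0 in LHS](scale0r 0) fd// enorm0 expr0n gtn_eqF// !mul0r.
  rewrite /F /radial_ext patchE mem_set; last exact: direction_sphere.
  rewrite -fd ?enorm_ge0// /direction scalerA divff ?scale1r//.
  by rewrite enorm_eq0.
have FT (a : R) x : 0 < a -> F (a *: x) = F x.
  move=> a0; rewrite /F /radial_ext /direction enormZ gtr0_norm// scalerA.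
  by rewrite invfM mulrAC mulVf ?mul1r// gt_eqF.
have bF := bounded_support_radial_ext cf.
have bf := bounded_support_ball cf.
set J := lint _; set g := lint _; pose J' := lint (fun x => `|F x| * \1_B x).
have bF' : bounded_support (fun x => `|F x| * \1_B x).
  have := bounded_support_norm bF; congr bounded_support; apply/funext => x.
  by rewrite normrM indicE; case: (x \in B); rewrite ?normr1 ?normr0.
apply/eqP; rewrite -subr_eq0; apply/eqP.
(* The first two terms bound the error of replacing the geometric sums by [n] and [n + d]; the third
   bounds the integral of [f - F] over the shell, after division by [e]. *)
apply: (@eq0_small _ ((n ^ 2)%:R * `|J| + ((n + d) ^ 2)%:R * `|g| +
  d%:R * n%:R * `|J'|)) => e /andP[e0 e1].
pose t := 1 - e.
have t0 : 0 < t by rewrite subr_gt0.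
have tv0 : t^-1 != 0 by rewrite invr_eq0 gt_eqF.
have t1 : t < 1 by rewrite /t; lra.
have [s [es /andP[s0 sk] hs]] := @onem_exprn t n (introT andP (conj (ltW t0) (ltW t1))).
have [s' [es' /andP[s'0 s'k] hs']] := @onem_exprn t (n + d) (introT andP (conj (ltW t0) (ltW t1))).
have [s'' [es'' /andP[s''0 s''k] _]] := @onem_exprn t d (introT andP (conj (ltW t0) (ltW t1))).
have bT (h : V -> R) : bounded_support h -> bounded_support (fun x => h (t^-1 *: x)).
  move=> [mh [r [C hC]]]; split.
    by have [mS _ _] := @dilates_scale R n _ tv0; exact: (measurableT_comp mh mS).
  exists (t * r), C => x; have [h1 h2] := hC (t^-1 *: x); split => // xr.
  by apply: h2; rewrite enormZ gtr0_norm ?invr_gt0// ltr_pdivlMl.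
have lT (h : V -> R) : bounded_support h -> lint (fun x => h (t^-1 *: x)) = t ^+ n * lint h.
  move=> bh; have := @lint_dilates _ _ _ _ h (dilates_scale tv0) _ bh (bT _ bh).
  rewrite /comp => ->; last first.
    by rewrite gt_eqF// invr_gt0 exprn_gt0// normr_gt0.
  by rewrite normfV gtr0_norm// exprVn invrK.
have bFT : bounded_support (fun x => F (t^-1 *: x) * \1_B (t^-1 *: x)) := bT _ bF.
have bFT' : bounded_support (fun x => `|F (t^-1 *: x)| * \1_B (t^-1 *: x)) :=
  bT _ bF'.
have bfT : bounded_support (fun x => f (t^-1 *: x) * \1_B (t^-1 *: x)) := bT _ bf.
have bt := bounded_supportB bF bFT.
have bt' := bounded_supportB bF' bFT'.
have btf := bounded_supportB bf (bounded_supportZ (t ^+ d) bfT).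
have E1 : lint (fun x => F x * \1_B x - F (t^-1 *: x) * \1_B (t^-1 *: x)) =
    (1 - t ^+ n) * J.
  by rewrite lintB// (lT _ bF) mulrBl mul1r.
have E2 : lint (fun x => `|F x| * \1_B x - `|F (t^-1 *: x)| * \1_B (t^-1 *: x)) =
    (1 - t ^+ n) * J'.
  by rewrite lintB// (lT _ bF') mulrBl mul1r.
have E3 : lint (fun x => f x * \1_B x - t ^+ d * (f (t^-1 *: x) * \1_B (t^-1 *: x))) =
    (1 - t ^+ (n + d)) * g.
  rewrite lintB//; last exact: bounded_supportZ.
  by rewrite lintZ// (lT _ bf) mulrBl mul1r mulrA -exprD addnC.
(* Both differences live on the shell [t < |x| <= 1], because [t ^+ d * f (t^-1 *: x) = f x] and
   [F (t^-1 *: x) = F x]. There [f - F = (|x| ^+ d - 1) * F], which is at most [(1 - t ^+ d) * |F|]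
   in absolute value. *)
have : `|lint (fun x => (f x * \1_B x - t ^+ d * (f (t^-1 *: x) * \1_B (t^-1 *: x)))
   - (F x * \1_B x - F (t^-1 *: x) * \1_B (t^-1 *: x)))| <=
   lint (fun x => (1 - t ^+ d) *
     (`|F x| * \1_B x - `|F (t^-1 *: x)| * \1_B (t^-1 *: x))).
  apply: ler_norm_lint; [exact: bounded_supportB|exact: bounded_supportZ|].
  move=> x; rewrite !FT ?invr_gt0// fd ?invr_ge0 ?(ltW t0)//.
  rewrite !mulrA -exprMn divff ?gt_eqF// expr1n mul1r fF.
  rewrite !indicE.
  have [x1|x1] := leP (enorm x) t.
    rewrite !mem_set ?mulr1 ?subrr ?normr0//.
      by rewrite mulr0.
      by rewrite /unit_ball /= enormZ gtr0_norm ?invr_gt0// ler_pdivrMl// mulr1.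
    by rewrite /unit_ball /= (le_trans x1) ?ltW.
  rewrite [_ *: _ \in B]memNset ?mulr0 ?subr0; last first.
    by apply/negP; rewrite enormZ gtr0_norm ?invr_gt0// ler_pdivrMl// mulr1 -ltNge.
  have [x2|x2] := leP (enorm x) 1; last first.
    by rewrite [x \in B]memNset ?mulr0 ?subr0 ?normr0//; apply/negP; rewrite -ltNge.
  rewrite mem_set// !mulr1 -{2}[F x]mul1r -mulrBl normrM ler_wpM2r//.
  have h1 : enorm x ^+ d <= 1 by rewrite exprn_ile1// enorm_ge0.
  have h2 : t ^+ d <= enorm x ^+ d by rewrite lerXn2r ?nnegrE ?enorm_ge0 ?ltW.
  by rewrite ler0_norm; lra.
rewrite lintB// lintZ// E1 E2 E3 es es' es''.
have -> : 1 - t = e by rewrite /t; lra.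
have -> : e * s' * g - e * s * J = e * (s' * g - s * J) by ring.
rewrite normrM (gtr0_norm e0) -[e * s'' * _]mulrA ler_pM2l// => hmain.
have -> : n%:R * J - (n + d)%:R * g =
  (n%:R - s) * J - ((n + d)%:R - s') * g - (s' * g - s * J) by ring.
have hte : 1 - t = e by rewrite /t; lra.
rewrite hte in hs hs'.
have b1 : `|(n%:R - s) * J| <= e * ((n ^ 2)%:R * `|J|).
  by rewrite normrM mulrA ler_wpM2r// mulrC.
have b2 : `|((n + d)%:R - s') * g| <= e * (((n + d) ^ 2)%:R * `|g|).
  by rewrite normrM mulrA ler_wpM2r// mulrC.
have b3 : s'' * (e * s * J') <= e * (d%:R * n%:R * `|J'|).
  rewrite (_ : s'' * _ = e * (s'' * s * J')); last by ring.
  rewrite ler_pM2l//; apply: (@le_trans _ _ (s'' * s * `|J'|)).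
    by rewrite ler_wpM2l ?mulr_ge0// ler_norm.
  by rewrite ler_wpM2r// ler_pM.
rewrite !mulrDr; apply: le_trans (ler_normB _ _) _.
apply: lerD; first by apply: le_trans (ler_normB _ _) _; exact: lerD.
by apply: le_trans hmain _.
Qed.

End polar.

(* [isMeasure] of [mpoly] would shadow the one of the analysis library. *)
Import -(notations) mpoly.

(** * Shears and integrals over the sphere *)

Section poly_functions.
Context {R : realType} {n : nat}.
Local Notation V := 'rV[R]_n.
Local Notation poly := (mpoly n R).
Implicit Types p q : poly.

Definition var (i : 'I_n) : poly := mpolyX R (mnm1 i).

Lemma mpoly_ring_ind (P : poly -> Prop) :
  (forall c, P (mpolyC n c)) -> (forall i, P (var i)) ->
  (forall p q, P p -> P q -> P (p + q)) ->
  (forall p q, P p -> P q -> P (p * q)) -> forall p, P p.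
Proof.
move=> hC hX hD hM.
have P1 : P 1 by have := hC 1; rewrite mpolyC1.
elim/mpolyind => [|c m p _ _ Pp].
  by have := hC 0; rewrite mpolyC0.
apply: (hD) => //; rewrite -mul_mpolyC; apply: (hM); first exact: hC.
rewrite mpolyXE_id.
elim/big_ind : _ => [||i _].
- exact: P1.
- exact: hM.
- elim: (m i) => [|k IHk]; first by rewrite expr0.
  by rewrite exprS; apply: (hM) => //; exact: hX.
Qed.

Definition peval p (x : V) : R := meval (x 0) p.

Lemma pevalD p q x : peval (p + q) x = peval p x + peval q x.
Proof. exact: mevalD. Qed.
Lemma pevalB p q x : peval (p - q) x = peval p x - peval q x.
Proof. exact: mevalB. Qed.
Lemma pevalM p q x : peval (p * q) x = peval p x * peval q x.
Proof. exact: mevalM. Qed.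
Lemma pevalZ c p x : peval (c *: p) x = c * peval p x.
Proof. exact: mevalZ. Qed.
Lemma pevalC c x : peval (mpolyC n c) x = c.
Proof. exact: mevalC. Qed.
Lemma peval0 x : peval 0 x = 0.
Proof. exact: meval0. Qed.
Lemma peval1 x : peval 1 x = 1.
Proof. exact: meval1. Qed.
Lemma peval_var i x : peval (var i) x = x 0 i.
Proof. exact: mevalXU. Qed.
Lemma peval_sum (I : Type) (s : seq I) (P : pred I) (F : I -> poly) x :
  peval (\sum_(i <- s | P i) F i) x = \sum_(i <- s | P i) peval (F i) x.
Proof. exact: raddf_sum. Qed.

Lemma continuous_peval p : continuous (peval p).
Proof.
elim/mpoly_ring_ind: p => [c|i|p q cp cq|p q cp cq].
- have -> : peval (mpolyC n c) = cst c by apply/funext => x; rewrite pevalC.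
  exact: cst_continuous.
- have -> : peval (var i) = (fun x => x 0 i) by apply/funext => x; rewrite peval_var.
  exact: continuous_coord.
- have -> : peval (p + q) = (fun x => peval p x + peval q x).
    by apply/funext => x; rewrite pevalD.
  by move=> x; apply: continuousD; [exact: cp|exact: cq].
- have -> : peval (p * q) = (fun x => peval p x * peval q x).
    by apply/funext => x; rewrite pevalM.
  by move=> x; apply: continuousM; [exact: cp|exact: cq].
Qed.

Definition homogeneous (d : nat) p := p \is ishomog1 d (@mdeg n).

Lemma homogeneous_var i : homogeneous 1 (var i).
Proof. by rewrite /homogeneous dhomogX /= mdeg1. Qed.

Lemma peval_homogeneous d p t x : homogeneous d p ->
  peval p (t *: x) = t ^+ d * peval p x.
Proof.
move=> /dhomogP hp; rewrite /peval !mevalE big_distrr /= [LHS]big_seq [RHS]big_seq.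
apply: eq_bigr => m /hp md.
rewrite mulrCA; congr (_ * _).
under eq_bigr do rewrite mxE exprMn.
rewrite big_split /= prodrXr.
by congr (_ ^+ _ * _); rewrite -md; exact/esym/mdegE.
Qed.

Lemma homogeneous_mderiv d i p : homogeneous d.+1 p -> homogeneous d (mderiv i p).
Proof.
move=> hp; apply/dhomogP => m; rewrite mcoeff_msupp mcoeff_deriv => h.
have : mcoeff (mnm_add m (mnm1 i)) p != 0.
  by apply: contraNneq h => ->; rewrite mul0rn.
rewrite -mcoeff_msupp => /(dhomog_mf hp) md.
by apply/eqP; rewrite -eqSS -md /= mdegD mdeg1 addn1.
Qed.

Lemma homogeneous_mderiv0 i p : homogeneous 0 p -> mderiv i p = 0.
Proof.
move=> hp; apply/mpolyP => m; rewrite mcoeff_deriv mcoeff0.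
rewrite (dhomog_nemf_coeff hp) ?mul0rn//=.
by rewrite mdegD mdeg1 addn1.
Qed.

Lemma homogeneous_var_mderiv d i j p : homogeneous d p ->
  homogeneous d (var i * mderiv j p).
Proof.
case: d => [|d] hp.
  by rewrite homogeneous_mderiv0// mulr0; exact: dhomog0.
rewrite -[d.+1]add1n; apply: dhomogM; first exact: homogeneous_var.
exact: homogeneous_mderiv.
Qed.

Lemma mderiv_var i j : mderiv i (var j) = (i == j)%:R.
Proof.
rewrite mderivX mnm1E eq_sym; case: eqVneq => [->|_]; last by rewrite scale0r.
rewrite scale1r (_ : mnm_sub _ _ = mnm0) ?mpolyX0//.
by apply/mnmP => k; rewrite !mnmE subnn.
Qed.

End poly_functions.

(** * First-order expansions along elementary matrices *)

Section first_order.
Context {R : realType} {n : nat}.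
Local Notation V := 'rV[R]_n.
Local Notation poly := (mpoly n R).

(* [W s x = W0 x + s * W1 x + O(s^2)], uniformly for [x] in a ball. *)
Definition first_order (r : R) (W : R -> V -> R) (W0 W1 : V -> R) :=
  exists2 C, 0 <= C & forall s x, `|s| <= 2^-1 -> enorm x <= r ->
    [/\ `|W s x - (W0 x + s * W1 x)| <= C * s ^+ 2, `|W0 x| <= C & `|W1 x| <= C].

Lemma first_orderD r W W0 W1 W' W0' W1' : first_order r W W0 W1 ->
  first_order r W' W0' W1' ->
  first_order r (fun s x => W s x + W' s x) (fun x => W0 x + W0' x)
    (fun x => W1 x + W1' x).
Proof.
move=> [C C0 h] [D D0 h']; exists (C + D); first exact: addr_ge0.
move=> s x s1 xr; have [a1 a2 a3] := h s x s1 xr; have [b1 b2 b3] := h' s x s1 xr.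
split; last 2 first.
- by apply: le_trans (ler_normD _ _) _; exact: lerD.
- by apply: le_trans (ler_normD _ _) _; exact: lerD.
rewrite mulrDl; apply: le_trans (lerD a1 b1); apply: le_trans (ler_normD _ _).
by rewrite le_eqVlt; apply/orP; left; apply/eqP; congr (`| _ |); ring.
Qed.

Lemma first_orderM r W W0 W1 W' W0' W1' : first_order r W W0 W1 ->
  first_order r W' W0' W1' ->
  first_order r (fun s x => W s x * W' s x) (fun x => W0 x * W0' x)
    (fun x => W0 x * W1' x + W1 x * W0' x).
Proof.
move=> [C C0 h] [D D0 h']; have CD : 0 <= C * D by exact: mulr_ge0.
(* Six is 2 + 2 + 1 + 1, the sum of the coefficients in the bounds [e1] to [e4]. *)
exists (6 * (C * D)); first by rewrite mulr_ge0.
move=> s x s1 xr; have [] := h s x s1 xr; have [] := h' s x s1 xr.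
move: (W s x) (W0 x) (W1 x) (W' s x) (W0' x) (W1' x) => w w0 w1 w' w0' w1'.
move=> b1 b2 b3 a1 a2 a3.
have {}s1 : `|s| <= 1 by lra.
have s2 : s ^+ 2 = `|s| ^+ 2 by rewrite real_normK ?num_real.
have s0 : 0 <= s ^+ 2 by exact: sqr_ge0.
have s21 : s ^+ 2 <= 1 by rewrite s2 expr_le1.
have p1 : `|w0 * w1'| <= C * D by rewrite normrM ler_pM.
have p2 : `|w1 * w0'| <= C * D by rewrite normrM ler_pM.
have p3 : `|w1 * w1'| <= C * D by rewrite normrM ler_pM.
have q0 : `|w0 + s * w1| <= 2 * C.
  apply: le_trans (ler_normD _ _) _; rewrite normrM.
  have : `|s| * `|w1| <= 1 * C by rewrite ler_pM.
  by lra.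
have q0' : `|w0' + s * w1'| <= 2 * D.
  apply: le_trans (ler_normD _ _) _; rewrite normrM.
  have : `|s| * `|w1'| <= 1 * D by rewrite ler_pM.
  by lra.
split; last 2 first.
- rewrite normrM; have : `|w0| * `|w0'| <= C * D by rewrite ler_pM.
  lra.
- by apply: le_trans (ler_normD _ _) _; lra.
set e := w - _ in a1; set e' := w' - _ in b1.
have e1 : `|(w0 + s * w1) * e'| <= 2 * (C * D) * s ^+ 2.
  rewrite normrM (_ : 2 * (C * D) * s ^+ 2 = 2 * C * (D * s ^+ 2)); last by ring.
  by rewrite ler_pM.
have e2 : `|(w0' + s * w1') * e| <= 2 * (C * D) * s ^+ 2.
  rewrite normrM (_ : 2 * (C * D) * s ^+ 2 = 2 * D * (C * s ^+ 2)); last by ring.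
  by rewrite ler_pM.
have e3 : `|e * e'| <= C * D * s ^+ 2.
  rewrite normrM; apply: (@le_trans _ _ (C * s ^+ 2 * (D * s ^+ 2))).
    by rewrite ler_pM.
  rewrite (_ : _ * _ = C * D * s ^+ 2 * s ^+ 2); last by ring.
  by rewrite ler_piMr// mulr_ge0.
have e4 : `|s ^+ 2 * (w1 * w1')| <= C * D * s ^+ 2.
  by rewrite normrM (ger0_norm s0) mulrC ler_wpM2r.
have -> : w * w' - (w0 * w0' + s * (w0 * w1' + w1 * w0')) =
   (w0 + s * w1) * e' + (w0' + s * w1') * e + e * e' + s ^+ 2 * (w1 * w1').
  by rewrite /e /e'; ring.
apply: le_trans (ler_normD _ _) _; apply: le_trans (lerD (ler_normD _ _) (lexx _)) _.
apply: le_trans (lerD (lerD (ler_normD _ _) (lexx _)) (lexx _)) _.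
lra.
Qed.

Lemma continuous_ball_bounded (f : V -> R) r : continuous f ->
  exists2 C, 0 <= C & forall x, enorm x <= r -> `|f x| <= C.
Proof.
move=> cf.
have [_ [r' [C hC]]] : bounded_support (fun x => f x * \1_[set x | enorm x <= r] x).
  apply: bounded_supportMl => //.
  by apply: (@bounded_support_indic _ _ _ r) => //; exact: measurable_enorm_le.
exists C; first by apply: le_trans (normr_ge0 _) (proj1 (hC 0)).
move=> x xr; have [+ _] := hC x; rewrite indicE mem_set ?mulr1//.
Qed.

Lemma first_order_affine r (w w1 : V -> R) : continuous w -> continuous w1 ->
  first_order r (fun s x => w x + s * w1 x) w w1.
Proof.
move=> /(@continuous_ball_bounded _ r)[C C0 hC] /(@continuous_ball_bounded _ r)[D D0 hD].
exists (C + D); first exact: addr_ge0.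
move=> s x _ xr; rewrite subrr normr0; split.
- by rewrite mulr_ge0 ?sqr_ge0 ?addr_ge0.
- by rewrite (le_trans (hC _ xr))// lerDl.
- by rewrite (le_trans (hD _ xr))// lerDr.
Qed.

(** The velocity of [x *m elem_mx i j s] at [s = 0] is [x 0 i] times the [j]-th basis vector. Sums
    and products of expansions reduce the claim to constants and variables, the product rule being
    [first_orderM]. *)
Lemma first_order_peval r (i j : 'I_n) (p : poly) :
  first_order r (fun s x => peval p (x *m elem_mx i j s)) (peval p)
    (fun x => x 0 i * peval (mderiv j p) x).
Proof.
elim/(@mpoly_ring_ind R n): p => [c|k|p q hp hq|p q hp hq].
- have := @first_order_affine r (cst c) (cst 0) (@cst_continuous _ _ _) (@cst_continuous _ _ _).
  congr first_order; try by apply/funext => x; rewrite ?mderivC ?pevalC ?peval0 ?mulr0.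
  by apply/funext => s; apply/funext => x; rewrite pevalC mulr0 addr0.
- have := @first_order_affine r (fun x => x 0 k) (fun x => x 0 i * (k == j)%:R)
    (@continuous_coord _ _ _) _.
  have cc : continuous (fun x : V => x 0 i * (k == j)%:R).
    by apply: fun_continuousM; [exact: continuous_coord|exact: cst_continuous].
  move=> /(_ cc); congr first_order.
  + by apply/funext => s; apply/funext => x; rewrite peval_var mul_elem_mx mulrA.
  + by apply/funext => x; rewrite peval_var.
  + apply/funext => x; rewrite mderiv_var eq_sym.
    by case: eqVneq => _; rewrite ?peval1 ?peval0.
- have := first_orderD hp hq; congr first_order.
  + by apply/funext => s; apply/funext => x; rewrite pevalD.
  + by apply/funext => x; rewrite pevalD.
  + by apply/funext => x; rewrite mderivD pevalD mulrDr.
- have := first_orderM hp hq; congr first_order.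
  + by apply/funext => s; apply/funext => x; rewrite pevalM.
  + by apply/funext => x; rewrite pevalM.
  + by apply/funext => x; rewrite mderivM pevalD !pevalM; ring.
Qed.

(* Unlike the indicator of the ball, [cutoff x ^+ 2] is of class C^1, so that a
   shear changes it to first order with a uniform quadratic error. *)
Definition cutoff (x : V) : R := Num.max 0 (1 - dot x x).

Lemma cutoffE x : cutoff x = (1 - dot x x) * \1_(@unit_ball R n) x.
Proof.
rewrite /cutoff indicE.
have -> : (x \in @unit_ball R n) = (0 <= 1 - dot x x).
  rewrite subr_ge0 -sqr_enorm expr_le1 ?enorm_ge0//.
  by apply/idP/idP => [/set_mem//|h]; exact/mem_set.
by case: (leP 0 (1 - dot x x)); rewrite ?mulr1 ?mulr0.
Qed.

Lemma continuous_cutoff : continuous cutoff.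
Proof.
apply: fun_continuous_max0; apply: fun_continuousB; first exact: cst_continuous.
exact: continuous_dotxx.
Qed.

Lemma cutoff_out x : 1 < enorm x -> cutoff x = 0.
Proof. by move=> x1; rewrite cutoffE indicE memNset ?mulr0//; apply/negP; rewrite -ltNge. Qed.

(** Taylor's formula for the square of the positive part, whose derivative [2 * Num.max 0 u] is
    2-Lipschitz. With opposite signs, the inequality rests on [u * v <= 0]. *)
Lemma sqr_max0_expand (u v : R) :
  `|Num.max 0 v ^+ 2 - (Num.max 0 u ^+ 2 + 2 * Num.max 0 u * (v - u))| <= (v - u) ^+ 2.
Proof.
have u2 := sqr_ge0 u; have v2 := sqr_ge0 v; have vu2 := sqr_ge0 (v - u).
rewrite ler_norml; case: (leP 0 u) => hu; case: (leP 0 v) => hv.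
- by apply/andP; split; nra.
- have : u * v <= 0 by rewrite mulr_ge0_le0// ltW.
  by move=> uv; apply/andP; split; rewrite expr0n /=; nra.
- have : u * v <= 0 by rewrite mulr_le0_ge0// ltW.
  by move=> uv; apply/andP; split; rewrite expr0n /=; nra.
- by apply/andP; split; rewrite expr0n /=; nra.
Qed.

Lemma dot_elem_mx (i j : 'I_n) s (x : V) :
  dot (x *m elem_mx i j s) (x *m elem_mx i j s) =
  dot x x + s * (2 * (x 0 i * x 0 j)) + s ^+ 2 * x 0 i ^+ 2.
Proof.
have -> : x *m elem_mx i j s = x + (s * x 0 i) *: delta_mx 0 j.
  by apply/rowP => k; rewrite mul_elem_mx !mxE eqxx.
rewrite !(dotDl, dotDr, dotZl, dotZr).
have h (y : V) : dot y (delta_mx 0 j) = y 0 j.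
  rewrite /dot (bigD1 j)//= big1 ?addr0; last first.
    by move=> k kj; rewrite !mxE (negbTE kj) andbF mulr0.
  by rewrite !mxE !eqxx mulr1.
by rewrite (dotC (delta_mx _ _) x) !h !mxE !eqxx /=; ring.
Qed.

(** The linear term is [2 * cutoff x] times the derivative [- 2 * (x 0 i * x 0 j)] of [1 - dot x x]
    along the motion. *)
Lemma first_order_cutoff r (i j : 'I_n) :
  first_order r (fun s x => cutoff (x *m elem_mx i j s) ^+ 2)
    (fun x => cutoff x ^+ 2) (fun x => - 4 * (x 0 i * x 0 j * cutoff x)).
Proof.
have ci k := @continuous_coord R n k.
have cij : continuous (fun x : V => x 0 i * x 0 j).
  by apply: fun_continuousM; exact: ci.
have cii : continuous (fun x : V => x 0 i * x 0 i).
  by apply: fun_continuousM; exact: ci.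
have [A A0 hA] := @continuous_ball_bounded _ r cij.
have [A' A'0 hA'] := @continuous_ball_bounded _ r cii.
have [B B0 hB] := @continuous_ball_bounded _ r continuous_cutoff.
exists ((2 * A + A') ^+ 2 + 2 * B * A' + B ^+ 2 + 4 * (A * B)).
  by rewrite !addr_ge0 ?sqr_ge0// !mulr_ge0.
move=> s x s1 xr.
have h0 : 0 <= B * A' by exact: mulr_ge0.
have h1 : 0 <= A * B by exact: mulr_ge0.
have h2 : 0 <= B ^+ 2 by exact: sqr_ge0.
have h3 : 0 <= (2 * A + A') ^+ 2 by exact: sqr_ge0.
have {}hA := hA _ xr; have {}hA' := hA' _ xr; have {}hB := hB _ xr.
split; last 2 first.
- rewrite normrX; have : `|cutoff x| ^+ 2 <= B ^+ 2 by rewrite lerXn2r ?nnegrE.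
  by lra.
- rewrite normrM (_ : `|-4| = 4); last by rewrite normrN ger0_norm.
  have : `|x 0 i * x 0 j * cutoff x| <= A * B by rewrite normrM ler_pM.
  by lra.
pose u := 1 - dot x x; pose v := 1 - dot (x *m elem_mx i j s) (x *m elem_mx i j s).
have vu : v - u = - s * (2 * (x 0 i * x 0 j) + s * (x 0 i * x 0 i)).
  by rewrite /v /u dot_elem_mx; ring.
have := sqr_max0_expand u v; rewrite -/(cutoff x) -/(cutoff _).
set c' := cutoff (_ *m _); set c := cutoff x => h.
have hs2 : 0 <= s ^+ 2 by exact: sqr_ge0.
(* The increment [v - u] itself has a term in [s ^+ 2], which is split off here. *)
have -> : c' ^+ 2 - (c ^+ 2 + s * (-4 * (x 0 i * x 0 j * c))) =
  (c' ^+ 2 - (c ^+ 2 + 2 * c * (v - u))) - 2 * (c * (x 0 i * x 0 i)) * s ^+ 2.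
  by rewrite vu; ring.
apply: le_trans (ler_normB _ _) _.
have e1 : `|2 * (c * (x 0 i * x 0 i)) * s ^+ 2| <= 2 * B * A' * s ^+ 2.
  rewrite normrM (ger0_norm hs2) ler_wpM2r// normrM ger0_norm// -mulrA ler_pM2l//.
  by rewrite normrM ler_pM.
have e2 : (v - u) ^+ 2 <= (2 * A + A') ^+ 2 * s ^+ 2.
  rewrite vu exprMn sqrrN mulrC ler_wpM2r// -real_normK ?num_real//.
  rewrite lerXn2r ?nnegrE ?addr_ge0 ?mulr_ge0//.
  apply: le_trans (ler_normD _ _) _; apply: lerD.
    by rewrite normrM ger0_norm// ler_pM2l.
  rewrite normrM; have : `|s| * `|x 0 i * x 0 i| <= 1 * A'.
    by rewrite ler_pM//; lra.
  by rewrite mul1r.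
have h4 : 0 <= (B ^+ 2 + 4 * (A * B)) * s ^+ 2 by rewrite mulr_ge0//; lra.
move: h e2 e1 h4; rewrite !mulrDl; lra.
Qed.

End first_order.

(** * Integration over the sphere through the ball *)

Section sphere_integral.
Context {R : realType} {n : nat}.
Local Notation V := 'rV[R]_n.
Local Notation S := (unit_sphere R n).
Implicit Types f : V -> R.

Lemma eq_sint f g : (forall x, S x -> f x = g x) -> sint f = sint g.
Proof. by move=> fg; apply: eq_Rintegral => x /set_mem/fg. Qed.

Lemma sphere_dotxx (x : V) : S x -> dot x x = 1.
Proof. by rewrite /unit_sphere /= -sqr_enorm => ->; rewrite expr1n. Qed.

Lemma sintD f g : continuous f -> continuous g ->
  sint (fun x => f x + g x) = sint f + sint g.
Proof.
move=> cf cg; rewrite !sint_lint//; last exact: fun_continuousD.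
rewrite -mulrDr -lintD; try exact: bounded_support_radial_ext.
congr (_ * lint _); apply/funext => x; rewrite !radial_extE.
by case: ifP => _; ring.
Qed.

Lemma sintZ (a : R) f : continuous f -> sint (fun x => a * f x) = a * sint f.
Proof.
move=> cf; rewrite !sint_lint//; last first.
  by apply: fun_continuousM => //; exact: cst_continuous.
rewrite mulrCA -(@lintZ _ _ a); last exact: bounded_support_radial_ext.
congr (_ * lint _); apply/funext => x; rewrite !radial_extE.
by case: ifP => _; ring.
Qed.

Lemma sintB f g : continuous f -> continuous g ->
  sint (fun x => f x - g x) = sint f - sint g.
Proof.
move=> cf cg; rewrite -mulN1r -sintZ// -sintD//; last first.
  by apply: fun_continuousM => //; exact: cst_continuous.
by congr sint; apply/funext => x; rewrite mulN1r.
Qed.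

Lemma sint0 : sint (fun _ : V => 0) = 0.
Proof.
rewrite -[RHS](mul0r (sint (fun _ : V => 0))) -sintZ; last exact: cst_continuous.
by congr sint; apply/funext => x; rewrite mul0r.
Qed.

Lemma sint_sum (I : Type) (s : seq I) (P : pred I) (F : I -> V -> R) :
  (forall i, continuous (F i)) ->
  sint (fun x => \sum_(i <- s | P i) F i x) = \sum_(i <- s | P i) sint (F i).
Proof.
move=> cF; elim: s => [|i s IHs].
  by rewrite [RHS]big_nil -[RHS]sint0; congr sint; apply/funext => x; rewrite big_nil.
rewrite big_cons; case: ifPn => Pi; last first.
  by rewrite -IHs; congr sint; apply/funext => x; rewrite big_cons (negbTE Pi).
rewrite -IHs -sintD//; last first.
  rewrite (_ : (fun x => _) = (fun x => \sum_(i <- [seq i <- s | P i]) F i x)).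
    exact: continuous_sum.
  by apply/funext => x; rewrite big_filter.
by congr sint; apply/funext => x; rewrite big_cons Pi.
Qed.

Lemma le_sint f g : continuous f -> continuous g ->
  (forall x, S x -> f x <= g x) -> sint f <= sint g.
Proof.
move=> cf cg fg; rewrite !sint_lint// ler_wpM2l//.
apply: le_lint; try exact: bounded_support_radial_ext.
move=> x; rewrite ler_wpM2r// !radial_extE.
by case: ifPn => // /set_mem/fg.
Qed.

Definition pos_homogeneous (d : nat) f :=
  forall t x, 0 <= t -> f (t *: x) = t ^+ d * f x.

Lemma pos_homogeneousM d e f g : pos_homogeneous d f -> pos_homogeneous e g ->
  pos_homogeneous (d + e) (fun x => f x * g x).
Proof. by move=> hf hg t x t0; rewrite hf// hg// exprD; ring. Qed.

Lemma pos_homogeneous_peval d p : homogeneous d p ->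
  pos_homogeneous d (@peval R n p).
Proof. by move=> hp t x _; rewrite (peval_homogeneous _ _ hp). Qed.

Lemma pos_homogeneous_dotxx : pos_homogeneous 2 (fun x => dot x x).
Proof. by move=> t x _; rewrite dotZl dotZr; ring. Qed.

(** On the sphere [dot x x = 1]: the powers leave the sphere integral unchanged and only raise the
    degree of homogeneity, hence the denominator. *)
Lemma lint_ball_dotX f d k : (0 < d)%N -> continuous f -> pos_homogeneous d f ->
  lint (fun x => f x * dot x x ^+ k * \1_(@unit_ball R n) x) =
  sint f / (n + d + 2 * k)%:R.
Proof.
move=> d0 cf hf.
have c2 : continuous (fun x : V => dot x x ^+ k).
  by apply: fun_continuousX; exact: continuous_dotxx.
have h2 : pos_homogeneous (d + 2 * k) (fun x => f x * dot x x ^+ k).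
  move=> t x t0; rewrite hf// pos_homogeneous_dotxx// exprMn -exprM exprD; ring.
have -> : sint f = sint (fun x => f x * dot x x ^+ k).
  by apply: eq_sint => x Sx; rewrite sphere_dotxx// expr1n mulr1.
rewrite (@sint_homogeneous _ _ _ (d + 2 * k))//.
- rewrite addnA mulrAC divff ?mul1r// pnatr_eq0 -lt0n.
  by rewrite addn_gt0 addn_gt0 d0 orbT.
- by rewrite addn_gt0 d0.
- exact: fun_continuousM.
Qed.

(** With [N = n + d], the constant is [1 / N - 1 / (N + 2)]. *)
Lemma lint_cutoff f d : (0 < d)%N -> continuous f -> pos_homogeneous d f ->
  lint (fun x => f x * cutoff x) =
  2 / ((n + d)%:R * ((n + d)%:R + 2)) * sint f.
Proof.
move=> d0 cf hf.
have c2 k : continuous (fun x : V => f x * dot x x ^+ k).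
  by apply: fun_continuousM => //; apply: fun_continuousX; exact: continuous_dotxx.
rewrite (_ : (fun x => _) = (fun x => f x * dot x x ^+ 0 * \1_(@unit_ball R n) x -
   f x * dot x x ^+ 1 * \1_(@unit_ball R n) x)); last first.
  by apply/funext => x; rewrite cutoffE expr0 expr1; ring.
rewrite lintB; try exact: bounded_support_ball.
rewrite !(@lint_ball_dotX f d)//= muln0 addn0 muln1 natrD; field.
have n0 : 0 < (n + d)%:R :> R by rewrite ltr0n addn_gt0 d0 orbT.
by apply/andP; split; apply/negP => /eqP; lra.
Qed.

(** With [N = n + d], the constant is [1 / N - 2 / (N + 2) + 1 / (N + 4)]. *)
Lemma lint_sqr_cutoff f d : (0 < d)%N -> continuous f -> pos_homogeneous d f ->
  lint (fun x => f x * cutoff x ^+ 2) =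
  8 / ((n + d)%:R * ((n + d)%:R + 2) * ((n + d)%:R + 4)) * sint f.
Proof.
move=> d0 cf hf.
have c2 k : continuous (fun x : V => f x * dot x x ^+ k).
  by apply: fun_continuousM => //; apply: fun_continuousX; exact: continuous_dotxx.
have hb k := bounded_support_ball (c2 k).
rewrite (_ : (fun x => _) = (fun x => (f x * dot x x ^+ 0 * \1_(@unit_ball R n) x -
   2 * (f x * dot x x ^+ 1 * \1_(@unit_ball R n) x)) +
   f x * dot x x ^+ 2 * \1_(@unit_ball R n) x)); last first.
  apply/funext => x; rewrite cutoffE expr0 expr1 indicE.
  by case: (x \in _); rewrite /=; ring.
rewrite lintD// ?lintB//; try exact: bounded_supportZ; last first.
  by apply: bounded_supportB => //; exact: bounded_supportZ.
rewrite lintZ// !(@lint_ball_dotX f d)//= muln0 addn0 muln1 !natrD; field.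
have n0 : 0 < (n + d)%:R :> R by rewrite ltr0n addn_gt0 d0 orbT.
rewrite natrD in n0.
by apply/and3P; split; apply/negP => /eqP; lra.
Qed.

End sphere_integral.

(** * Differentiation along shears and the divergence theorem *)

Section flux.
Context {R : realType} {n : nat}.
Local Notation V := 'rV[R]_n.
Local Notation poly := (mpoly n R).
Implicit Types f : V -> R.

Lemma continuous_row (T : topologicalType) (F : T -> V) :
  (forall i, continuous (fun x => F x 0 i)) -> continuous F.
Proof.
move=> cF x; apply/cvgrPdist_le => e e0.
have : \forall t \near nbhs x, forall i, `|F x 0 i - F t 0 i| <= e.
  apply: filter_forall => i.
  by have /cvgrPdist_le/(_ _ e0) := cF i x.
apply: filterS => t h.
by apply: mx_norm_row_le (ltW e0) _ => i; rewrite !mxE.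
Qed.

Lemma continuous_mulmxr (A : 'M[R]_n) : continuous (fun x : V => x *m A).
Proof.
apply: continuous_row => i.
rewrite (_ : (fun x : V => _) = (fun x : V => \sum_k x 0 k * A k i)).
  apply: continuous_sum => k; apply: fun_continuousM; first exact: continuous_coord.
  exact: cst_continuous.
by apply/funext => x; rewrite mxE.
Qed.

Lemma continuous_mulmxr_comp f (A : 'M[R]_n) : continuous f ->
  continuous (fun x : V => f (x *m A)).
Proof.
move=> cf x; apply: continuous_comp; last exact: cf.
exact: continuous_mulmxr.
Qed.

Lemma bounded_support_continuous f r : continuous f ->
  (forall x, r < enorm x -> f x = 0) -> bounded_support f.
Proof.
move=> cf f0; have : bounded_support (fun x => f x * \1_[set x : V | enorm x <= r] x).
  apply: bounded_supportMl => //.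
  by apply: (@bounded_support_indic _ _ _ r) => //; exact: measurable_enorm_le.
congr bounded_support; apply/funext => x; rewrite indicE.
have [xr|xr] := leP (enorm x) r; first by rewrite mem_set ?mulr1.
by rewrite f0// mul0r.
Qed.

(** The displacement is at most half of [enorm x]. Consequently a sheared cutoff still vanishes
    outside the ball of radius 2. *)
Lemma enorm_elem_mx i j s (x : V) : `|s| <= 2^-1 ->
  enorm x <= 2 * enorm (x *m elem_mx i j s).
Proof.
move=> s1.
have {1}-> : x = x *m elem_mx i j s - (s * x 0 i) *: delta_mx 0 j.
  by apply/rowP => k; rewrite mxE mul_elem_mx !mxE eqxx /=; ring.
have : enorm ((s * x 0 i) *: delta_mx 0 j : V) <= 2^-1 * enorm x.
  rewrite enormZ (_ : enorm (delta_mx 0 j) = 1); last first.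
    rewrite /enorm /dot (bigD1 j)//= big1 ?addr0; last first.
      by move=> k kj; rewrite !mxE (negbTE kj) !andbF mulr0.
    by rewrite !mxE !eqxx mulr1 sqrtr1.
  by rewrite mulr1 normrM ler_pM// coord_le_enorm.
have := enormD (x *m elem_mx i j s) (- ((s * x 0 i) *: delta_mx 0 j)).
rewrite enormN => h1 h2.
have h3 : x = x *m elem_mx i j s - (s * x 0 i) *: delta_mx 0 j.
  by apply/rowP => k; rewrite mxE mul_elem_mx !mxE eqxx /=; ring.
rewrite -h3 in h1 *; lra.
Qed.

(** Uniqueness of the first-order coefficient: expanding the weight under the integral sign gives
    one value, the hypothesis gives [th1]. The factor [f] is only integrated, never
    differentiated. *)
Lemma lint_first_order f (p : poly) i j (th0 th1 e D : R) : continuous f -> 0 < e ->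
  (forall s, `|s| < e ->
    `|lint (fun x => f x * (peval p (x *m elem_mx i j s) *
        cutoff (x *m elem_mx i j s) ^+ 2)) - (th0 + s * th1)| <= D * s ^+ 2) ->
  lint (fun x => f x * (x 0 i * peval (mderiv j p) x) * cutoff x ^+ 2 -
     4 * (f x * (x 0 i * x 0 j * peval p x) * cutoff x)) = th1.
Proof.
move=> cf e0 hth.
have hW := first_orderM (first_order_peval 2 i j p) (@first_order_cutoff R n 2 i j).
set W := (fun s x => _ * _) in hW; set W0 := (fun x => _ * _) in hW.
set W1 := (fun x => _ + _) in hW.
have [C C0 hC] := hW.
have ci k := @continuous_coord R n k.
have cc := @continuous_cutoff R n.
have cp q := @continuous_peval R n q.
have cW1 : continuous W1.
  apply: fun_continuousD.
    apply: fun_continuousM => //; apply: fun_continuousM; first exact: cst_continuous.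
    by apply: fun_continuousM => //; exact: fun_continuousM.
  by apply: fun_continuousM; [exact: fun_continuousM|exact: fun_continuousX].
have cW0 : continuous W0 by apply: fun_continuousM => //; exact: fun_continuousX.
have cW s : continuous (W s).
  apply: fun_continuousM; first exact: (@continuous_mulmxr_comp (peval p)).
  by apply: fun_continuousX; exact: (@continuous_mulmxr_comp cutoff).
have W0out x : 1 < enorm x -> W0 x = 0.
  by move=> x1; rewrite /W0 cutoff_out// expr0n mulr0.
have W1out x : 1 < enorm x -> W1 x = 0.
  by move=> x1; rewrite /W1 cutoff_out// expr0n /= !mulr0 addr0.
have Wout s x : `|s| <= 2^-1 -> 2 < enorm x -> W s x = 0.
  move=> s1 x1; rewrite /W cutoff_out ?expr0n ?mulr0//.
  by have := enorm_elem_mx i j x s1; lra.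
have bW0 : bounded_support (fun x => f x * W0 x).
  apply: (@bounded_support_continuous _ 1); first exact: fun_continuousM.
  by move=> x /W0out ->; rewrite mulr0.
have bW1 : bounded_support (fun x => f x * W1 x).
  apply: (@bounded_support_continuous _ 1); first exact: fun_continuousM.
  by move=> x /W1out ->; rewrite mulr0.
have bW s : `|s| <= 2^-1 -> bounded_support (fun x => f x * W s x).
  move=> s1; apply: (@bounded_support_continuous _ 2); first exact: fun_continuousM.
  by move=> x /(Wout _ _ s1) ->; rewrite mulr0.
have bf : bounded_support (fun x => `|f x| * \1_[set x : V | enorm x <= 2] x).
  apply: bounded_supportMl; last exact: fun_continuous_norm.
  by apply: (@bounded_support_indic _ _ _ 2) => //; exact: measurable_enorm_le.
have est s : `|s| <= 2^-1 -> `|lint (fun x => f x * W s x) -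
    (lint (fun x => f x * W0 x) + s * lint (fun x => f x * W1 x))| <=
    C * s ^+ 2 * lint (fun x => `|f x| * \1_[set x : V | enorm x <= 2] x).
  move=> s1; have bWs := bW _ s1; have bsW1 := bounded_supportZ s bW1.
  rewrite -lintZ// -lintD// -lintB//; last exact: bounded_supportD.
  rewrite -lintZ//; apply: ler_norm_lint.
  - by apply: bounded_supportB => //; exact: bounded_supportD.
  - exact: bounded_supportZ.
  move=> x; have -> : f x * W s x - (f x * W0 x + s * (f x * W1 x)) =
    f x * (W s x - (W0 x + s * W1 x)) by ring.
  rewrite normrM indicE; have [x2|x2] := leP (enorm x) 2.
    by rewrite mem_set// mulr1 mulrC ler_wpM2r//; have [] := hC s x s1 x2.
  rewrite Wout// W0out; last by lra.
  rewrite W1out; last by lra.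
  rewrite mulr0 addr0 subrr normr0 mulr0; apply: mulr_ge0; apply: mulr_ge0 => //.
  exact: sqr_ge0.
(* At [s = 0] the error bound is 0, which identifies the constant term exactly. *)
have th0E : lint (fun x => f x * W0 x) = th0.
  have := hth 0; rewrite normr0 e0 => /(_ isT).
  rewrite mul0r addr0 expr0n mulr0 normr_le0 subr_eq0 => /eqP <-.
  by congr lint; apply/funext => x; rewrite /elem_mx scale0r addr0 mulmx1.
rewrite (_ : (fun x => _) = (fun x => f x * W1 x)); last first.
  by apply/funext => x; rewrite /W1; ring.
apply/eqP; rewrite -subr_eq0; apply/eqP.
set A := lint (fun x => f x * W1 x) in est *.
set B := lint (fun x => `|f x| * _) in est *.
pose s0 := Num.min 2^-1 e.
have s00 : 0 < s0 by rewrite lt_min e0 andbT invr_gt0.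
(* At [s = t * s0] the two expansions differ by [s * (A - th1)] and agree up to a multiple of
   [s ^+ 2]; dividing by [s] leaves a bound proportional to [t]. *)
apply: (@eq0_small _ _ (s0 * `|C * B + D|)) => t /andP[t0 t1].
pose s := t * s0.
have sp : 0 < s by rewrite mulr_gt0.
have ss0 : s < s0 by rewrite gtr_pMl.
have sh : `|s| <= 2^-1 by rewrite gtr0_norm// ltW// (lt_le_trans ss0)// ge_min lexx.
have se : `|s| < e by rewrite gtr0_norm// (lt_le_trans ss0)// ge_min lexx orbT.
have h1 : `|lint (fun x => f x * W s x) - (th0 + s * th1)| <= D * s ^+ 2 := hth _ se.
have h2 := est _ sh; rewrite th0E in h2.
set L := lint (fun x => f x * W s x) in h1 h2.
have h3 : `|s * (A - th1)| <= s ^+ 2 * `|C * B + D|.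
  have -> : s * (A - th1) = (L - (th0 + s * th1)) - (L - (th0 + s * A)) by ring.
  apply: le_trans (ler_normB _ _) _; apply: le_trans (lerD h1 h2) _.
  rewrite (_ : D * s ^+ 2 + C * s ^+ 2 * B = s ^+ 2 * (C * B + D)); last by ring.
  by rewrite ler_wpM2l ?sqr_ge0// ler_norm.
rewrite mulrA -/s -(ler_pM2l sp) mulrA -expr2.
by rewrite -{1}(gtr0_norm sp) -normrM.
Qed.

(* The factor is the integral of [r ^+ (N - 1) * (1 - r ^+ 2) ^+ 2] over [0, 1],
   for [N = n + (e + m)]. *)
Lemma sint_first_order f e (p : poly) m i j (th0 th1 ep D : R) : (0 < e + m)%N ->
  continuous f -> pos_homogeneous e f -> homogeneous m p -> 0 < ep ->
  (forall s, `|s| < ep ->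
    `|lint (fun x => f x * (peval p (x *m elem_mx i j s) *
        cutoff (x *m elem_mx i j s) ^+ 2)) - (th0 + s * th1)| <= D * s ^+ 2) ->
  8 / ((n + (e + m))%:R * ((n + (e + m))%:R + 2) * ((n + (e + m))%:R + 4)) *
  sint (fun x => f x * (x 0 i * peval (mderiv j p) x -
    (n + (e + m))%:R * (x 0 i * x 0 j * peval p x))) = th1.
Proof.
move=> em cf hf hp ep0 hth; rewrite -(lint_first_order cf ep0 hth).
have ci k := @continuous_coord R n k.
have cc := @continuous_cutoff R n.
have cp q := @continuous_peval R n q.
pose F1 x := f x * (x 0 i * peval (mderiv j p) x).
pose F2 x := f x * (x 0 i * x 0 j * peval p x).
have cF1 : continuous F1 by apply: fun_continuousM => //; exact: fun_continuousM.
have cF2 : continuous F2.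
  apply: fun_continuousM => //; apply: fun_continuousM => //; exact: fun_continuousM.
have hF1 : pos_homogeneous (e + m) F1.
  apply: pos_homogeneousM => //.
  have := pos_homogeneous_peval (homogeneous_var_mderiv i j hp).
  by congr pos_homogeneous; apply/funext => x; rewrite pevalM peval_var.
have hF2 : pos_homogeneous (e + m + 2) F2.
  move=> t x t0; rewrite /F2 hf// !mxE (pos_homogeneous_peval hp)// !exprD; ring.
have b1 : bounded_support (fun x => F1 x * cutoff x ^+ 2).
  apply: (@bounded_support_continuous _ 1).
    by apply: fun_continuousM => //; exact: fun_continuousX.
  by move=> x x1; rewrite cutoff_out// expr0n mulr0.
have b2 : bounded_support (fun x => F2 x * cutoff x).
  apply: (@bounded_support_continuous _ 1); first exact: fun_continuousM.
  by move=> x x1; rewrite cutoff_out// mulr0.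
rewrite [RHS](@lintB _ _ (fun x => F1 x * cutoff x ^+ 2)
  (fun x => 4 * (F2 x * cutoff x)))//; last exact: bounded_supportZ.
(* The degree of [F2] exceeds that of [F1] by two, so its constant is [2 / ((N + 2) * (N + 4))].
   Factoring out the constant of [F1] leaves the coefficient [N] in front of [F2]. *)
rewrite lintZ// (lint_sqr_cutoff em)// (@lint_cutoff _ _ _ (e + m + 2))//; last first.
  by rewrite addn_gt0 em.
rewrite (_ : sint (fun x => f x * _) = sint F1 - (n + (e + m))%:R * sint F2).
  have N0 : 0 < (n + (e + m))%:R :> R by rewrite ltr0n addn_gt0 em orbT.
  rewrite addnA natrD; field.
  by apply/and3P; split; apply/negP => /eqP; lra.
rewrite -sintZ// -sintB//; last by apply: fun_continuousM => //; exact: cst_continuous.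
by congr sint; apply/funext => x; rewrite /F1 /F2; ring.
Qed.

Lemma mul_elem_mxV i j s : `|s| < 1 ->
  @elem_mx R n i j s *m elem_mx i j (- s / (1 + s * (i == j)%:R)) = 1%:M.
Proof.
move=> s1; set t := - s / _.
have d0 : 1 + s * (i == j)%:R != 0.
  move: s1; rewrite ltr_norml => /andP[h1 h2].
  by apply/negP => /eqP; case: eqVneq => _ /=; lra.
rewrite /elem_mx mulmxDl mul1mx mulmxDr mulmx1 -scalemxAl -scalemxAr.
rewrite mul_delta_mx_cond -[RHS]addr0 -!addrA; congr (_ + _).
rewrite /t; case: (eqVneq i j) d0 => [->|ij] /= d0; rewrite ?eqxx /= ?mulr1n.
  rewrite mulr1 in d0 *; rewrite !scalerA -!scalerDl [X in X *: _](_ : _ = 0) ?scale0r//.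
  by field; exact: d0.
by rewrite ?mulr0n !scaler0 addr0 mulr0 addr0 divr1 scaleNr addNr.
Qed.

Lemma elem_mx_unit i j s : `|s| < 1 -> @elem_mx R n i j s \in unitmx.
Proof. by move=> /(mul_elem_mxV i j)/mulmx1_unit[]. Qed.

Lemma invmx_elem_mx i j s : `|s| < 1 ->
  invmx (@elem_mx R n i j s) = elem_mx i j (- s / (1 + s * (i == j)%:R)).
Proof.
move=> s1; rewrite -[LHS]mulmx1 -(mul_elem_mxV i j s1) mulKmx//.
exact: elem_mx_unit.
Qed.

(** The substitution [u = x *m elem_mx i j s] moves the shear from [f] to the polynomial and the
    cutoff. The resulting integral is 0 for all small [s], whatever the Jacobian, so its first-order
    coefficient is 0. *)
Lemma sint_shear_vanishing f e (p : poly) m i j (ep : R) : (0 < e + m)%N ->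
  continuous f -> pos_homogeneous e f -> homogeneous m p -> 0 < ep ->
  (forall s, `|s| < ep ->
    sint (fun u : V => f (u *m invmx (elem_mx i j s)) * peval p u) = 0) ->
  sint (fun x => f x * (x 0 i * peval (mderiv j p) x -
    (n + (e + m))%:R * (x 0 i * x 0 j * peval p x))) = 0.
Proof.
move=> em cf hf hp ep0 h0.
have e20 : 0 < Num.min 2^-1 ep by rewrite lt_min ep0 invr_gt0 ltr0n.
have := @sint_first_order f e p m i j 0 0 _ 0 em cf hf hp e20.
have N0 : 0 < (n + (e + m))%:R :> R by rewrite ltr0n addn_gt0 em orbT.
set c := 8 / _; set I := sint _.
have c0 : c != 0.
  by rewrite gt_eqF// divr_gt0// !mulr_gt0//; lra.
suff H : forall s, `|s| < Num.min 2^-1 ep ->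
   lint (fun x => f x * (peval p (x *m elem_mx i j s) *
        cutoff (x *m elem_mx i j s) ^+ 2)) = 0.
  move=> h; have /eqP : c * I = 0.
    by apply: h => s /H ->; rewrite mulr0 addr0 subrr normr0 mul0r.
  by rewrite mulf_eq0 (negbTE c0) => /eqP.
move=> s; rewrite lt_min => /andP[s1 s2].
have uB : elem_mx i j s \in unitmx by apply: elem_mx_unit; lra.
have cg : continuous (fun u : V => f (u *m invmx (elem_mx i j s)) * peval p u).
  apply: fun_continuousM; first exact: continuous_mulmxr_comp.
  exact: continuous_peval.
have hg : pos_homogeneous (e + m) (fun u : V => f (u *m invmx (elem_mx i j s)) * peval p u).
  apply: pos_homogeneousM; last exact: pos_homogeneous_peval.
  by move=> t x t0; rewrite -scalemxAl hf.
pose G (u : V) := f (u *m invmx (elem_mx i j s)) * peval p u * cutoff u ^+ 2.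
have G0 : lint G = 0 by rewrite (lint_sqr_cutoff em cg hg) h0// mulr0.
have cG : continuous G.
  by apply: fun_continuousM => //; apply: fun_continuousX; exact: continuous_cutoff.
have d0 : 1 + s * (i == j)%:R != 0.
  move: s1; rewrite ltr_norml => /andP[h1 h2].
  by apply/negP => /eqP; case: eqVneq => _ /=; lra.
have := lint_dilates (dilates_elem_mx d0) (f := G); rewrite G0 mulr0 /comp => H.
rewrite -[RHS]H.
- by congr lint; apply/funext => x; rewrite /G mulmxK// mulrA.
- by rewrite invr_eq0 normr_eq0.
- apply: (@bounded_support_continuous _ 1) => // x x1.
  by rewrite /G cutoff_out// expr0n mulr0.
- apply: (@bounded_support_continuous _ 2); first exact: continuous_mulmxr_comp.
  move=> x x1; rewrite /G cutoff_out ?expr0n ?mulr0//.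
  by have := enorm_elem_mx i j x (ltW s1); lra.
Qed.

(** The case of a constant [f]: the sheared integral is [L] divided by the Jacobian
    [1 + s * (i == j)%:R], whose derivative produces the last term. This serves as divergence
    theorem on the sphere. *)
Lemma sint_divergence (p : poly) m i j : (0 < m)%N -> homogeneous m p ->
  sint (fun x => x 0 i * peval (mderiv j p) x -
    (n + m)%:R * (x 0 i * x 0 j * peval p x) + (i == j)%:R * peval p x) = 0.
Proof.
move=> m0 hp.
have ci k := @continuous_coord R n k.
have cp q := @continuous_peval R n q.
pose L := lint (fun x => peval p x * cutoff x ^+ 2).
(* For [i = j] the remainder is [L * s ^+ 2 / (1 + s)], and [1 + s > 1/2] gives the factor 2. *)
have := @sint_first_order (cst 1) 0 p m i j L (- (i == j)%:R * L) 2^-1 (2 * `|L|) m0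
  (@cst_continuous _ _ _) _ hp.
set c := 8 / _.
have c0 : c != 0.
  have N0 : 0 < (n + m)%:R :> R by rewrite ltr0n addn_gt0 m0 orbT.
  by rewrite /c add0n gt_eqF// divr_gt0// !mulr_gt0//; lra.
have LE : L = c * sint (peval p).
  rewrite /L (lint_sqr_cutoff m0)//; exact: pos_homogeneous_peval.
move=> h; rewrite sintD//; last first.
- by apply: fun_continuousM => //; exact: cst_continuous.
- apply: fun_continuousB; first exact: fun_continuousM.
  apply: fun_continuousM; first exact: cst_continuous.
  by apply: fun_continuousM => //; exact: fun_continuousM.
rewrite sintZ//; apply: (mulfI c0); rewrite mulr0 mulrDr mulrCA -LE.
apply/eqP; rewrite addr_eq0 -mulNr -h.
- by apply/eqP; congr (_ * sint _); apply/funext => x; rewrite mul1r.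
- by move=> t x _; rewrite expr0 mul1r.
- by rewrite invr_gt0.
move=> s s1.
have d0 : 0 < 1 + s * (i == j)%:R.
  move: s1; rewrite ltr_norml => /andP[h1 h2].
  by case: eqVneq => _ /=; lra.
pose G x := peval p x * cutoff x ^+ 2.
have cG : continuous G.
  by apply: fun_continuousM => //; apply: fun_continuousX; exact: continuous_cutoff.
rewrite (_ : lint _ = (1 + s * (i == j)%:R)^-1 * L).
  case: (eqVneq i j) d0 => [_|_] /= d0; last first.
    rewrite !(mulr0, addr0, invr1, mul1r, oppr0, mul0r) subrr normr0.
    by apply: mulr_ge0; [exact: mulr_ge0|exact: sqr_ge0].
  rewrite mulr1 in d0 *.
  have -> : (1 + s)^-1 * L - (L + s * (- 1 * L)) = (1 + s)^-1 * (s ^+ 2) * L.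
    by field; rewrite gt_eqF.
  rewrite 2!normrM (ger0_norm (sqr_ge0 s)) mulrAC ler_wpM2r ?sqr_ge0// ler_wpM2r//.
  rewrite gtr0_norm ?invr_gt0// -[leRHS]invrK lef_pV2 ?posrE// ?invr_gt0//.
  by move: s1; rewrite ltr_norml => /andP[h1 h2]; lra.
have := lint_dilates (dilates_elem_mx (lt0r_neq0 d0)) (f := G); rewrite /comp => H.
rewrite -[in RHS](gtr0_norm d0) -/G -H.
- by congr lint; apply/funext => x; rewrite mul1r.
- by rewrite invr_eq0 normr_eq0 gt_eqF.
- apply: (@bounded_support_continuous _ 1) => // x x1.
  by rewrite /G cutoff_out// expr0n mulr0.
- apply: (@bounded_support_continuous _ 2); first exact: continuous_mulmxr_comp.
  move=> x x1; rewrite /G cutoff_out ?expr0n ?mulr0//.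
  by have := enorm_elem_mx i j x (ltW s1); lra.
Qed.

End flux.

(** * Harmonic polynomials *)

Section harmonic_polynomials.
Context {R : realType} {n : nat}.
Local Notation V := 'rV[R]_n.
Local Notation poly := (mpoly n R).
Local Notation var := (@var R n).
Implicit Types (p q F Q : poly) (f : V -> R).

Lemma euler_homogeneous d F : homogeneous d F ->
  \sum_j var j * mderiv j F = d%:R *: F.
Proof.
move=> hF.
have e j : var j * mderiv j F =
    \sum_(m <- msupp F) mcoeff m F *: ((m j)%:R *: mpolyX R m).
  rewrite {1}[F]mpolyE raddf_sum mulr_sumr /=; apply: eq_bigr => m _.
  rewrite mderivZ mderivX -!scalerAr; congr (_ *: _).
  have [->|mj] := eqVneq (m j) 0%N; first by rewrite !scale0r.
  congr (_ *: _); rewrite -mpolyXD; congr mpolyX.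
  apply/mnmP => i; rewrite !mnmE; case: eqVneq => [<-|_]; last by rewrite subn0.
  by rewrite addnC subnK// lt0n.
rewrite (eq_bigr _ (fun j _ => e j)) exchange_big [F in RHS]mpolyE scaler_sumr /=.
rewrite [LHS]big_seq [RHS]big_seq; apply: eq_bigr => m hm.
have md : mdeg m = d by have := dhomog_mf hF hm.
by rewrite scalerA mulrC -scalerA -md mdegE natr_sum scaler_suml scaler_sumr.
Qed.

Definition harmonic_poly m p := homogeneous m p /\ laplacian p = 0.

Lemma laplacianD p q : laplacian (p + q) = laplacian p + laplacian q.
Proof. by rewrite -big_split; apply: eq_bigr => i _; rewrite !mderivD. Qed.

Lemma laplacianZ c p : laplacian (c *: p) = c *: laplacian p.
Proof. by rewrite scaler_sumr; apply: eq_bigr => i _; rewrite !mderivZ. Qed.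

Lemma laplacian_mderiv i p : laplacian (mderiv i p) = mderiv i (laplacian p).
Proof.
rewrite /laplacian raddf_sum; apply: eq_bigr => j _ /=.
by rewrite (mderiv_comm j i) (mderiv_comm j i).
Qed.

Lemma laplacianM p q : laplacian (p * q) =
  laplacian p * q + (\sum_i mderiv i p * mderiv i q) *+ 2 + p * laplacian q.
Proof.
rewrite /laplacian mulr_suml mulr_sumr mulr2n -!big_split /=.
apply: eq_bigr => i _; rewrite mderivM mderivD !mderivM; ring.
Qed.

Lemma harmonicD m p q : harmonic_poly m p -> harmonic_poly m q -> harmonic_poly m (p + q).
Proof.
move=> [hp lp] [hq lq]; split; first exact: dhomogD.
by rewrite laplacianD lp lq addr0.
Qed.

Lemma harmonicZ m c p : harmonic_poly m p -> harmonic_poly m (c *: p).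
Proof.
by move=> [hp lp]; split; [exact: dhomogZ|rewrite laplacianZ lp scaler0].
Qed.

Lemma harmonic0 m : harmonic_poly m 0.
Proof.
split; first exact: dhomog0.
by apply: big1 => i _; rewrite !mderiv0.
Qed.

Lemma harmonic_mderiv m i p : harmonic_poly m.+1 p -> harmonic_poly m (mderiv i p).
Proof.
move=> [hp lp]; split; first exact: homogeneous_mderiv.
by rewrite laplacian_mderiv lp mderiv0.
Qed.

Definition sqnorm : poly := \sum_i var i * var i.

Lemma peval_sqnorm (x : V) : peval sqnorm x = dot x x.
Proof.
by rewrite peval_sum; apply: eq_bigr => i _; rewrite pevalM peval_var.
Qed.

Lemma mderiv_sqnorm i : mderiv i sqnorm = var i *+ 2.
Proof.
rewrite /sqnorm raddf_sum (bigD1 i)//= big1 ?addr0; last first.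
  by move=> j ji; rewrite mderivM mderiv_var eq_sym (negbTE ji) mul0r mulr0 addr0.
by rewrite mderivM mderiv_var eqxx mul1r mulr1 mulr2n.
Qed.

Lemma laplacian_sqnorm : laplacian sqnorm = (2 * n)%:R.
Proof.
rewrite /laplacian (eq_bigr (fun=> 2%:R)); last first.
  by move=> i _; rewrite mderiv_sqnorm mderivMn mderiv_var eqxx.
by rewrite sumr_const card_ord mulrnA.
Qed.

Lemma homogeneous_sqnorm : homogeneous 2 sqnorm.
Proof.
apply: rpred_sum => i _; rewrite -[2%N]/(1 + 1)%N.
by apply: dhomogM; exact: homogeneous_var.
Qed.

Lemma laplacian_var i : laplacian (var i) = 0.
Proof.
apply: big1 => j _; rewrite mderiv_var.
by case: eqVneq => _; rewrite ?mderiv0//; have := mderivC j (1 : R); rewrite mpolyC1.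
Qed.

Lemma sum_mderiv_var i p : \sum_j mderiv j (var i) * mderiv j p = mderiv i p.
Proof.
rewrite (bigD1 i)//= mderiv_var eqxx mul1r big1 ?addr0// => j ji.
by rewrite mderiv_var (negbTE ji) mul0r.
Qed.

(** In terms of [k] the coefficient is [1 / (n + 2 * k - 2)]. For [k = 0] the derivative that it
    multiplies is 0, and the value is a convention. *)
Definition raise_coef (k : nat) : R :=
  if k is k'.+1 then (n + 2 * k')%:R^-1 else 0.

(* The harmonic component of degree [k + 1] of [x_j Q]. *)
Definition raise k j Q : poly := var j * Q - raise_coef k *: (sqnorm * mderiv j Q).

(** Write [D] for [mderiv j Q], harmonic of degree [k - 1]. The Laplacian of [var j * Q] is [2 D],
    and by Euler's identity that of [sqnorm * D] is [(2 n + 4 (k - 1)) D]; the coefficient is the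
    quotient. *)
Lemma harmonic_raise k j Q : (0 < n)%N -> harmonic_poly k Q -> harmonic_poly k.+1 (raise k j Q).
Proof.
move=> n0; case: k => [|k] [hQ lQ].
  rewrite /raise /raise_coef scale0r subr0.
  split; first by rewrite -[1%N]addn0; apply: dhomogM => //; exact: homogeneous_var.
  rewrite laplacianM laplacian_var lQ mul0r mulr0 addr0 add0r sum_mderiv_var.
  by rewrite homogeneous_mderiv0// mul0rn.
have hD : homogeneous k (mderiv j Q) by exact: homogeneous_mderiv.
split.
  apply: rpredB; first by rewrite -[k.+2]add1n; apply: dhomogM => //; exact: homogeneous_var.
  by apply: dhomogZ; rewrite -[k.+2]add2n; apply: dhomogM => //; exact: homogeneous_sqnorm.
rewrite /raise -scaleNr laplacianD laplacianZ !laplacianM laplacian_var lQ.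
rewrite laplacian_mderiv lQ mderiv0 sum_mderiv_var laplacian_sqnorm.
rewrite (eq_bigr (fun i => (var i * mderiv i (mderiv j Q)) *+ 2)); last first.
  by move=> i _; rewrite mderiv_sqnorm mulrnAl.
rewrite sumrMnl (euler_homogeneous hD).
have nk : (n + 2 * k)%:R != 0 :> R by rewrite pnatr_eq0 addn_eq0 (gtn_eqF n0).
rewrite mul0r !mulr0 !addr0 add0r; set D := mderiv j Q.
have -> : (2 * n)%:R * D = (2 * n)%:R *: D by rewrite mulr_natl scaler_nat.
have -> : k%:R *: D *+ 2 *+ 2 = (4%:R * k%:R) *: D.
  by rewrite -mulrnA -[RHS]scalerA [RHS]scaler_nat.
have -> : D *+ 2 = 2%:R *: D by rewrite scaler_nat.
rewrite -scalerDl scalerA -scalerDl -[RHS](scale0r D); congr (_ *: _).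
have e : (n + 2 * k)%:R = n%:R + 2 * k%:R :> R by rewrite natrD natrM.
by rewrite /raise_coef natrM e in nk *; field.
Qed.

Definition annihilates f k := forall Q, harmonic_poly k Q ->
  sint (fun x => f x * peval Q x) = 0.

(* The infinitesimal form of [f (u *m B^-1)] being orthogonal to the harmonics
   of degree [m] for all [B] near 1, when [f] is homogeneous of degree 1. *)
Definition flux_annihilates f m := forall i j p, harmonic_poly m p ->
  sint (fun x => f x * (x 0 i * peval (mderiv j p) x -
    (n + (1 + m))%:R * (x 0 i * x 0 j * peval p x))) = 0.

(** The contraction shared by the steps from degree [m] to [m + 2] and to [m - 2], which differ in
    the family [P]. *)
Lemma sum_flux_annihilates f m (P : 'I_n -> 'I_n -> poly) : continuous f ->
  flux_annihilates f m -> (forall i j, harmonic_poly m (P i j)) ->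
  sint (fun x => f x * (peval (\sum_i var i * \sum_j mderiv j (P i j)) x -
    (n + (1 + m))%:R * peval (\sum_i var i * \sum_j var j * P i j) x)) = 0.
Proof.
move=> cf hf hP.
pose F i j (x : V) := f x * (x 0 i * peval (mderiv j (P i j)) x -
    (n + (1 + m))%:R * (x 0 i * x 0 j * peval (P i j) x)).
have cF i j : continuous (F i j).
  have -> : F i j = (fun x => f x * (peval (var i * mderiv j (P i j)) x -
    (n + (1 + m))%:R * peval (var i * var j * P i j) x)).
    by apply/funext => x; rewrite /F !pevalM !peval_var.
  apply: fun_continuousM => //; apply: fun_continuousB; first exact: continuous_peval.
  by apply: fun_continuousM; [exact: cst_continuous|exact: continuous_peval].
have : \sum_i \sum_j sint (F i j) = 0.
  by apply: big1 => i _; apply: big1 => j _; exact: hf.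
rewrite (eq_bigr (fun i => sint (fun x => \sum_j F i j x))); last first.
  by move=> i _; rewrite sint_sum.
rewrite -sint_sum; last by move=> i; exact: continuous_sum.
move=> <-; congr sint; apply/funext => x; rewrite !peval_sum !mulr_sumr -sumrB mulr_sumr.
apply: eq_bigr => i _; rewrite !pevalM !peval_sum !peval_var !mulr_sumr -sumrB mulr_sumr.
by apply: eq_bigr => j _; rewrite !pevalM !peval_var /F; ring.
Qed.

(** The derivative term contracts to the Laplacian of [mderiv i Q], which is 0; in the other one,
    Euler's identity used twice leaves [(m + 2) * (m + 1)] times [Q]. *)
Lemma annihilates_raise f m : continuous f -> flux_annihilates f m ->
  annihilates f m.+2.
Proof.
move=> cf hf Q [hQ lQ].
have hP i j : harmonic_poly m (mderiv j (mderiv i Q)).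
  by do 2 apply: harmonic_mderiv.
have := sum_flux_annihilates cf hf hP.
have -> : \sum_i var i * \sum_j mderiv j (mderiv j (mderiv i Q)) = 0.
  apply: big1 => i _; rewrite -[X in _ * X]/(laplacian (mderiv i Q)).
  by rewrite laplacian_mderiv lQ mderiv0 mulr0.
have -> : \sum_i var i * \sum_j var j * mderiv j (mderiv i Q) =
    (m.+2%:R * m.+1%:R) *: Q.
  rewrite mulrC -scalerA -(euler_homogeneous hQ) scaler_sumr; apply: eq_bigr => i _.
  by rewrite (euler_homogeneous (homogeneous_mderiv i hQ)) scalerAr.
set c := (n + _)%:R; set d := _ * _ => h.
have cd : - (c * d) != 0 by rewrite oppr_eq0 !mulf_neq0// pnatr_eq0 ?addnS.
apply: (mulfI cd); rewrite mulr0 -h -sintZ; last first.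
  by apply: fun_continuousM => //; exact: continuous_peval.
by congr sint; apply/funext => x; rewrite peval0 pevalZ; ring.
Qed.

(* Raising [Q] twice and summing gives [b * (1 - a * k) * (k - 1) * (n + k - 1)]
   times [Q] on the sphere, where [a] and [b] are the raising coefficients: this
   vanishes only for [k = 1]. *)
Lemma annihilates_lower f k : (1 < n)%N -> k != 1%N -> continuous f ->
  flux_annihilates f k.+2 -> annihilates f k.
Proof.
move=> n1 k1 cf hf Q HQ; have [hQ lQ] := HQ.
have n0 : (0 < n)%N by exact: ltnW.
have hFi i : harmonic_poly k.+1 (raise k i Q) by exact: harmonic_raise.
have hP i j : harmonic_poly k.+2 (raise k.+1 j (raise k i Q)) by exact: harmonic_raise.
have := sum_flux_annihilates cf hf hP.
pose a := raise_coef k; pose b := raise_coef k.+1.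
pose K : R := k%:R; pose N : R := n%:R.
have n2 : 2 <= N by rewrite (ler_nat _ 2).
have K0 : 0 <= K by rewrite ler0n.
have nk : N + 2 * K != 0 by apply/negP => /eqP; lra.
have bE : b = (N + 2 * K)^-1 by rewrite /b /raise_coef natrD natrM.
have E1 : \sum_i var i * raise k i Q = (1 - a * K) *: (sqnorm * Q).
  rewrite /raise -/a; under eq_bigr => i _ do rewrite mulrBr mulrA -scalerAr mulrCA.
  rewrite sumrB -mulr_suml -/sqnorm -scaler_sumr -mulr_sumr (euler_homogeneous hQ).
  by rewrite -scalerAr scalerA scalerBl scale1r.
(* The Laplacian of the harmonic [F] drops out, and Euler's identity turns the remaining sum into a
   multiple of [F]. *)
have E2 i : \sum_j mderiv j (raise k.+1 j (raise k i Q)) =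
    (N + K + 1 - 2 * b * (K + 1)) *: raise k i Q.
  set F := raise k i Q; have [hF lF] := hFi i; rewrite -/F in hF lF.
  rewrite /raise -/b.
  rewrite (eq_bigr (fun j => (F + (1 - 2 * b) *: (var j * mderiv j F)) -
      b *: (sqnorm * mderiv j (mderiv j F)))); last first.
    move=> j _; rewrite mderivB mderivZ !mderivM mderiv_var eqxx mul1r mderiv_sqnorm.
    have -> : (1 - 2 * b) *: (var j * mderiv j F) =
        var j * mderiv j F - b *: (var j * mderiv j F) *+ 2.
      by rewrite scalerBl scale1r [2 * b]mulrC -scalerA scaler_nat scalerMnr.
    by rewrite mulrnAl scalerDr -scalerMnr opprD !addrA.
  rewrite sumrB big_split /= -!scaler_sumr -mulr_sumr -/(laplacian F) lF mulr0.
  rewrite scaler0 subr0 sumr_const card_ord (euler_homogeneous hF) -scaler_nat.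
  rewrite scalerA -scalerDl; congr (_ *: _); rewrite -natr1 -/N -/K; ring.
have E3 i : \sum_j var j * raise k.+1 j (raise k i Q) =
    (1 - b * (K + 1)) *: (sqnorm * raise k i Q).
  set F := raise k i Q; have [hF lF] := hFi i; rewrite -/F in hF lF.
  rewrite /raise -/b; under eq_bigr => j _ do rewrite mulrBr mulrA -scalerAr mulrCA.
  rewrite sumrB -mulr_suml -/sqnorm -scaler_sumr -mulr_sumr (euler_homogeneous hF).
  by rewrite -scalerAr scalerA scalerBl scale1r -natr1.
have -> : \sum_i var i * \sum_j mderiv j (raise k.+1 j (raise k i Q)) =
    (N + K + 1 - 2 * b * (K + 1)) *: ((1 - a * K) *: (sqnorm * Q)).
  by rewrite -E1 scaler_sumr; apply: eq_bigr => i _; rewrite E2 scalerAr.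
have -> : \sum_i var i * \sum_j var j * raise k.+1 j (raise k i Q) =
    (1 - b * (K + 1)) *: (sqnorm * ((1 - a * K) *: (sqnorm * Q))).
  rewrite -E1 mulr_sumr scaler_sumr; apply: eq_bigr => i _.
  by rewrite E3 -scalerAr mulrCA.
move=> h.
have ak : 1 - a * K != 0.
  rewrite /a /K; case: (k) => [|k']; first by rewrite mul0r subr0 oner_eq0.
  rewrite /raise_coef natrD natrM -/N -(natr1 k').
  have : 0 <= k'%:R :> R by rewrite ler0n.
  move: (k'%:R : R) => t t0.
  have t2 : N + 2 * t != 0 by apply/negP => /eqP; lra.
  rewrite (_ : 1 - _ = (N + t - 1) / (N + 2 * t)); last by field.
  by rewrite mulf_neq0 ?invr_neq0//; apply/negP => /eqP; lra.
pose C := (1 - a * K) * (b * (K - 1) * (N + K - 1)).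
have C0 : C != 0.
  rewrite !mulf_neq0// ?bE ?invr_neq0//; last by apply/negP => /eqP; lra.
  by rewrite subr_eq0 /K (eqr_nat _ k 1).
apply: (mulfI C0); rewrite mulr0 -h -sintZ; last first.
  by apply: fun_continuousM => //; exact: continuous_peval.
(* The two contractions are multiples of [sqnorm * Q] and of [sqnorm * (sqnorm * Q)]; only on the
   sphere do they combine into one multiple of [Q]. *)
apply: eq_sint => x Sx; rewrite !pevalZ !pevalM peval_sqnorm sphere_dotxx//.
rewrite !pevalZ !pevalM peval_sqnorm sphere_dotxx// !mul1r.
rewrite /C bE !natrD -[k.+2]addn2 natrD -/N -/K; field; exact: nk.
Qed.

End harmonic_polynomials.

(** * Orthogonality of harmonics and positivity of the integral *)

Section orthogonality.
Context {R : realType} {n : nat}.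
Local Notation V := 'rV[R]_n.
Local Notation poly := (mpoly n R).
Local Notation S := (unit_sphere R n).
Local Notation var := (@var R n).
Implicit Types (p q F Q : poly) (f : V -> R).

(** Green's identity: the field [F = p grad q - q grad p] has divergence 0 since [p] and [q] are
    harmonic, while its radial component is the difference of the degrees times [p * q]. *)
Lemma sint_harmonicM m k p q : (1 < n)%N -> (0 < m)%N -> (0 < k)%N -> m != k ->
  harmonic_poly m p -> harmonic_poly k q -> sint (fun x => peval p x * peval q x) = 0.
Proof.
move=> n1 m0 k0 mk [hp lp] [hq lq].
case: m => // m in m0 mk hp *; case: k => // k in k0 mk hq *.
pose F j := p * mderiv j q - q * mderiv j p.
have hF j : homogeneous (m + k).+1 (F j).
  apply: rpredB.
    by rewrite -addSn; apply: dhomogM => //; exact: homogeneous_mderiv.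
  by rewrite -addnS addnC; apply: dhomogM => //; exact: homogeneous_mderiv.
have sF : \sum_j var j * F j = (k.+1%:R - m.+1%:R) *: (p * q).
  rewrite /F; under eq_bigr => j _ do rewrite mulrBr mulrCA [var j * (q * _)]mulrCA.
  rewrite sumrB -!mulr_sumr (euler_homogeneous hp) (euler_homogeneous hq).
  by rewrite -!scalerAr scalerBl (mulrC q).
have dF : \sum_j mderiv j (F j) = 0.
  rewrite (eq_bigr (fun j => p * mderiv j (mderiv j q) - q * mderiv j (mderiv j p))).
    by rewrite sumrB -!mulr_sumr -!/(laplacian _) lp lq !mulr0 subrr.
  by move=> j _; rewrite mderivB !mderivM; ring.
have hxF i j : homogeneous (m + k).+2 (var i * F j).
  by rewrite -[(m + k).+2]add1n; exact: (dhomogM (@homogeneous_var R n i) (hF j)).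
pose N : R := (n + (m + k).+2)%:R.
(* [sint_divergence] is applied to [var i * F j]: summing over [i] then turns the pairs of factors
   [var i] into [sqnorm], which is 1 on the sphere. *)
pose G i j := var i * mderiv j (var i * F j) - N *: (var i * var j * (var i * F j)) +
    (i == j)%:R *: (var i * F j).
have GE i j : sint (peval (G i j)) = 0.
  rewrite -(@sint_divergence _ _ (var i * F j) _ i j _ (hxF i j))//; congr sint.
  by apply/funext => x; rewrite pevalD pevalB !pevalM !pevalZ !pevalM !peval_var -/N; ring.
have : sint (peval (\sum_i \sum_j G i j)) = 0.
  rewrite (_ : peval _ = fun x => \sum_i peval (\sum_j G i j) x); last first.
    by apply/funext => x; rewrite peval_sum.
  rewrite sint_sum; last by move=> i; exact: continuous_peval.
  apply: big1 => i _.
  rewrite (_ : peval _ = fun x => \sum_j peval (G i j) x); last first.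
    by apply/funext => x; rewrite peval_sum.
  rewrite sint_sum; last by move=> j; exact: continuous_peval.
  by apply: big1 => j _.
have -> : \sum_i \sum_j G i j = \sum_j (2%:R *: (var j * F j) +
    sqnorm * mderiv j (F j) - N *: (sqnorm * (var j * F j))).
  rewrite exchange_big; apply: eq_bigr => j _ /=.
  rewrite (eq_bigr (fun i => (i == j)%:R *: (2%:R *: (var i * F j)) +
     (var i * var i) * (mderiv j (F j) - N *: (var j * F j)))); last first.
    move=> i _; rewrite /G mderivM mderiv_var eq_sym.
    case: eqVneq => [->|_] /=; rewrite ?scale1r ?scale0r -!mul_mpolyC ?(mpolyC_nat 2); ring.
  rewrite big_split /= -mulr_suml -/sqnorm mulrBr -scalerAr addrA; congr (_ + _ - _).
  rewrite (bigD1 j)//= eqxx scale1r big1 ?addr0// => i ij.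
  by rewrite (negbTE ij) scale0r.
rewrite sumrB big_split /= -!scaler_sumr -!mulr_sumr dF sF mulr0 addr0.
(* The 2 collects the derivative of the factor [var i] and the Kronecker term of
   [sint_divergence]. *)
pose c : R := (2 - N) * (k.+1%:R - m.+1%:R).
have c0 : c != 0.
  rewrite mulf_neq0//.
    rewrite /N subr_eq0 eqr_nat addnS addnS -[2%N]/(0.+2) !eqSS.
    by rewrite eq_sym addn_eq0 (gtn_eqF (ltnW n1)).
  by rewrite subr_eq0 eqr_nat eq_sym.
move=> h; apply: (mulfI c0); rewrite mulr0 -h -sintZ; last first.
  by apply: fun_continuousM; exact: continuous_peval.
apply: eq_sint => x Sx; rewrite pevalB !pevalZ !pevalM !pevalZ peval_sqnorm.
by rewrite sphere_dotxx// pevalM mul1r /c; ring.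
Qed.

(** The coordinate is moved to [Q]: on the sphere [var j * Q] is the harmonic [raise k j Q] of
    degree [k + 1] plus a multiple of the harmonic [mderiv j Q] of degree [k - 1]. *)
Lemma annihilates_var f j : (0 < n)%N -> continuous f ->
  (forall k, annihilates f k) -> forall k, annihilates (fun x => x 0 j * f x) k.
Proof.
move=> n0 cf hf k Q hQ.
have cp q := @continuous_peval R n q.
have -> : sint (fun x => x 0 j * f x * peval Q x) =
    sint (fun x => f x * peval (raise k j Q) x +
      raise_coef (R := R) (n := n) k * (f x * peval (mderiv j Q) x)).
  apply: eq_sint => x Sx; rewrite /raise pevalB pevalZ !pevalM peval_sqnorm.
  by rewrite sphere_dotxx// peval_var; ring.
rewrite sintD; last 2 first.
- exact: fun_continuousM.
- by apply: fun_continuousM; [exact: cst_continuous|exact: fun_continuousM].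
rewrite sintZ; last exact: fun_continuousM.
rewrite (hf k.+1); last exact: harmonic_raise.
case: k hQ => [|k] hQ; first by rewrite mul0r addr0.
by rewrite (hf k) ?mulr0 ?addr0//; exact: harmonic_mderiv.
Qed.

(** By induction on [p], the product of [p] and [f] is again orthogonal to all harmonics; testing it
    against the harmonic 1 gives the claim. The function is generalized for the sake of products. *)
Lemma annihilates_polynomials f p : (0 < n)%N -> continuous f ->
  (forall k, annihilates f k) -> sint (fun x => f x * peval p x) = 0.
Proof.
move=> n0 cf hf.
have cp q := @continuous_peval R n q.
suff H q : forall g, continuous g -> (forall k, annihilates g k) ->
    forall k, annihilates (fun x => peval q x * g x) k.
  have h1 : harmonic_poly 0 (1 : poly).
    split; first exact: dhomog1.
    apply: big1 => i _; rewrite (_ : mderiv i 1 = 0) ?mderiv0//.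
    by have := mderivC i (1 : R); rewrite mpolyC1.
  rewrite -[RHS](H p f cf hf 0%N 1 h1).
  by congr sint; apply/funext => x; rewrite peval1 mulr1 mulrC.
elim/(@mpoly_ring_ind R n): q => [c|i|p1 p2 h1 h2|p1 p2 h1 h2] g cg hg k Q hQ.
- rewrite -[RHS](mulr0 c) -(hg k Q hQ) -sintZ; last exact: fun_continuousM.
  by congr sint; apply/funext => x; rewrite pevalC mulrA.
- rewrite -[RHS](@annihilates_var g i n0 cg hg k Q hQ).
  by congr sint; apply/funext => x; rewrite peval_var.
- rewrite -[RHS](addr0 0) -{1}(h1 g cg hg k Q hQ) -(h2 g cg hg k Q hQ) -sintD.
  + by congr sint; apply/funext => x; rewrite pevalD; ring.
  + by apply: fun_continuousM => //; exact: fun_continuousM.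
  + by apply: fun_continuousM => //; exact: fun_continuousM.
- have := h1 (fun x => peval p2 x * g x) _ (h2 g cg hg) k Q hQ.
  rewrite -[in X in _ -> X]/(_ = _) => <-; last exact: fun_continuousM.
  by congr sint; apply/funext => x; rewrite pevalM mulrA.
Qed.

Lemma sint_opp f : continuous f -> sint (fun x => f (- x)) = sint f.
Proof.
move=> cf.
have cf' : continuous (fun x : V => f (- x)).
  by move=> x; apply: continuous_comp; [exact: opp_continuous|exact: cf].
rewrite !sint_lint//; congr (_ * _).
have N1 : (-1 : R) != 0 by rewrite oppr_eq0 oner_eq0.
have B1 := bounded_support_radial_ext cf; have B2 := bounded_support_radial_ext cf'.
have E : (fun x => radial_ext f x * \1_(@unit_ball R n) x) \o (fun x : V => -1 *: x) =
    (fun x => radial_ext (fun y => f (- y)) x * \1_(@unit_ball R n) x).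
  apply/funext => x /=; rewrite !radial_extE !scaleN1r.
  have -> : direction (- x) = - direction x by rewrite /direction enormN scalerN.
  have -> : (- direction x \in S) = (direction x \in S).
    by apply/idP/idP => /set_mem h; apply/mem_set; move: h;
      rewrite /unit_sphere /= enormN.
  rewrite !indicE; suff -> : (- x \in @unit_ball R n) = (x \in @unit_ball R n) by [].
  by apply/idP/idP => /set_mem h; apply/mem_set; move: h;
    rewrite /unit_ball /= enormN.
have := lint_dilates (@dilates_scale R n _ N1) _ B1.
rewrite E normrN1 expr1n invr1 mul1r oner_eq0 => -> //.
Qed.

Lemma continuous_direction (x : V) : x != 0 -> {for x, continuous (@direction R n)}.
Proof.
move=> x0.
have h : (enorm y)^-1 @[y --> nbhs x] --> (enorm x)^-1.
  apply: (@cvgV _ _ (nbhs x) _ (@enorm R n)); first by rewrite enorm_eq0.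
  exact: continuous_enorm.
exact: cvgZ h cvg_id.
Qed.

Lemma sint_gt0 f u : continuous f -> (forall x, S x -> 0 <= f x) -> S u ->
  0 < f u -> 0 < sint f.
Proof.
move=> cf f0 Su fu; rewrite sint_lint//.
have n0 : (0 < n)%N.
  case: (posnP n) => // n0; exfalso; apply: (@notin_sphere0 R n).
  suff <- : u = 0 by [].
  by apply/rowP => i; have := ltn_ord i; rewrite {2}n0.
apply: mulr_gt0; first by rewrite ltr0n.
(* Halfway to [u], a whole neighbourhood lies in the ball and avoids the origin, where [direction]
   is discontinuous. *)
pose c : V := 2^-1 *: u.
have ec : enorm c = 2^-1 by rewrite enormZ ger0_norm// Su mulr1.
have c0 : c != 0 by rewrite -enorm_eq0 ec invr_eq0 pnatr_eq0.
have dc : direction c = u by rewrite /direction ec /c scalerA mulVf ?scale1r.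
have : \forall x \near nbhs c, [/\ f u / 2 <= f (direction x), enorm x <= 1 & x != 0].
  have h1 : \forall x \near nbhs c, f u / 2 <= f (direction x).
    have cfd : {for c, continuous (f \o @direction R n)}.
      by apply: continuous_comp; [exact: continuous_direction|exact: cf].
    have := cvgr_ge _ cfd (f u / 2); rewrite /= dc; apply; lra.
  have h2 : \forall x \near nbhs c, enorm x <= 1.
    by have := cvgr_le _ (@continuous_enorm R n c) 1; rewrite ec; apply; lra.
  have h3 : \forall x \near nbhs c, 0 < enorm x.
    by have := cvgr_gt _ (@continuous_enorm R n c) 0; rewrite ec; apply; lra.
  by near=> x; split; [near: x|near: x|rewrite -enorm_gt0; near: x].
move=> /nbhs_normP[r /= r0 hr].
apply: (@lint_gt0 _ _ _ c (r / 2) (f u / 2)).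
- exact: bounded_support_radial_ext.
- move=> x; rewrite radial_extE mulr_ge0 ?indicE//.
  by case: ifPn => // /set_mem; exact: f0.
- by rewrite divr_gt0.
- by rewrite divr_gt0.
move=> x cx; have [|h1 h2 h3] := hr x.
  rewrite /= (@le_lt_trans _ _ (r / 2))//; last by lra.
  rewrite distrC; apply: mx_norm_row_le; first by lra.
  by move=> i; have := cx i; rewrite !mxE.
rewrite radial_extE mem_set; last exact: direction_sphere.
by rewrite indicE mem_set ?mulr1.
Unshelve. all: by end_near. Qed.

End orthogonality.

(** * Completeness of polynomials on the sphere *)

Section completeness.
Context {R : realType} {n : nat}.
Local Notation V := 'rV[R]_n.
Local Notation poly := (mpoly n R).
Local Notation S := (unit_sphere R n).
Implicit Types (f : V -> R).

Let cap (v : V) : poly := 2^-1 *: (1 + \sum_i v 0 i *: var i).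

Let peval_cap v x : peval (cap v) x = (1 + dot x v) / 2.
Proof.
rewrite /cap pevalZ pevalD peval1 peval_sum mulrC; congr ((_ + _) / _).
by apply: eq_bigr => i _; rewrite pevalZ peval_var mulrC.
Qed.

Lemma peval_exp (p : poly) k (x : V) : peval (p ^+ k) x = peval p x ^+ k.
Proof. exact: rmorphXn. Qed.

Lemma dot_sphere_le (u v : V) : S u -> S v -> `|dot u v| <= 1.
Proof. by move=> Su Sv; have := dot_le_enorm u v; rewrite Su Sv mulr1. Qed.

(* The powers of [(1 + <u, v>) / 2] concentrate at [v]. *)
Lemma polynomials_total_le0 f : continuous f ->
  (forall p, sint (fun x => f x * peval p x) = 0) -> forall v, S v -> f v <= 0.
Proof.
move=> cf hf v Sv; rewrite leNgt; apply/negP => fv.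
pose d := f v / 2; have d0 : 0 < d by rewrite divr_gt0.
have [e /andP[e0 e1] he] : exists2 e, 0 < e < 1 &
    forall u, S u -> 1 - e <= dot u v -> d <= f u.
  have : \forall x \near nbhs v, d <= f x.
    by have := cvgr_ge _ (cf v) d; apply; rewrite /d; lra.
  move=> /nbhs_normP[r /= r0 hr].
  (* For unit vectors [|u - v| ^ 2 = 2 - 2 <u, v>], which is at most [r ^ 2 / 2] if
     [<u, v> >= 1 - r ^ 2 / 4]. *)
  exists (Num.min 2^-1 (r ^+ 2 / 4)).
    rewrite lt_min gt_min !divr_gt0 ?exprn_gt0// andbT invr_gt0 ltr0n /=.
    by rewrite invf_lt1 ?ltr1n.
  move=> u Su uv; apply: hr; rewrite /= distrC.
  apply: le_lt_trans (norm_le_enorm _) _.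
  rewrite -(@ltr_pXn2r _ 2)// ?nnegrE ?enorm_ge0 ?ltW// sqr_enorm.
  rewrite !(dotDl, dotDr, dotNl, dotNr) (dotC v u) !sphere_dotxx//.
  have h : 1 - r ^+ 2 / 4 <= dot u v.
    by apply: le_trans uv; rewrite lerD2l lerN2 ge_min lexx orbT.
  have : 0 < r ^+ 2 by rewrite exprn_gt0.
  by lra.
have [C fC] := continuous_sphere_bounded cf.
have C0 : 0 <= C by apply: le_trans (fC _ Sv).
(* Where [dot x v < 1 - e], [cap v] is below [q], so that this region contributes at most a multiple
   of [q ^+ N], negligible against [q' ^+ N]. *)
pose q := 1 - e / 2; pose q' := 1 - e / 4.
have q0 : 0 < q by rewrite /q; lra.
have q'0 : 0 < q' by rewrite /q'; lra.
have qq' : q < q' by rewrite /q /q'; lra.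
have cc k : continuous (fun x => peval (cap v) x ^+ k).
  by apply: fun_continuousX; exact: continuous_peval.
(* A continuous substitute for the indicator of the region [cap v > q'], where [f >= d]. *)
pose psi (x : V) := Num.max 0 (peval (cap v) x - q').
have cpsi : continuous psi.
  apply: fun_continuous_max0; apply: fun_continuousB; last exact: cst_continuous.
  exact: continuous_peval.
have I0 : 0 < sint psi.
  apply: (@sint_gt0 _ _ psi v) => //.
    by move=> x _; rewrite /psi le_max lexx.
  by rewrite /psi lt_max peval_cap sphere_dotxx// /q'; apply/orP; right; lra.
(* On the sphere the difference of the integrands is at most [f] times the [N]-th power of [cap v],
   whose integral is 0 by hypothesis. *)
have key N : d * q' ^+ N * sint psi <= C * q ^+ N * sint (cst (1 : R) : V -> R).
  have c1 : continuous (fun x => d * q' ^+ N * psi x).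
    by apply: fun_continuousM => //; exact: cst_continuous.
  have c2 : continuous (fun x : V => C * q ^+ N * (cst 1 x : R)).
    by apply: fun_continuousM; exact: cst_continuous.
  rewrite -!sintZ//; last exact: cst_continuous.
  rewrite -subr_le0 -sintB// -[leRHS](hf (cap v ^+ N)).
  apply: le_sint => //; first exact: fun_continuousB.
    by apply: fun_continuousM => //; exact: continuous_peval.
  move=> x Sx; rewrite peval_exp /cst mulr1 /psi peval_cap.
  have := dot_sphere_le Sx Sv; rewrite ler_norml => /andP[xv1 xv2].
  have k0 : 0 <= (1 + dot x v) / 2 by rewrite divr_ge0//; lra.
  set k := _ / 2 in k0 *.
  have CqN : 0 <= C * q ^+ N by rewrite mulr_ge0// exprn_ge0// ltW.
  have kN : 0 <= k ^+ N by exact: exprn_ge0.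
  have q'N : 0 <= q' ^+ N by rewrite exprn_ge0// ltW.
  have [xv|xv] := leP (1 - e) (dot x v).
    have fx := he _ Sx xv.
    have [kq|kq] := leP (k - q') 0.
      rewrite mulr0 sub0r; apply: (@le_trans _ _ 0); first by rewrite oppr_le0.
      by rewrite mulr_ge0// (le_trans _ fx)// ltW.
    rewrite lerBlDr; apply: (@le_trans _ _ (f x * k ^+ N)); last by rewrite lerDl.
    have kq' : q' ^+ N <= k ^+ N by rewrite lerXn2r ?nnegrE ?ltW//; lra.
    apply: (@le_trans _ _ (d * q' ^+ N)).
      rewrite ler_piMr//; first by rewrite mulr_ge0// ltW.
      by rewrite /k; lra.
    by rewrite ler_pM// ltW.
  have kq : k - q' <= 0 by rewrite /k /q'; lra.
  rewrite (max_idPl kq) mulr0 sub0r.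
  have : `|f x * k ^+ N| <= C * q ^+ N.
    rewrite normrM ler_pM// ?fC// (ger0_norm kN) lerXn2r ?nnegrE ?(ltW q0)//.
    by rewrite /k /q; lra.
  by rewrite ler_norml => /andP[].
pose z := q / q'; have z0 : 0 <= z by rewrite divr_ge0// ltW.
have z1 : z < 1 by rewrite ltr_pdivrMr// mul1r.
have zN : z ^+ N @[N --> \oo] --> (0 : R).
  by apply: cvg_expr; rewrite ger0_norm.
pose s := sint (cst (1 : R) : V -> R).
have dI : 0 < d * sint psi by exact: mulr_gt0.
have : \forall N \near \oo, C * s * z ^+ N < d * sint psi.
  apply: cvgr_lt; last exact: dI.
  by rewrite -(mulr0 (C * s)); apply: cvgM zN; exact: cvg_cst.
move=> [N _ /(_ N (leqnn N))] /=; apply/negP; rewrite -leNgt.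
have q'N : 0 < q' ^+ N by exact: exprn_gt0.
rewrite -(ler_pM2r q'N) /z expr_div_n; have := key N; rewrite -/s => h.
rewrite (_ : C * s * _ * _ = C * q ^+ N * s); last by field; rewrite gt_eqF.
by rewrite mulrAC.
Qed.

Lemma polynomials_total f : continuous f ->
  (forall p, sint (fun x => f x * peval p x) = 0) -> forall v, S v -> f v = 0.
Proof.
move=> cf hf v Sv; apply/le_anti/andP; split; first exact: polynomials_total_le0.
rewrite -oppr_le0 -mulN1r.
apply: (@polynomials_total_le0 (fun x => -1 * f x) _ _ v Sv).
  by apply: fun_continuousM => //; exact: cst_continuous.
move=> p; rewrite -(mulr0 (-1)) -(hf p) -sintZ.
  by congr sint; apply/funext => x; rewrite mulrA.
by apply: fun_continuousM => //; exact: continuous_peval.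
Qed.

End completeness.

(** * Support functions *)

Section support_functions.
Context {R : realType} {n : nat}.
Local Notation V := 'rV[R]_n.
Local Notation S := (unit_sphere R n).
Implicit Types (K : set V) (x y : V).

Lemma compact_enorm_bounded K : compact K ->
  exists2 M, 0 <= M & forall y, K y -> enorm y <= M.
Proof.
have [->|/set0P K0] := eqVneq K set0; first by exists 0.
move=> cK; have [c _ hc] := @compact_EVT_max _ _ (@enorm R n) K K0 cK
  (continuous_subspaceT (@continuous_enorm R n)).
exists (enorm c); first exact: enorm_ge0.
by move=> y Ky; apply: hc; exact/mem_set.
Qed.

Lemma continuous_sub_comp (f : V -> R) x : continuous f ->
  continuous (fun y => f (x - y)).
Proof.
move=> cf y; apply: (@continuous_comp _ _ _ (fun y : V => x - y) f); last exact: cf.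
move: y; apply: continuous_row => i.
have -> : (fun y : V => (x - y) 0 i) = (fun y => x 0 i - y 0 i).
  by apply/funext => y; rewrite !mxE.
by apply: fun_continuousB; [exact: cst_continuous|exact: continuous_coord].
Qed.

Section body.
Variable K : set V.
Hypotheses (K0 : K !=set0) (cK : compact K).
Local Notation h := (support_function K).

Lemma has_sup_support x : has_sup [set dot x y | y in K].
Proof.
split; first by have [y Ky] := K0; exists (dot x y), y.
have [M M0 hM] := compact_enorm_bounded cK.
exists (enorm x * M) => _ [y Ky <-]; apply: le_trans (dot_le _ _) _.
by rewrite ler_wpM2l ?enorm_ge0// hM.
Qed.

Lemma dot_le_support x y : K y -> dot x y <= h x.
Proof.
by move=> Ky; apply: ub_le_sup; [case: (has_sup_support x)|exists y].
Qed.

Lemma support_le x b : (forall y, K y -> dot x y <= b) -> h x <= b.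
Proof.
move=> hb; apply: ge_sup; first by case: (has_sup_support x).
by move=> _ [y Ky <-]; exact: hb.
Qed.

Lemma support_pos_homogeneous : pos_homogeneous 1 h.
Proof.
move=> t x; rewrite expr1 le_eqVlt => /predU1P[<-|t0].
  rewrite scale0r mul0r; apply/le_anti/andP; split.
    by apply: support_le => y _; rewrite dot0l.
  by have [y Ky] := K0; rewrite -(dot0l y); exact: dot_le_support.
apply/le_anti/andP; split.
  apply: support_le => y Ky; rewrite dotZl ler_pM2l//; exact: dot_le_support.
rewrite -ler_pdivlMl//; apply: support_le => y Ky.
rewrite ler_pdivlMl// -dotZl; exact: dot_le_support.
Qed.

Lemma support_lipschitz : exists2 M, 0 <= M &
  forall x x', h x <= h x' + enorm (x - x') * M.
Proof.
have [M M0 hM] := compact_enorm_bounded cK; exists M => // x x'.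
apply: support_le => y Ky; rewrite -{1}[x](subrK x') addrC dotDl.
apply: lerD; first exact: dot_le_support.
by apply: le_trans (dot_le _ _) _; rewrite ler_wpM2l ?enorm_ge0// hM.
Qed.

Lemma continuous_support : continuous h.
Proof.
have [M M0 lip] := support_lipschitz.
move=> x; apply: (@cvgrPdist_le _ _ _ (nbhs x) (nbhs_filter x) h (h x)).2 => e e0.
have M1 : 0 < M + 1 by lra.
have : \forall y \near nbhs x, enorm (x - y) < e / (M + 1).
  have c := @continuous_sub_comp _ x (@continuous_enorm R n) x.
  have := cvgr_lt _ c (e / (M + 1)); apply.
  by rewrite subrr enorm0 divr_gt0.
apply: filterS => y; rewrite ltr_pdivlMr// mulrDr mulr1 => hy.
have e1 := enorm_ge0 (x - y).
have e2 : enorm (y - x) = enorm (x - y) by rewrite -enormN opprB.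
have := lip x y; have := lip y x; rewrite e2 ler_norml => h1 h2.
by apply/andP; split; lra.
Qed.

Lemma support_oppD_ge0 x : 0 <= h x + h (- x).
Proof.
have [y Ky] := K0; have := dot_le_support x Ky; have := dot_le_support (- x) Ky.
rewrite dotNl; lra.
Qed.

Lemma support_oppD_gt0 : nontrivial_body K ->
  exists2 x, S x & 0 < h x + h (- x).
Proof.
move=> [a [b [Ka Kb ab]]]; pose x := direction (a - b).
have ab0 : a - b != 0 by rewrite subr_eq0; apply/eqP.
exists x; first exact: direction_sphere.
apply: (@lt_le_trans _ _ (dot x (a - b))).
  rewrite /x /direction dotZl mulr_gt0 ?invr_gt0 ?enorm_gt0//.
  by rewrite lt_neqAle eq_sym dotxx_eq0 ab0 dotxx_ge0.
have := dot_le_support x Ka; have := dot_le_support (- x) Kb.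
rewrite dotDr dotNr dotNl; lra.
Qed.

(** If [z] were outside, the vector [w] from the point [p] of [K] nearest to [z] would separate
    them: [dot w y <= dot w p < dot w z] on [K]. *)
Lemma support_separation z : convex_set K -> (forall x, dot x z <= h x) -> K z.
Proof.
move=> cvK hz.
have cd : continuous (fun y : V => dot (z - y) (z - y)).
  exact: (@continuous_sub_comp (fun y => dot y y) z (@continuous_dotxx R n)).
have [p /set_mem Kp hp] := compact_EVT_min K0 cK (continuous_subspaceT cd).
pose w := z - p.
have hw y : K y -> dot w (y - p) <= 0.
  move=> Ky; rewrite leNgt; apply/negP => h0.
  pose D := dot (y - p) (y - p); have D0 : 0 <= D by exact: dotxx_ge0.
  (* Moving from [p] towards [y] by the fraction [t] changes the squared distance to [z] by
     [t * t * D - 2 * t * dot w (y - p)], which is negative for this [t]. *)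
  pose t := Num.min 1 (dot w (y - p) / (D + 1)).
  have D1 : 0 < D + 1 by lra.
  have t0 : 0 < t by rewrite lt_min ltr01 divr_gt0.
  have t1 : t <= 1 by rewrite ge_min lexx.
  have Kt : K (p + t *: (y - p)).
    have := cvK y p (Itv01 (ltW t0) t1) (mem_set Ky) (mem_set Kp).
    move=> /set_mem; congr K; apply/rowP => i; rewrite /conv /= !mxE /unstable.onem; ring.
  have := hp _ (mem_set Kt).
  have -> : z - (p + t *: (y - p)) = w - t *: (y - p) by rewrite opprD addrA.
  rewrite -/w !(dotDl w, dotDr _ w, dotNl, dotNr, dotZl, dotZr) -/D.
  rewrite (dotC (y - p) w).
  have tD : t * (D + 1) <= dot w (y - p) by rewrite -ler_pdivlMr// ge_min lexx orbT.
  set d := dot w (y - p) in h0 tD *; set W := dot w w => hW.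
  have : t * (t * D) <= t * d - t * t by rewrite -mulrBr ler_pM2l//; lra.
  have : 0 < t * d by exact: mulr_gt0.
  have : 0 < t * t by exact: mulr_gt0.
  move: hW; lra.
have [w0|w0] := eqVneq w 0; first by rewrite -[z](subrK p) -/w w0 add0r.
exfalso; have := hz w; apply/negP; rewrite -ltNge.
apply: (@le_lt_trans _ _ (dot w p)).
  by apply: support_le => y /hw; rewrite dotDr dotNr; lra.
rewrite -subr_gt0 -dotNr -dotDr -/w.
by rewrite lt_neqAle eq_sym dotxx_eq0 w0 dotxx_ge0.
Qed.

(** As [h (- x)] is the support function of [- K], the hypothesis says that [K] and [c - K] have the
    same one, hence coincide; the centre is [c / 2]. *)
Lemma symmetric_of_support c : convex_set K ->
  (forall x, h x - h (- x) = dot x c) -> symmetric_body K.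
Proof.
move=> cvK hc; pose c' : V := 2^-1 *: c.
have c2 : c' + c' = c.
  by rewrite -scalerDl (_ : 2^-1 + 2^-1 = 1 :> R) ?scale1r//; field.
have refl y : K y -> K (c - y).
  move=> Ky; apply: support_separation => // x.
  rewrite dotDr dotNr -hc; have := dot_le_support (- x) Ky; rewrite dotNl; lra.
have e y : c - y - c' = - (y - c') by rewrite -{1}c2 opprB addrAC addrK.
exists c'; apply/seteqP; split => _ [y Ky <-].
  by exists (c - y); [exact: refl|rewrite e opprK].
by exists (c - y); [exact: refl|rewrite e].
Qed.

End body.

Lemma support_linear_image (A : 'M[R]_n) K x :
  support_function (linear_image A K) x = support_function K (x *m A).
Proof.
congr sup; have e (y : V) : dot x (y *m A^T) = dot (x *m A) y.
  rewrite /dot; under eq_bigr => i _ do rewrite mxE mulr_sumr.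
  under [RHS]eq_bigr => i _ do rewrite mxE mulr_suml.
  rewrite exchange_big; apply: eq_bigr => i _; apply: eq_bigr => j _.
  by rewrite mxE; ring.
apply/seteqP; split.
  by move=> _ [_ [y Ky <-] <-]; exists y.
by move=> _ [y Ky <-]; exists (y *m A^T) => //; exists y.
Qed.

Lemma convex_body_linear_image (A : 'M[R]_n) K :
  convex_body K -> convex_body (linear_image A K).
Proof.
move=> [[y Ky] cK cvK]; split.
- by exists (y *m A^T), y.
- apply: continuous_compact => //; apply: continuous_subspaceT.
  exact: continuous_mulmxr.
- move=> x x' t /set_mem[a Ka <-] /set_mem[b Kb <-]; apply/mem_set.
  have Kc : K (t%:num *: a + (1 - t%:num) *: b).
    by have /set_mem := cvK a b t (mem_set Ka) (mem_set Kb).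
  exists (t%:num *: a + (1 - t%:num) *: b) => //.
  by rewrite mulmxDl -!scalemxAl.
Qed.

Lemma nontrivial_linear_image (A : 'M[R]_n) K : A \in unitmx ->
  nontrivial_body K -> nontrivial_body (linear_image A K).
Proof.
move=> uA [x [y [Kx Ky xy]]]; exists (x *m A^T), (y *m A^T); split.
- by exists x.
- by exists y.
- move=> h; apply: xy.
  have uT : A^T \in unitmx by rewrite unitmx_tr.
  by rewrite -[x](mulmxK uT) h mulmxK.
Qed.

Lemma symmetric_linear_image (A : 'M[R]_n) K : A \in unitmx ->
  symmetric_body (linear_image A K) -> symmetric_body K.
Proof.
move=> uA [c /seteqP[h1 h2]].
have uT : A^T \in unitmx by rewrite unitmx_tr.
exists (c *m invmx A^T); apply/seteqP; split => _ [x Kx <-].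
  have [|_ [y Ky <-] e] := h1 (x *m A^T - c).
    by exists (x *m A^T) => //; exists x.
  exists y => //; rewrite -[x](mulmxK uT) -[y](mulmxK uT) -!mulmxBl -mulNmx.
  by rewrite e.
have [|_ [y Ky <-] e] := h2 (- (x *m A^T - c)).
  by exists (x *m A^T) => //; exists x.
exists y => //; rewrite -[x](mulmxK uT) -[y](mulmxK uT) -!mulmxBl -mulNmx.
by rewrite e.
Qed.

Lemma nonsymmetric_nontrivial K : K !=set0 -> ~ symmetric_body K -> nontrivial_body K.
Proof.
move=> [y Ky] nsym; apply: contrapT => ntriv; apply: nsym; exists y.
have Ke x : K x -> x = y.
  by move=> Kx; apply: contrapT => xy; apply: ntriv; exists x, y.
by apply/seteqP; split => _ [x /Ke -> <-]; exists y => //; rewrite subrr oppr0.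
Qed.

End support_functions.

(** * Harmonic projections *)

Section projection.
Context {R : realType} {n : nat}.
Local Notation V := 'rV[R]_n.
Local Notation poly := (mpoly n R).
Local Notation S := (unit_sphere R n).
Implicit Types (f : V -> R) (p q : poly).

Definition linear_pred (W : poly -> Prop) :=
  W 0 /\ forall c p q, W p -> W q -> W (c *: p + q).

(** The linear span as the intersection of all subspaces containing [s]: its elements inherit every
    linear property of the generators. *)
Definition spanned (s : seq poly) p :=
  forall W, linear_pred W -> (forall q, q \in s -> W q) -> W p.

Let orthogonal_to f q := sint (fun x => f x * peval q x) = 0.

Let linear_pred_orthogonal f : continuous f -> linear_pred (orthogonal_to f).
Proof.
rewrite /orthogonal_to => cf; have cp q := @continuous_peval R n q; split.
  by rewrite -[RHS](@sint0 R n); congr sint; apply/funext => x; rewrite peval0 mulr0.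
move=> c p q hp hq.
transitivity (c * sint (fun x => f x * peval p x) + sint (fun x => f x * peval q x));
  last by rewrite hp hq mulr0 addr0.
rewrite -sintZ; last exact: fun_continuousM.
rewrite -sintD; last exact: fun_continuousM.
  by congr sint; apply/funext => x; rewrite pevalD pevalZ; ring.
by apply: fun_continuousM; [exact: cst_continuous|exact: fun_continuousM].
Qed.

Lemma linear_pred_harmonic m : linear_pred (@harmonic_poly R n m).
Proof.
split; first exact: harmonic0.
by move=> c p q hp hq; apply: harmonicD => //; exact: harmonicZ.
Qed.

(** Gram-Schmidt orthogonalization. The induction hypothesis is used both for [f] and for the new
    generator [a], whose component [e] orthogonal to the span of [s] supplies the correction. *)
Lemma spanned_projection (s : seq poly) f : continuous f ->
  exists2 p0, spanned s p0 &
    forall q, spanned s q -> sint (fun x => (f x - peval p0 x) * peval q x) = 0.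
Proof.
have cp q := @continuous_peval R n q.
elim: s f => [|a s IHs] f cf.
  exists 0; first by move=> W [].
  move=> q hq; apply: (hq (orthogonal_to (fun x => f x - peval 0 x))) => //.
  by apply: linear_pred_orthogonal; exact: fun_continuousB.
have sub p : spanned s p -> spanned (a :: s) p.
  by move=> sp W lW hW; apply: sp => // q qs; apply: hW; rewrite inE qs orbT.
have [b sb hb] := IHs _ (cp a).
have [p1 sp1 hp1] := IHs _ cf.
pose e := a - b.
have se : spanned (a :: s) e.
  move=> W lW hW; rewrite /e addrC -scaleN1r; apply: (lW.2).
    exact: (sub _ sb W lW hW).
  by apply: hW; rewrite inE eqxx.
have eE x : peval e x = peval a x - peval b x by rewrite pevalB.
have es q : spanned s q -> sint (fun x => peval e x * peval q x) = 0.
  move=> /hb <-; congr sint; apply/funext => x; by rewrite eE.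
have [c hc] : exists c, sint (fun x => (f x - peval (p1 + c *: e) x) * peval e x) = 0.
  pose I := sint (fun x => peval e x * peval e x).
  (* Nonzero polynomials may vanish on the sphere, so [e] can have norm 0; then it is 0 on the
     sphere and any coefficient works. *)
  have [I0|I0] := eqVneq I 0.
    have e0 u : S u -> peval e u = 0.
      move=> Su; apply/eqP/negP => /negP eu.
      have : 0 < I.
        apply: (@sint_gt0 _ _ _ u) => //; first exact: fun_continuousM.
          by move=> x _; rewrite -expr2 sqr_ge0.
        by rewrite -expr2 lt_neqAle eq_sym sqrf_eq0 eu sqr_ge0.
      by rewrite I0 ltxx.
    exists 0; rewrite -[RHS](@sint0 R n); apply: eq_sint => x Sx.
    by rewrite (e0 _ Sx) mulr0.
  pose J := sint (fun x => (f x - peval p1 x) * peval e x).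
  pose c := J / I; exists c.
  have cJ : continuous (fun x => (f x - peval p1 x) * peval e x).
    by apply: fun_continuousM => //; exact: fun_continuousB.
  transitivity (J - c * I); last by rewrite /c divfK// subrr.
  have cee : continuous (fun x => peval e x * peval e x) by exact: fun_continuousM.
  have ccee := fun_continuousM (@cst_continuous V R c) cee.
  transitivity (J - sint (fun x => c * (peval e x * peval e x))).
    rewrite -[RHS](sintB cJ ccee).
    by congr sint; apply/funext => x; rewrite pevalD pevalZ /cst; ring.
  by rewrite (sintZ c cee).
exists (p1 + c *: e).
  move=> W lW hW; rewrite addrC; apply: (lW.2); first exact: (se W lW hW).
  exact: (sub _ sp1 W lW hW).
have cr : continuous (fun x => f x - peval (p1 + c *: e) x) by exact: fun_continuousB.
have hs q : spanned s q ->
    sint (fun x => (f x - peval (p1 + c *: e) x) * peval q x) = 0.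
  move=> sq; have h1 := hp1 q sq; have h2 := es q sq.
  transitivity (sint (fun x => (f x - peval p1 x) * peval q x) -
     c * sint (fun x => peval e x * peval q x)); last by rewrite h1 h2 mulr0 subr0.
  rewrite -sintZ; last exact: fun_continuousM.
  rewrite -sintB; last 2 first.
  - by apply: fun_continuousM => //; exact: fun_continuousB.
  - by apply: fun_continuousM; [exact: cst_continuous|exact: fun_continuousM].
  by congr sint; apply/funext => x; rewrite pevalD pevalZ; ring.
move=> q hq; apply: (hq (orthogonal_to _) (linear_pred_orthogonal cr)) => {hq}q.
rewrite inE => /predU1P[->|qs]; last by apply: hs => W _; apply.
have [_ lin] := linear_pred_orthogonal cr.
have -> : a = 1 *: e + b by rewrite scale1r /e subrK.
by apply: lin => //; exact: hs.
Qed.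

End projection.

(** * Finite dimension and existence of the projections *)

Section finite_dimension.
Context {R : realType}.

(** A subspace of maximal dimension among those inside [W] exhausts [W], since a missing vector
    could be added to it. *)
Lemma exists_vspace (vT : vectType R) (W : vT -> Prop) : W 0 ->
  (forall c u v, W u -> W v -> W (c *: u + v)) ->
  exists U : {vspace vT}, forall v, v \in U <-> W v.
Proof.
move=> W0 lW.
pose P d := `[< exists2 U : {vspace vT}, \dim U = d & forall v, v \in U -> W v >].
have P0 : exists d, P d.
  exists 0%N; apply/asboolP; exists 0%VS; first exact: dimv0.
  by move=> v; rewrite memv0 => /eqP ->.
have Pb d : P d -> (d <= \dim {:vT})%N.
  by move=> /asboolP[U <- _]; apply: dimvS; exact: subvf.
have [d /asboolP[U dU UW] dmax] := ex_maxnP P0 Pb.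
exists U => v; split; first exact: UW.
move=> Wv; apply: contrapT => /negP vU.
have : P (\dim (U + <[v]>)%VS).
  apply/asboolP; exists (U + <[v]>)%VS => // _ /memv_addP[u uU [_ /vlineP[k ->] ->]].
  by rewrite addrC; apply: lW => //; exact: UW.
move=> /dmax; rewrite leqNgt -dU => /negP; apply.
rewrite ltn_neqAle dimvS ?addvSl// andbT; apply: contra vU => /eqP h.
have /eqP -> : U == (U + <[v]>)%VS by rewrite eqEdim addvSl h leqnn.
by rewrite -[X in X \in _]add0r memv_add ?mem0v ?memv_line.
Qed.

Lemma harmonic_spanning_seq n m : exists2 s : seq (mpoly n.+1 R),
  (forall q, q \in s -> harmonic_poly m q) &
  (forall q, harmonic_poly m q -> spanned s q).
Proof.
pose vT : vectType R := dhomog n.+1 R m.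
pose W (v : vT) := harmonic_poly m (mpoly_of_dhomog v).
have [W0 lW] := @linear_pred_harmonic R n.+1 m.
have [U hU] := @exists_vspace vT W W0 (fun c u v => lW c _ _).
exists [seq mpoly_of_dhomog v | v <- vbasis U].
  by move=> q /mapP[v vU ->]; apply/(hU v).1; exact: vbasis_mem.
move=> q hq W' [W'0 lW'] h.
have [hom _] := hq; pose v : vT := DHomog hom.
have vU : v \in U by apply/hU.
have -> : q = mpoly_of_dhomog v by [].
rewrite (coord_vbasis vU) raddf_sum /=.
elim/big_ind : _ => //; first by move=> p1 p2 h1 h2; rewrite -[p1]scale1r; exact: lW'.
move=> i _; rewrite -[X in W' X]addr0; apply: lW' => //.
by apply: h; apply/mapP; exists (vbasis U)`_i => //; rewrite mem_nth// size_tuple.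
Qed.

Lemma exists_harmonic_projection n m (f : 'rV[R]_n.+1 -> R) : continuous f ->
  exists2 p0, harmonic_poly m p0 & forall q, harmonic_poly m q ->
    sint (fun x => (f x - peval p0 x) * peval q x) = 0.
Proof.
move=> cf; have [s hs sp] := harmonic_spanning_seq n m.
have [p0 sp0 h0] := spanned_projection s cf.
exists p0; first by apply: sp0 => //; exact: linear_pred_harmonic.
by move=> q /sp; exact: h0.
Qed.

Lemma harmonic_proj_neq0 n m (f : 'rV[R]_n.+1 -> R) p : continuous f ->
  harmonic_poly m p -> sint (fun x => f x * peval p x) <> 0 ->
  harmonic_proj m (f \_ (unit_sphere R n.+1)) <> 0.
Proof.
move=> cf hp fp; rewrite /harmonic_proj.
have [p0 hp0 h0] := exists_harmonic_projection m cf.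
(* The default of [xget] is 0, the very value to be excluded, so the existence of a projection has
   to be established. *)
set D := [set g | _]; suff : D (xget 0 D).
  move=> [_ hx] x0; apply: fp; rewrite x0 subr0 in hx.
  have := hx (peval p \_ (unit_sphere R n.+1)) _.
  rewrite /sphere_dot => <-; last by exists p.
  by apply: eq_Rintegral => x xS; rewrite !patchE xS.
apply: (@xgetPex _ 0); exists (peval p0 \_ (unit_sphere R n.+1)); split.
  by exists p0.
move=> _ [q hq <-]; rewrite -[RHS](h0 q hq) /sphere_dot.
apply: eq_Rintegral => x xS.
by rewrite /GRing.add /= /GRing.opp /= !patchE xS.
Qed.

End finite_dimension.

(** * Generic linear images *)

Section linear_orbit.
Context {R : realType} {n : nat}.
Local Notation V := 'rV[R]_n.
Implicit Types (f : V -> R) (O : set 'M[R]_n).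

Lemma open_ball_mx O A : open O -> O A ->
  exists2 r : R, 0 < r & forall A', `|A - A'| < r -> O A'.
Proof.
move=> oO OA; have : nbhs A O by exact: open_nbhs_nbhs.
by move=> /nbhs_normP[r /= r0 hr]; exists r.
Qed.

(** For a support function [f] of [K], the function [f (u *m A)] is that of the image of [K] under
    [A]; this property is to be refuted on every nonempty open set of invertible matrices. *)
Definition orbit_annihilates O f m :=
  forall A, O A -> annihilates (fun u => f (u *m A)) m.

Variables (O : set 'M[R]_n) (f : V -> R).
Hypotheses (oO : open O) (cf : continuous f) (hf : pos_homogeneous 1 f).

(** As [O] is open, it contains the products of [A] with all elementary matrices close to 1, which
    is the variation that [sint_shear_vanishing] requires. *)
Lemma orbit_flux m : orbit_annihilates O f m ->
  forall A, O A -> flux_annihilates (fun u => f (u *m A)) m.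
Proof.
move=> hm A OA i j p hp; have [r r0 hr] := open_ball_mx oO OA.
pose N := `|delta_mx i j *m A|; have N0 : 0 <= N by exact: normr_ge0.
(* For [|s| < 1/2] the inverse of [elem_mx i j s] has a parameter of size at most [2 * |s|], so [A]
   is displaced by at most [2 * |s| * N < r]. *)
have ep0 : 0 < Num.min 2^-1 (r / (2 * (N + 1))).
  by rewrite lt_min invr_gt0 ltr0n divr_gt0// mulr_gt0//; lra.
apply: (@sint_shear_vanishing _ _ (fun u => f (u *m A)) 1 p m i j _ _ _ _ hp.1 ep0).
- by [].
- exact: continuous_mulmxr_comp.
- by move=> t x t0; rewrite -scalemxAl hf.
move=> s; rewrite lt_min => /andP[s1 s2].
set B := invmx _; rewrite (_ : (fun u => _) = (fun u => f (u *m (B *m A)) * peval p u)).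
  apply: (hm (B *m A)) => //; apply: hr.
  rewrite /B invmx_elem_mx; last by lra.
  set t := - s / _; rewrite /elem_mx mulmxDl mul1mx opprD addrA subrr sub0r normrN.
  rewrite -scalemxAl normrZ -/N.
  have ht : `|t| <= 2 * `|s|.
    have d0 : 2^-1 <= `|1 + s * (i == j)%:R|.
      move: s1; rewrite ltr_norml => /andP[h1 h2].
      have h3 : 2^-1 <= 1 + s * (i == j)%:R by case: (i == j) => /=; lra.
      by apply: le_trans h3 _; exact: ler_norm.
    have d1 : 0 < `|1 + s * (i == j)%:R| by lra.
    rewrite /t normrM normfV normrN ler_pdivrMr// mulrC mulrA -[leLHS]mul1r.
    by rewrite ler_wpM2r//; lra.
  apply: (@le_lt_trans _ _ (2 * `|s| * N)); first by rewrite ler_wpM2r.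
  have h4 : 0 < 2 * (N + 1) by lra.
  move: s2; rewrite ltr_pdivlMr// => s2.
  have : 0 <= `|s| by [].
  lra.
by apply/funext => u; rewrite mulmxA.
Qed.

Lemma orbit_raise m k : orbit_annihilates O f m ->
  orbit_annihilates O f (m + 2 * k).
Proof.
move=> hm; elim: k => [|k IHk]; first by rewrite muln0 addn0.
rewrite mulnS addnCA add2n => A OA; apply: annihilates_raise; last exact: orbit_flux.
exact: continuous_mulmxr_comp.
Qed.

Lemma orbit_lower k : (1 < n)%N -> k != 1%N -> orbit_annihilates O f k.+2 ->
  orbit_annihilates O f k.
Proof.
move=> n1 k1 hk A OA; apply: annihilates_lower => //; last exact: orbit_flux.
exact: continuous_mulmxr_comp.
Qed.

Lemma orbit_lower_even m : (1 < n)%N -> ~~ odd m -> orbit_annihilates O f m ->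
  orbit_annihilates O f 0.
Proof.
move=> n1 em; rewrite -(odd_double_half m) (negbTE em) add0n.
(* The degrees reached are doubles, so the excluded degree 1 never occurs. *)
elim: m./2 => // k IHk; rewrite doubleS => /orbit_lower h; apply: IHk; apply: h => //.
by case: k => // k; rewrite doubleS.
Qed.

(** The degree is first raised by [2 * k], beyond [k], and then lowered in steps of two; the descent
    ends at [k > 1], before the exceptional degree. *)
Lemma orbit_all_odd m k : (1 < n)%N -> odd m -> odd k -> (1 < k)%N ->
  orbit_annihilates O f m -> orbit_annihilates O f k.
Proof.
move=> n1 om ok k1 /(@orbit_raise _ k).
have -> : (m + 2 * k = k + 2 * ((m + k)./2))%N.
  have := odd_double_half (m + k); rewrite oddD om ok /= add0n => e.
  by rewrite [in RHS]mul2n e mul2n -addnn addnA addnC addnCA.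
elim: (_./2) => [|l IHl]; first by rewrite muln0 addn0.
rewrite mulnS addnCA add2n => h; apply: IHl; apply: orbit_lower => //.
by rewrite gtn_eqF// (leq_trans k1)// leq_addr.
Qed.

End linear_orbit.

Section nonvanishing.
Context {R : realType} {n : nat}.
Local Notation V := 'rV[R]_n.
Implicit Types (K : set V).

Lemma not_annihilates_support0 K : K !=set0 -> compact K -> nontrivial_body K ->
  ~ annihilates (support_function K) 0.
Proof.
move=> K0 cK ntK; set h := support_function K => hann.
have ch : continuous h by exact: continuous_support.
have ch' : continuous (fun x : V => h (- x)).
  by move=> x; apply: continuous_comp; [exact: opp_continuous|exact: ch].
have h1 : harmonic_poly 0 (1 : mpoly n R).
  split; first exact: dhomog1.
  apply: big1 => i _; rewrite (_ : mderiv i 1 = 0) ?mderiv0//.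
  by have := mderivC i (1 : R); rewrite mpolyC1.
have I0 : sint h = 0.
  rewrite -[RHS](hann 1 h1); congr sint; apply/funext => x.
  by rewrite peval1 mulr1.
have [u Su hu] := support_oppD_gt0 K0 cK ntK.
have : 0 < sint (fun x => h x + h (- x)).
  apply: (@sint_gt0 _ _ _ u) => //; first exact: fun_continuousD.
  by move=> x _; exact: support_oppD_ge0.
by rewrite sintD// sint_opp// I0 addr0 ltxx.
Qed.

Lemma sint_odd (F : V -> R) : continuous F -> (forall x, F (- x) = - F x) ->
  sint F = 0.
Proof.
move=> cF oF; have : sint F = - sint F.
  rewrite -{1}sint_opp// -mulN1r -sintZ//; congr sint; apply/funext => x.
  by rewrite oF mulN1r.
by lra.
Qed.

Lemma peval_opp d (p : mpoly n R) (x : V) : homogeneous d p ->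
  peval p (- x) = (-1) ^+ d * peval p x.
Proof. by move=> hp; rewrite -scaleN1r (peval_homogeneous _ _ hp). Qed.

End nonvanishing.

Section symmetric.
Context {R : realType} {n : nat}.
Local Notation V := 'rV[R]_n.+1.
Local Notation S := (unit_sphere R n.+1).

(** [f] is twice the odd part of [h] minus its projection [q] on degree 1. It is orthogonal to even
    degrees by parity, to degree 1 by the choice of [q], and to the other odd degrees by hypothesis
    and since harmonics of distinct degrees are orthogonal. Hence it vanishes. *)
Lemma symmetric_of_annihilates (K : set V) : (0 < n)%N -> convex_body K ->
  (forall k, odd k -> (1 < k)%N -> annihilates (support_function K) k) ->
  symmetric_body K.
Proof.
move=> n1 [K0 cK cvK]; set h := support_function K => hann.
have ch : continuous h by exact: continuous_support.
have hh : pos_homogeneous 1 h by exact: support_pos_homogeneous.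
have ch' : continuous (fun x : V => h (- x)).
  by move=> x; apply: continuous_comp; [exact: opp_continuous|exact: ch].
pose G x := h x - h (- x).
have cG : continuous G by exact: fun_continuousB.
have [q hq hGq] := exists_harmonic_projection 1 cG.
have cp p := @continuous_peval R n.+1 p.
(* The derivatives of [q] are homogeneous of degree 0, hence constant: their values at 0 form the
   gradient. *)
pose c : V := \row_i peval (mderiv i q) 0.
have qE x : peval q x = dot x c.
  have := euler_homogeneous hq.1; rewrite scale1r => <-.
  rewrite peval_sum; apply: eq_bigr => i _; rewrite pevalM peval_var mxE.
  have := peval_homogeneous 0 x (homogeneous_mderiv i hq.1).
  by rewrite scale0r expr0 mul1r => ->.
pose f x := G x - peval q x.
have cF : continuous f by exact: fun_continuousB.
have fodd x : f (- x) = - f x.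
  by rewrite /f /G opprK !qE dotNl; ring.
have fann k : annihilates f k.
  move=> Q hQ; have cfQ : continuous (fun x => f x * peval Q x) by exact: fun_continuousM.
  have [ok|ek] := boolP (odd k); last first.
    apply: sint_odd => // x; rewrite fodd (peval_opp _ hQ.1) -signr_odd (negbTE ek).
    by rewrite expr0 mul1r mulNr.
  have [k1|k1] := eqVneq k 1%N; first by rewrite k1 in hQ; exact: hGq.
  have k2 : (1 < k)%N by rewrite ltn_neqAle eq_sym k1/=; case: (k) ok.
  have e1 : sint (fun x => h x * peval Q x) = 0 by exact: hann ok k2 _ hQ.
  have e2 : sint (fun x => h (- x) * peval Q x) = 0.
    rewrite -(mulr0 (-1)) -e1 -[in RHS]sint_opp; last exact: fun_continuousM.
    rewrite -sintZ.
      congr sint; apply/funext => x; rewrite (peval_opp _ hQ.1) -signr_odd ok expr1.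
      by ring.
    apply: fun_continuousM => //; move=> x.
    by apply: continuous_comp; [exact: opp_continuous|exact: cp].
  have e3 : sint (fun x => peval q x * peval Q x) = 0.
    apply: (@sint_harmonicM _ _ 1 k) => //; first exact: ltnW.
    by rewrite eq_sym.
  transitivity (sint (fun x => h x * peval Q x) - sint (fun x => h (- x) * peval Q x)
    - sint (fun x => peval q x * peval Q x)); last by rewrite e1 e2 e3 !subr0.
  rewrite -sintB; try exact: fun_continuousM.
  rewrite -sintB; try exact: fun_continuousM.
    by congr sint; apply/funext => x; rewrite /f /G; ring.
  by apply: fun_continuousB; exact: fun_continuousM.
have f0 v : S v -> f v = 0.
  apply: polynomials_total => // p; exact: annihilates_polynomials.
(* Both sides are positively homogeneous of degree 1, which extends the equality from the sphere to
   the whole space. *)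
have GE x : G x = dot x c.
  have [->|x0] := eqVneq x 0; first by rewrite /G oppr0 subrr dot0l.
  have := f0 _ (direction_sphere x0); rewrite /f qE => /eqP; rewrite subr_eq0 => /eqP.
  rewrite /G /direction -scalerN !hh ?invr_ge0 ?enorm_ge0// !expr1 dotZl -mulrBr.
  by apply: mulfI; rewrite invr_eq0 enorm_eq0.
exact: (@symmetric_of_support _ _ K K0 cK c cvK).
Qed.

End symmetric.

(** Baire's theorem is applied in the space of matrices, as a complete normed space. *)
HB.instance Definition _ (R : realType) m n := Complete.on 'M[R]_(m, n).

(** * The Baire category argument *)

Section generic_transformations.
Context {R : realType} {n : nat}.
Local Notation V := 'rV[R]_n.
Local Notation S := (unit_sphere R n).
Implicit Types (K : set V) (p : mpoly n R).

Lemma enorm_mulmx_le (u : V) (A : 'M[R]_n) : S u ->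
  enorm (u *m A) <= (n * n)%:R * `|A|.
Proof.
move=> Su; apply: le_trans (enorm_le_sum _) _.
have h j : `|(u *m A) 0 j| <= `|A| *+ n.
  rewrite mxE; apply: le_trans (ler_norm_sum _ _ _) _.
  apply: (@le_trans _ _ (\sum_(i < n) `|A|)); last by rewrite sumr_const card_ord.
  apply: ler_sum => i _; rewrite normrM -[leRHS]mul1r; apply: ler_pM => //.
    by rewrite -(Su : enorm u = 1) coord_le_enorm.
  by rewrite [leRHS]/Num.norm/= mx_normrE; apply/bigmax_geP; right; exists (i, j).
apply: (@le_trans _ _ (\sum_(j < n) `|A| *+ n)); first exact: ler_sum.
by rewrite sumr_const card_ord -mulrnA mulr_natl.
Qed.

(** Exchanging [A] and [B] makes this a Lipschitz bound in the matrix. It comes from the Lipschitz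
    constant of the support function and the boundedness of [p] on the sphere. *)
Lemma sint_support_lipschitz K p : K !=set0 -> compact K ->
  exists2 C, 0 <= C & forall A B : 'M[R]_n,
  sint (fun u : V => support_function K (u *m A) * peval p u) <=
  sint (fun u : V => support_function K (u *m B) * peval p u) + C * `|A - B|.
Proof.
move=> K0 cK; set h := support_function K.
have ch : continuous h by exact: continuous_support.
have [M M0 hM] := support_lipschitz K0 cK.
have cp := @continuous_peval R n p.
have [C hC] := continuous_sphere_bounded cp.
exists (`|C| * ((n * n)%:R * M) * `|sint (fun _ : V => 1)|) => [|A B].
  by rewrite !mulr_ge0.
have cF A' : continuous (fun u : V => h (u *m A') * peval p u).
  by apply: fun_continuousM => //; exact: continuous_mulmxr_comp.
pose c := `|C| * ((n * n)%:R * M) * `|A - B|.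
have c1 : continuous (fun _ : V => 1 : R) by exact: cst_continuous.
have cc : continuous (fun _ : V => c * 1) by exact: cst_continuous.
apply: (@le_trans _ _ (sint (fun u : V => h (u *m B) * peval p u + c * 1))).
  apply: le_sint => //; first exact: fun_continuousD.
  move=> u Su; rewrite -lerBlDl -mulrBl; apply: le_trans (ler_norm _) _.
  rewrite normrM mulrC mulr1 /c -mulrA; apply: ler_pM => //.
    by apply: le_trans (hC u Su) _; exact: ler_norm.
  have hAB A' B' : h (u *m A') - h (u *m B') <= (n * n)%:R * `|A' - B'| * M.
    rewrite lerBlDl; apply: le_trans (hM _ (u *m B')) _; rewrite lerD2l ler_wpM2r//.
    by rewrite -mulmxBr enorm_mulmx_le.
  by rewrite [leRHS]mulrAC ler_norml hAB andbT lerNl opprB distrC hAB.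
by rewrite sintD// sintZ// lerD2l /c [leRHS]mulrAC ler_wpM2l ?mulr_ge0// ler_norm.
Qed.

Lemma open_sint_support_neq0 K p : K !=set0 -> compact K ->
  open [set A : 'M[R]_n |
    sint (fun u : V => support_function K (u *m A) * peval p u) <> 0].
Proof.
move=> K0 cK; have [C C0 hC] := sint_support_lipschitz p K0 cK.
pose F (A : 'M[R]_n) := sint (fun u : V => support_function K (u *m A) * peval p u).
rewrite openE => A /=; rewrite -/(F A) => /eqP FA.
change (nbhs A [set A' | F A' <> 0]).
suff : exists2 e : R, 0 < e & forall B, `|A - B| < e -> F B <> 0.
  by move=> [e e0 he]; apply: (@nbhs_normP R 'M[R]_n A _).2; exists e.
have FA0 : 0 < `|F A| by rewrite normr_gt0.
exists (`|F A| / (C + 1)); first by rewrite divr_gt0//; lra.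
move=> B; rewrite ltr_pdivlMr; last lra.
move=> hB FB; have := hC A B; have := hC B A.
rewrite -/(F A) -/(F B) FB distrC.
have := normr_ge0 (A - B).
by move: FA0 hB; have [?|?] := ger0P (F A); nra.
Qed.

Lemma open_GL : open (GL R n).
Proof.
rewrite (_ : GL R n = [set A | \det A != 0]); last first.
  by apply/seteqP; split => A /=; rewrite /GL /= unitmxE unitfE.
apply: (@open_comp _ _ (fun A : 'M[R]_n => \det A) [set x | x != 0]) => [A _|].
  move: A; apply: (@continuous_sum R 'M[R]_n) => s.
  apply: fun_continuousM; first exact: cst_continuous.
  by apply: (@continuous_prod R 'M[R]_n) => i; exact: coord_continuous.
exact: open_neq.
Qed.

End generic_transformations.

Section exists_generic.
Context {R : realType} {n : nat}.
Implicit Types (K : set 'rV[R]_n.+1) (O U : set 'M[R]_n.+1).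

Lemma exists_harmonic_proj_neq0 (D : pred nat) K U : convex_body K ->
  (forall m O, D m -> open O -> O !=set0 -> O `<=` GL R n.+1 ->
    ~ orbit_annihilates O (support_function K) m) ->
  within (GL R n.+1) (nbhs (1%:M : 'M[R]_n.+1)) U ->
  exists2 A, U A & forall m, D m ->
    harmonic_proj m (support_function (linear_image A K) \_ (unit_sphere R n.+1)) <> 0.
Proof.
move=> [K0 cK cvK] hO hU.
have : nbhs (1%:M : 'M[R]_n.+1) (GL R n.+1 `&` U).
  have hG : nbhs (1%:M : 'M[R]_n.+1) (GL R n.+1).
    by apply: open_nbhs_nbhs; split; [exact: open_GL|exact: unitmx1].
  by apply: filterS2 hG hU => A GA UA; split=> //; exact: UA.
move=> /(@nbhs_normP R 'M[R]_n.+1)[e /= e0 he].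
pose G m := [set A : 'M[R]_n.+1 | exists2 p : mpoly n.+1 R, harmonic_poly m p &
  sint (fun u : 'rV_n.+1 => support_function K (u *m A) * peval p u) <> 0].
(* Baire's theorem needs sets dense among all matrices, while [G m] is known to be dense only near
   the identity. The open set [far] covers the rest; the matrix found at distance less than [e / 2]
   from the identity is not in it. *)
pose far := [set A : 'M[R]_n.+1 | e / 2 < `|1%:M - A|].
pose F m := if D m then G m `|` far else setT.
have oG m : open (G m).
  rewrite (_ : G m = \bigcup_(p in [set p | harmonic_poly m p]) [set A : 'M[R]_n.+1 |
    sint (fun u : 'rV_n.+1 => support_function K (u *m A) * peval p u) <> 0]) //.
  by apply: bigcup_open => p _; exact: open_sint_support_neq0.
have ofar : open far.
  apply: (@open_comp _ _ (fun A : 'M[R]_n.+1 => `|1%:M - A|) [set x | e / 2 < x]).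
    move=> A _; apply: continuous_comp; last exact: norm_continuous.
    by apply: continuousB; [exact: cst_continuous|].
  exact: open_gt.
have FP m : open (F m) /\ dense (F m).
  rewrite /F; case: ifP => Dm; last first.
    by split; [exact: openT|move=> O [A OA] _; exists A].
  split; first exact: openU.
  (* An open set that misses [G m] and [far] lies within [e / 2] of the identity, hence in [GL], and
     all its elements annihilate degree [m]. *)
  move=> O [A OA] oO; apply: contrapT => hn.
  have Ofar B : O B -> `|1%:M - B| <= e / 2.
    by move=> OB; rewrite leNgt; apply/negP => fB; apply: hn; exists B; split=> //; right.
  apply: (hO m O Dm oO) => [|B OB|B OB p hp]; first by exists A.
    by apply: (he B _).1; rewrite /=; have := Ofar B OB; lra.
  by apply: contrapT => Bp; apply: hn; exists B; split=> //; left; exists p.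
have oB : open [set A : 'M[R]_n.+1 | `|1%:M - A| < e / 2].
  apply: (@open_comp _ _ (fun A : 'M[R]_n.+1 => `|1%:M - A|) [set x | x < e / 2]).
    move=> A _; apply: continuous_comp; last exact: norm_continuous.
    by apply: continuousB; [exact: cst_continuous|].
  exact: open_lt.
have [|A [/= hA FA]] := Baire FP _ oB.
  by exists 1%:M; rewrite /= subrr normr0 divr_gt0.
exists A => [|m Dm]; first by apply: (he A _).2; rewrite /=; lra.
have : F m A by exact: FA.
rewrite /F Dm => -[[p hp hs]|]; last by rewrite /far/= ltNge ltW.
have -> : support_function (linear_image A K) = fun u => support_function K (u *m A).
  by apply/funext => u; exact: support_linear_image.
apply: harmonic_proj_neq0 hs => //.
by apply: continuous_mulmxr_comp; exact: continuous_support.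
Qed.

Lemma not_orbit_annihilates_even K m O : (0 < n)%N -> convex_body K ->
  nontrivial_body K -> ~~ odd m -> open O -> O !=set0 -> O `<=` GL R n.+1 ->
  ~ orbit_annihilates O (support_function K) m.
Proof.
move=> n0 cvK ntK em oO [A OA] OG hm; have [K0 cK _] := cvK.
have h0 : orbit_annihilates O (support_function K) 0.
  apply: orbit_lower_even em hm => //; first exact: continuous_support.
  exact: support_pos_homogeneous.
have [AK0 cAK _] := convex_body_linear_image A cvK.
apply: (not_annihilates_support0 AK0 cAK).
  by apply: nontrivial_linear_image => //; exact: OG.
rewrite (_ : support_function _ = fun u => support_function K (u *m A)).
  exact: h0.
by apply/funext => u; exact: support_linear_image.
Qed.

Lemma not_orbit_annihilates_odd K m O : (0 < n)%N -> convex_body K ->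
  ~ symmetric_body K -> odd m -> open O -> O !=set0 -> O `<=` GL R n.+1 ->
  ~ orbit_annihilates O (support_function K) m.
Proof.
move=> n0 cvK nsK om oO [A OA] OG hm; have [K0 cK _] := cvK.
apply: nsK; apply: (@symmetric_linear_image _ _ A); first exact: OG.
apply: symmetric_of_annihilates => // [|k ok k1].
  exact: convex_body_linear_image.
rewrite (_ : support_function _ = fun u => support_function K (u *m A)).
  apply: (@orbit_all_odd _ _ O _ _ _ _ m k) => //; first exact: continuous_support.
  exact: support_pos_homogeneous.
by apply/funext => u; exact: support_linear_image.
Qed.

End exists_generic.

Theorem theorem3 (R : realType) (n : nat) (hn : (2 <= n)%N) :
  (forall K : set 'rV[R]_n, convex_body K -> ~ symmetric_body K ->
    forall U : set 'M[R]_n, U `<=` GL R n ->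
      within (GL R n) (nbhs (1%:M : 'M[R]_n)) U ->
      exists2 A : 'M[R]_n, U A & universal (linear_image A K))
  /\
  (forall K : set 'rV[R]_n, convex_body K -> nontrivial_body K ->
    forall U : set 'M[R]_n, U `<=` GL R n ->
      within (GL R n) (nbhs (1%:M : 'M[R]_n)) U ->
      exists2 A : 'M[R]_n, U A & centrally_universal (linear_image A K)).
Proof.
case: n hn => // n n0; split => K cvK hK U _ hU.
  have [m O _ oO O0 OG|A UA hA] := @exists_harmonic_proj_neq0 _ _ predT K U cvK _ hU.
    have [om|em] := boolP (odd m); first exact: not_orbit_annihilates_odd.
    apply: not_orbit_annihilates_even => //; have [K0 _ _] := cvK.
    exact: nonsymmetric_nontrivial.
  by exists A => // m; exact: hA.
have [m O em oO O0 OG|A UA hA] :=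
  @exists_harmonic_proj_neq0 _ _ (fun m => ~~ odd m) K U cvK _ hU.
  exact: not_orbit_annihilates_even.
by exists A.
Qed.
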